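(* Let $\mathcal H$ be a complex separable infinite-dimensional Hilbert space, $T\in L(\mathcal H)$ and $f_0\in\mathcal H$. Then the following statements are equivalent: (i) The system $(T^nf_0)_{n\in\mathbb N}$ is a frame for $\mathcal H$. (ii) $(T,f_0)\cong(A_h,\phi_h)$ for some $h\in\mathfrak I^*\cup\{0\}$. In case these equivalent conditions are satisfied, the function $h$ in (ii) is unique (where inner functions whose quotient is a unimodular constant are identified), and the frame $(T^nf_0)_{n\in\mathbb N}$ is a Riesz basis for $\mathcal H$ if and only if $h=0$.
   Context: $\mathbb N=\{0,1,2,\dots\}$. For Hilbert spaces, $L(\mathcal H_1,\mathcal H_2)$ is the set of bounded linear operators from $\mathcal H_1$ to $\mathcal H_2$, $GL(\mathcal H_1,\mathcal H_2)$ the set of bijective ones, $L(\mathcal H)=L(\mathcal H,\mathcal H)$. A system $(f_n)_{n\in I}$ is a frame for $\mathcal H$ if there are $A,B>0$ with $A\|f\|^2\le\sum_{n\in I}|\langle f,f_n\rangle|^2\le B\|f\|^2$ for all $f\in\mathcal H$. Similarity: for $T_j\in L(\mathcal H_j)$, $f_j\in\mathcal H_j$, $j=1,2$, write $(T_1,f_1)\cong(T_2,f_2)$ if there is $V\in GL(\mathcal H_1,\mathcal H_2)$ with $T_2=VT_1V^{-1}$ and $f_2=Vf_1$. $\mathbb T$ is the unit circle with normalized arc length measure, and $1_{\mathbb T}$ is the constant function $1$ on $\mathbb T$. $L^2_+\subset L^2(\mathbb T)$ is the closed subspace of functions with vanishing negative Fourier coefficients, and $M_{\mathbb T}^+:L^2_+\to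 L^2_+$, $(M_{\mathbb T}^+f)(z)=zf(z)$. $\mathfrak I$ is the set of inner functions, i.e. of $h\in L^2_+$ with $|h(z)|=1$ for a.e. $z\in\mathbb T$ (equivalently, radial limits of inner functions on the open unit disk). $\mathfrak I^*$ is the set of $h\in\mathfrak I$ that are not finite Blaschke products (unimodular constants count as finite Blaschke products). For $h\in\mathfrak I\cup\{0\}$ put $$\mathcal H_h:=L^2_+\ominus hL^2_+,\qquad A_h:=P_{\mathcal H_h}\left(M_{\mathbb T}^+|_{\mathcal H_h}\right)\in L(\mathcal H_h),\qquad \phi_h:=P_{\mathcal H_h}1_{\mathbb T},$$ where $P_M$ denotes the orthogonal projection onto a closed subspace $M$. *)

(* Defs.v *)
From HB Require Import structures.
From mathcomp Require Import all_boot all_order all_algebra.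
From mathcomp Require Import sesquilinear ring_quotient complex.
From mathcomp Require Import all_classical all_reals all_analysis.
From mathcomp Require Import measurable_realfun.

Set Implicit Arguments.
Unset Strict Implicit.
Unset Printing Implicit Defensive.
Import Order.TTheory GRing.Theory Num.Def Num.Theory.
Import numFieldNormedType.Exports.

Local Open Scope classical_set_scope.
Local Open Scope ring_scope.
Local Open Scope quotient_scope.
Local Open Scope complex_scope.

Local Notation Re := (@complex.Re _).
Local Notation Im := (@complex.Im _).

Section ReIm.
Variable R : realType.
Implicit Types a b : R[i].

Lemma ReM a b : Re (a * b) = Re a * Re b - Im a * Im b.
Proof. by case: a b => [? ?] [? ?]. Qed.

Lemma ImM a b : Im (a * b) = Re a * Im b + Im a * Re b.
Proof. by case: a b => [? ?] [? ?]. Qed.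

End ReIm.

Section ComplexL2.
Context d (T : measurableType d) (R : realType).
Variable mu : {measure set T -> \bar R}.

(* |f|^p is integrable iff |Re f|^p and |Im f|^p are. *)
Definition cLfun (p : \bar R) : {pred T -> R[i]} := fun f =>
  (Re \o f \in Lfun mu p) && (Im \o f \in Lfun mu p).

Lemma cLfun_submod_closed (p : \bar R) : (1 <= p)%E -> submod_closed (cLfun p).
Proof.
move=> p1; have [L0 LZD] := Lfun_submod_closed mu p1.
have LD u v : u \in Lfun mu p -> v \in Lfun mu p -> u \+ v \in Lfun mu p.
  by move=> uL vL; have := LZD 1 _ _ uL vL; rewrite scale1r.
have LZ a u : u \in Lfun mu p -> a \*: u \in Lfun mu p.
  by move=> uL; have := LZD a _ _ uL L0; rewrite addr0.
split; first by apply/andP; split; exact: L0.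
move=> a f g /andP[f1 f2] /andP[g1 g2]; apply/andP; split.
- rewrite (_ : _ \o _ = ((Re a \*: (Re \o f)) \+
      ((- Im a) \*: (Im \o f))) \+ (Re \o g)).
    by apply: (LD) => //; apply: (LD); apply: LZ.
  by apply/funext => x /=; rewrite raddfD/= [Re (_ *: _)]ReM /GRing.scale/= mulNr.
- rewrite (_ : _ \o _ = ((Re a \*: (Im \o f)) \+
      (Im a \*: (Re \o f))) \+ (Im \o g)).
    by apply: (LD) => //; apply: (LD); apply: LZ.
  by apply/funext => x /=; rewrite raddfD/= [Im (_ *: _)]ImM.
Qed.

Lemma cLfun2_mul_conj f g :
  f \in cLfun 2%:E -> g \in cLfun 2%:E -> (fun x => f x * conjC (g x)) \in cLfun 1.
Proof.
move=> /andP[f1 f2] /andP[g1 g2].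
have [_ LZD] := Lfun_submod_closed mu (lexx 1%E).
apply/andP; split.
- rewrite (_ : _ \o _ = ((Re \o f) \* (Re \o g)) \+ ((Im \o f) \* (Im \o g))).
    have := LZD 1 _ _ (Lfun2_mul_Lfun1 f1 g1) (Lfun2_mul_Lfun1 f2 g2).
    by rewrite scale1r.
  by apply/funext => x /=; rewrite ReM; case: (g x) => c e /=; rewrite mulrN opprK.
- rewrite (_ : _ \o _ = (-1) *: ((Re \o f) \* (Im \o g)) + ((Im \o f) \* (Re \o g))).
    exact: LZD (Lfun2_mul_Lfun1 f1 g2) (Lfun2_mul_Lfun1 f2 g1).
  apply/funext => x /=; rewrite !fctE ImM /GRing.scale/=.
  by case: (g x) => c e /=; rewrite mulrN mulN1r.
Qed.

Definition cintegral (f : T -> R[i]) : R[i] :=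
  (\int[mu]_x Re (f x)) +i* (\int[mu]_x Im (f x)).

Lemma cintegral_linear a f g : f \in cLfun 1 -> g \in cLfun 1 ->
  cintegral (fun x => a * f x + g x) = a * cintegral f + cintegral g.
Proof.
move=> /andP[/Lfun1_integrable f1 /Lfun1_integrable f2].
move=> /andP[/Lfun1_integrable g1 /Lfun1_integrable g2].
have iZ r u : mu.-integrable setT (EFin \o u) ->
    mu.-integrable setT (EFin \o (fun x : T => r * u x)).
  move=> iu; rewrite (_ : _ \o _ = (fun x => r%:E * (EFin \o u) x)%E) //.
  exact: integrableZl.
have iD u v : mu.-integrable setT (EFin \o u) -> mu.-integrable setT (EFin \o v) ->
    mu.-integrable setT (EFin \o (fun x : T => u x + v x)).
  move=> iu iv; rewrite (_ : _ \o _ = ((EFin \o u) \+ (EFin \o v))%E) //.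
  exact: integrableD.
apply/eqP; rewrite eq_complex /cintegral /= !raddfD/= ReM ImM /=; apply/andP; split.
- under eq_Rintegral do rewrite raddfD/= ReM -mulNr.
  rewrite !RintegralD ?RintegralZl ?mulNr //; try exact: iZ.
  by apply: (iD) => //; exact: iZ.
- under eq_Rintegral do rewrite raddfD/= ImM.
  rewrite !RintegralD ?RintegralZl //; try exact: iZ.
  by apply: (iD) => //; exact: iZ.
Qed.

Lemma eq_cintegral f g : f \in cLfun 1 -> g \in cLfun 1 ->
  (\forall x \ae mu, f x = g x) -> cintegral f = cintegral g.
Proof.
move=> /andP[/Lfun1_integrable f1 /Lfun1_integrable f2].
move=> /andP[/Lfun1_integrable g1 /Lfun1_integrable g2] fg.
rewrite /cintegral; congr (_ +i* _); rewrite /Rintegral; congr fine.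
- apply: ae_eq_integral => //;
    [exact: measurable_int f1|exact: measurable_int g1|].
  by apply: filterS fg => x -> _.
- apply: ae_eq_integral => //;
    [exact: measurable_int f2|exact: measurable_int g2|].
  by apply: filterS fg => x -> _.
Qed.

Lemma cintegral_conj f : f \in cLfun 1 ->
  cintegral (fun x => conjC (f x)) = conjC (cintegral f).
Proof.
move=> /andP[_ /Lfun1_integrable f2].
rewrite /cintegral; apply/eqP; rewrite eq_complex/=; apply/andP; split.
  by apply/eqP/eq_Rintegral => x _; case: (f x).
rewrite -mulN1r -RintegralZl//; apply/eqP/eq_Rintegral => x _.
by rewrite mulN1r; case: (f x).
Qed.

Definition sqint : {pred T -> R[i]} := cLfun 2%:E.

Let sqint_submod_closed : submod_closed sqint.
Proof. by apply: cLfun_submod_closed; rewrite lee_fin ler1n. Qed.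

HB.instance Definition _ :=
  GRing.isSubmodClosed.Build _ _ sqint sqint_submod_closed.

Record L2fun := MkL2fun {
  L2fun_val :> T -> R[i];
  _ : L2fun_val \in sqint }.

HB.instance Definition _ := [isSub for L2fun_val].
HB.instance Definition _ := [Choice of L2fun by <:].
HB.instance Definition _ := [SubChoice_isSubLmodule of L2fun by <:].

(* [L2] is the quotient of the square-integrable functions by the a.e. null
   ones; a class is applied to a point through its canonical representative, so
   pointwise statements about classes are only meaningful almost everywhere. *)
Definition L2null : {pred L2fun} := fun f => `[< \forall x \ae mu, f x = 0 >].

Lemma L2null_zmod_closed : zmod_closed L2null.
Proof.
split; first by apply/asboolP/aeW.
move=> f g /asboolP f0 /asboolP g0; apply/asboolP.
by apply: filterS2 f0 g0 => x /= f0 g0; rewrite !fctE f0 g0 subr0.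
Qed.

HB.instance Definition _ :=
  GRing.isZmodClosed.Build L2fun L2null L2null_zmod_closed.

Definition L2 : Type := Quotient.quot L2null.

HB.instance Definition _ := GRing.Zmodule.on L2.
HB.instance Definition _ := EqQuotient.on L2.

Lemma L2_eqP (f g : L2fun) :
  (\pi_L2 f = \pi_L2 g) <-> (\forall x \ae mu, f x = g x).
Proof.
split.
  move=> /eqP; rewrite -[_ == _]Quotient.idealrBE => /asboolP.
  by apply: filterS => x /eqP; rewrite subr_eq0 => /eqP.
move=> fg; apply/eqP; rewrite -[_ == _]Quotient.idealrBE; apply/asboolP.
by apply: filterS fg => x /= fgx; rewrite !fctE fgx subrr.
Qed.

Lemma repr_L2P (f : L2fun) : \forall x \ae mu, repr (\pi_L2 f) x = f x.
Proof. by apply/L2_eqP; rewrite reprK. Qed.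

Definition L2scale (a : R[i]) (f : L2) : L2 := \pi_L2 (a *: repr f).

Lemma pi_L2scale a f : L2scale a (\pi_L2 f) = \pi_L2 (a *: f).
Proof. by apply/L2_eqP; apply: filterS (repr_L2P f) => x fx /=; rewrite !fctE fx. Qed.

Lemma L2scalerA a b v : L2scale a (L2scale b v) = L2scale (a * b) v.
Proof. by rewrite -[v]reprK [L2scale b _]pi_L2scale !pi_L2scale scalerA. Qed.

Lemma L2scale1r : left_id 1 L2scale.
Proof. by move=> v; rewrite -[v]reprK !pi_L2scale scale1r. Qed.

Lemma L2scalerDr : right_distributive L2scale +%R.
Proof.
move=> a u v; rewrite -[u]reprK -[v]reprK -[_ + _]Quotient.pi_add.
by rewrite !pi_L2scale scalerDr [LHS]Quotient.pi_add.
Qed.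

Lemma L2scalerDl v : {morph L2scale^~ v : a b / a + b}.
Proof.
move=> a b /=; rewrite -[v]reprK !pi_L2scale scalerDl.
exact: Quotient.pi_add.
Qed.

HB.instance Definition _ := GRing.Zmodule_isLmodule.Build R[i] L2
  L2scalerA L2scale1r L2scalerDr L2scalerDl.

Definition L2_to_fun (f : L2) : T -> R[i] := repr f.
Coercion L2_to_fun : L2 >-> Funclass.

Definition L2dot (f g : L2) : R[i] := cintegral (fun x => f x * conjC (g x)).

Lemma L2P (f : L2) : (f : T -> R[i]) \in cLfun 2%:E.
Proof. exact: (valP (repr f)). Qed.

Lemma L2_linE a (f g : L2) : \forall x \ae mu, (a *: f + g : L2) x = a * f x + g x.
Proof.
have -> : a *: f + g = \pi_L2 (a *: repr f + repr g).
  by rewrite [RHS]Quotient.pi_add reprK.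
exact: repr_L2P.
Qed.

Let L2dot_hermitian f g : L2dot f g = (-1) ^+ false * conjC (L2dot g f).
Proof.
rewrite expr0 mul1r /L2dot -cintegral_conj; last exact: cLfun2_mul_conj (L2P _) (L2P _).
by congr cintegral; apply/funext => x; rewrite rmorphM/= conjCK mulrC.
Qed.

Let L2dot_linl a f g h : L2dot (a *: f + g) h = a * L2dot f h + L2dot g h.
Proof.
have fh := cLfun2_mul_conj (L2P f) (L2P h).
have gh := cLfun2_mul_conj (L2P g) (L2P h).
rewrite /L2dot -cintegral_linear//; apply: eq_cintegral.
- exact: cLfun2_mul_conj (L2P _) (L2P _).
- by have [_ LZD] := cLfun_submod_closed (lexx 1%E); exact: LZD.
- by apply: filterS (L2_linE a f g) => x ->; rewrite mulrDl mulrA.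
Qed.

Let L2dot_bilinear :
  bilinear_for (GRing.Scale.Law.clone _ _ ( *%R ) _)
    (GRing.Scale.Law.clone _ _ (conjC \; *%R) _) L2dot.
Proof.
split=> [h a f g|h a f g]; first exact: L2dot_linl.
rewrite L2dot_hermitian expr0 mul1r L2dot_linl rmorphD rmorphM /=.
by rewrite (L2dot_hermitian h f) (L2dot_hermitian h g) expr0 !mul1r.
Qed.

HB.instance Definition _ :=
  bilinear_isBilinear.Build R[i] _ _ _ _ _ L2dot L2dot_bilinear.
HB.instance Definition _ :=
  isHermitianSesquilinear.Build R[i] _ _ _ L2dot L2dot_hermitian.

Let L2dot_gt0 (f : L2) : f != 0 -> 0 < L2dot f f.
Proof.
move=> f_neq0; pose g (x : T) : R := Re (f x) ^+ 2 + Im (f x) ^+ 2.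
have fE : (fun x => f x * conjC (f x)) = (fun x => (g x)%:C).
  by apply/funext => x; rewrite /g -normCK add_Re2_Im2.
have g_ge0 x : 0 <= g x by rewrite addr_ge0 ?sqr_ge0.
have /Lfun1_integrable intg : g \in Lfun mu 1.
  by have := cLfun2_mul_conj (L2P f) (L2P f); rewrite fE => /andP[].
have -> : L2dot f f = (\int[mu]_x g x)%:C.
  rewrite /L2dot fE /cintegral; congr (_ +i* _).
  by rewrite (@Rintegral_cst _ _ _ mu setT measurableT 0) mul0r.
rewrite ltcR lt_neqAle Rintegral_ge0// andbT eq_sym; apply: contra f_neq0.
move=> /eqP intg0; have : (\int[mu]_x `|(g x)%:E|)%E = 0%E.
  under eq_integral do rewrite gee0_abs ?lee_fin//.
  rewrite -[LHS]fineK; first by rewrite -[fine _]/(Rintegral mu setT g) intg0.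
  exact: (integrable_fin_num measurableT intg).
move=> /(ae_eq_integral_abs mu measurableT (measurable_int _ intg)) g0.
have -> : (0 : L2) = \pi_L2 0.
  by rewrite -[in RHS](subrr (0 : L2fun)) [RHS]Quotient.pi_add Quotient.pi_opp; exact: esym (subrr _).
rewrite -[f]reprK; apply/eqP/L2_eqP.
apply: filterS g0 => x /= /(_ I) [].
move=> /eqP; rewrite paddr_eq0 ?sqr_ge0// !sqrf_eq0 => /andP[/eqP rf /eqP jf].
rewrite /=.
by apply/eqP; rewrite eq_complex /= [Re _]rf [Im _]jf !eqxx.
Qed.

HB.instance Definition _ := isDotProduct.Build R[i] L2 L2dot L2dot_gt0.

(* Junk value: the class of 0 if [f] is not square integrable. *)
Definition toL2 (f : T -> R[i]) : L2 := \pi_L2 (insubd 0 f).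

Lemma toL2E f : f \in sqint -> \forall x \ae mu, toL2 f x = f x.
Proof.
move=> f2; apply: filterS (repr_L2P (insubd 0 f)) => x.
by rewrite /toL2 /L2_to_fun => ->; rewrite insubdK.
Qed.

Lemma Lfun2_bounded_mul (b u : T -> R) : measurable_fun setT b ->
  (forall x, `|b x| <= 1) -> u \in Lfun mu 2%:E -> b \* u \in Lfun mu 2%:E.
Proof.
move=> mb b1 /andP[/[!inE]/= mu_ u2].
have mbu : measurable_fun setT (b \* u) by exact: measurable_funM.
apply/andP; rewrite !inE/=; split => //.
move: u2; rewrite /finite_norm unlock => u2.
have mpow (v : T -> R) : measurable_fun setT v ->
    measurable_fun setT (fun x => (`|(v x)%:E| `^ 2)%E).
  move=> mv; apply/measurable_EFinP.
  apply: (@measurableT_comp _ _ _ _ _ _ (fun r : R => r `^ 2)) => //.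
  exact: measurableT_comp.
apply: le_lt_trans u2; rewrite gt0_ler_poweR ?invr_ge0//.
- by rewrite in_itv/= leey integral_ge0// => x _; exact: poweR_ge0.
- by rewrite in_itv/= leey integral_ge0// => x _; exact: poweR_ge0.
apply: ge0_le_integral => //=.
- exact: mpow.
- exact: mpow.
- move=> x _; rewrite lee_fin ge0_ler_powR ?nnegrE//.
  by rewrite normrM ler_piMl.
Qed.

Lemma cLfun2_unimodular_mul (g f : T -> R[i]) :
  measurable_fun setT (Re \o g) -> measurable_fun setT (Im \o g) ->
  (forall x, `|g x| = 1) -> f \in cLfun 2%:E -> (fun x => g x * f x) \in cLfun 2%:E.
Proof.
move=> mr mi g1 /andP[f1 f2].
have le12 : (1 <= 2%:E :> \bar R)%E by rewrite lee_fin ler1n.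
have [_ LZD] := Lfun_submod_closed mu le12.
have bR x : `|Re (g x)| <= 1.
  by rewrite -lecR (le_trans (normc_ge_Re _))// g1.
have bI x : `|Im (g x)| <= 1.
  rewrite -lecR -[Im _]opprK -ReiNIm normrN (le_trans (normc_ge_Re _))//.
  by rewrite normrM g1 mul1r normc_def/= expr0n expr1n add0r sqrtr1.
have [mb1 mb2] : (Re \o g) \* (Re \o f) \in Lfun mu 2%:E /\
    (Im \o g) \* (Im \o f) \in Lfun mu 2%:E by split; exact: Lfun2_bounded_mul.
have [mb3 mb4] : (Im \o g) \* (Re \o f) \in Lfun mu 2%:E /\
    (Re \o g) \* (Im \o f) \in Lfun mu 2%:E by split; exact: Lfun2_bounded_mul.
apply/andP; split.
- rewrite (_ : _ \o _ = (-1) *: ((Im \o g) \* (Im \o f)) + ((Re \o g) \* (Re \o f))).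
    exact: LZD.
  by apply/funext => x; rewrite !fctE/= ReM /GRing.scale/= mulN1r addrC.
- rewrite (_ : _ \o _ = 1 *: ((Im \o g) \* (Re \o f)) + ((Re \o g) \* (Im \o f))).
    exact: LZD.
  by apply/funext => x; rewrite !fctE/= ImM /GRing.scale/= mul1r addrC.
Qed.

End ComplexL2.

Section HilbertSpaces.
Variable R : realType.
Local Notation C := R[i].

Definition dnorm (U : lmodType C) (dot : {dot U for conjC}) (x : U) : R :=
  Num.sqrt (Re (dot x x)).

Definition bounded_op (U W : lmodType C) (dU : {dot U for conjC})
    (dW : {dot W for conjC}) (V : U -> W) : Prop :=
  exists M : R, forall x, dnorm dW (V x) <= M * dnorm dU x.

Definition is_orthproj (U : lmodType C) (dot : {dot U for conjC}) (M : set U)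
    (x p : U) : Prop :=
  M p /\ forall m, M m -> dot (x - p) m = 0.

(* Junk value 0 if [x] has no orthogonal projection on [M]; on a closed subspace
   of a Hilbert space the projection exists and is unique. *)
Definition orthproj (U : lmodType C) (dot : {dot U for conjC}) (M : set U)
    (x : U) : U :=
  xget 0 [set p | is_orthproj dot M x p].

(* (T1, f1) on [U] is similar to (T2, f2) on the subspace [M] of [W]: [V] is a
   bounded bijection from [U] onto [M] with inverse [Vinv]; only the values of
   [T2] and [Vinv] on [M] matter. *)
Definition similar (U W : lmodType C) (dU : {dot U for conjC})
    (dW : {dot W for conjC}) (T1 : U -> U) (f1 : U)
    (M : set W) (T2 : W -> W) (f2 : W) : Prop :=
  exists (V : {linear U -> W}) (Vinv : W -> U),
    [/\ bounded_op dU dW V,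
        (forall x, M (V x)) /\ cancel V Vinv,
        forall y, M y -> V (Vinv y) = y,
        forall y, M y -> T2 y = V (T1 (Vinv y)) &
        f2 = V f1].

Definition is_frame (U : lmodType C) (dot : {dot U for conjC}) (f : nat -> U) :
    Prop :=
  exists A B : R, [/\ 0 < A, 0 < B & forall g : U,
    ((A * dnorm dot g ^+ 2)%:E
       <= \sum_(0 <= n <oo) ((Re `|dot g (f n)|) ^+ 2)%:E
       <= (B * dnorm dot g ^+ 2)%:E)%E].

Definition infinite_dimensional (U : lmodType C) : Prop :=
  forall (n : nat) (e : 'I_n -> U),
    exists x, forall c : 'I_n -> C, x != \sum_(i < n) c i *: e i.

Definition separable (U : topologicalType) : Prop :=
  exists2 D : set U, countable D & dense D.

Definition lin_span (U : lmodType C) (f : nat -> U) : set U :=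
  [set x | exists n (c : nat -> C), x = \sum_(i < n) c i *: f i].

Definition orthonormal_basis (H : normedModType C) (dot : {dot H for conjC})
    (e : nat -> H) : Prop :=
  (forall m n, dot (e m) (e n) = (m == n)%:R) /\ dense (lin_span e).

(* A Riesz basis is the image of an orthonormal basis under a bounded bijection. *)
Definition is_riesz_basis (H : normedModType C) (dot : {dot H for conjC})
    (f : nat -> H) : Prop :=
  exists (e : nat -> H) (V : {linear H -> H}),
    [/\ orthonormal_basis dot e, bounded_op dot dot V, bijective V &
        forall n, f n = V (e n)].

End HilbertSpaces.

Section Circle.
Variable R : realType.

Record circle := MkCircle { circle_val :> R[i]; _ : `|circle_val| == 1 }.
HB.instance Definition _ := [isSub for circle_val].
HB.instance Definition _ := [Choice of circle by <:].

Let cis_subproof (t : R) : `|cos t +i* sin t| == 1.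
Proof. by rewrite normc_def /= cos2Dsin2 sqrtr1. Qed.

Definition cis (t : R) : circle := MkCircle (cis_subproof t).

HB.instance Definition _ := isPointed.Build circle (cis 0).

Definition circle_coord (z : circle) : R * R := (Re z, Im z).

(* The circle with its Borel sigma-algebra, traced from the plane R x R. *)
Definition circleT := g_sigma_algebra_preimageType circle_coord.
HB.instance Definition _ := Measurable.on circleT.
Definition val_circleT (z : circleT) : R[i] := circle_val z.
Coercion val_circleT : circleT >-> complex.

Definition turn (t : measurableTypeR R) : circleT := cis (2 * pi * t).

Lemma measurable_turn : measurable_fun setT turn.
Proof.
move=> _ _ [B mB <-]; rewrite !setTI.
have mc : measurable_fun setT
    (fun t : measurableTypeR R => (cos (2 * pi * t), sin (2 * pi * t))).
  apply: measurable_fun_pair.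
    apply: (@measurableT_comp _ _ _ _ _ _ (@cos R)).
      by apply: continuous_measurable_fun; exact: continuous_cos.
    exact: measurable_funM.
  apply: (@measurableT_comp _ _ _ _ _ _ (@sin R)).
    by apply: continuous_measurable_fun; exact: continuous_sin.
  exact: measurable_funM.
by have := mc measurableT _ mB; rewrite setTI.
Qed.

HB.instance Definition _ := isMeasurableFun.Build _ _ _ _ turn measurable_turn.

(* Normalized arc length: the image of Lebesgue measure on [0, 1] under
   t |-> exp (2 i pi t). *)
Definition arc_length : set circleT -> \bar R :=
  pushforward (mrestr (@lebesgue_measure R)
    (measurable_itv (`[0, 1] : interval R))) turn.

Let arc_length0 : arc_length set0 = 0%E.
Proof. by rewrite /arc_length /pushforward preimage_set0 measure0. Qed.

Let arc_length_ge0 A : (0 <= arc_length A)%E.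
Proof. exact: measure_ge0. Qed.

Let arc_length_sigma_additive : semi_sigma_additive arc_length.
Proof. exact: measure_semi_sigma_additive. Qed.

HB.instance Definition _ := isMeasure.Build _ _ _ arc_length
  arc_length0 arc_length_ge0 arc_length_sigma_additive.

Let arc_lengthT : arc_length setT = 1%E.
Proof.
rewrite /arc_length /pushforward preimage_setT /mrestr setTI.
by rewrite lebesgue_measure_itv/= lte_fin ltr01 sube0.
Qed.

HB.instance Definition _ := Measure_isProbability.Build _ _ _ arc_length arc_lengthT.

End Circle.

Section Hardy.
Variable R : realType.
Local Notation m := (@arc_length R).
Local Notation L2T := (L2 m).

Definition fourier_coef (f : L2T) (n : int) : R[i] :=
  cintegral m (fun z => f z * (z : R[i]) ^ (- n)).

Definition L2plus : set L2T := [set f | forall n : int, n < 0 -> fourier_coef f n = 0].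

Definition one_L2 : L2T := toL2 m (cst 1).

Definition mulz (f : L2T) : L2T := toL2 m (fun z => (z : R[i]) * f z).

Lemma one_L2E : \forall z \ae m, one_L2 z = 1.
Proof. by apply: toL2E; apply/andP; split; exact: Lfun_cst. Qed.

Lemma mulzE (f : L2T) : \forall z \ae m, mulz f z = (z : R[i]) * f z.
Proof.
apply: toL2E; apply: cLfun2_unimodular_mul; last exact: L2P.
- move=> _ B mB; rewrite setTI; exists (fst @^-1` B); last by rewrite setTI.
  by rewrite -[X in measurable X]setTI; exact: measurable_fst.
- move=> _ B mB; rewrite setTI; exists (snd @^-1` B); last by rewrite setTI.
  by rewrite -[X in measurable X]setTI; exact: measurable_snd.
- by case=> z /= /eqP.
Qed.

Definition inner (h : L2T) : Prop :=
  L2plus h /\ \forall z \ae m, `|h z| = 1.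

Definition finite_blaschke (h : L2T) : Prop :=
  exists (c : R[i]) (s : seq R[i]),
    [/\ `|c| = 1, (forall a, a \in s -> `|a| < 1) &
      \forall z \ae m,
        h z = c * \prod_(a <- s) (((z : R[i]) - a) / (1 - conjC a * (z : R[i])))].

Definition inner_star (h : L2T) : Prop := inner h /\ ~ finite_blaschke h.

(* h L^2_+, stated a.e. since a product of two classes need not be in L^2. *)
Definition mulL2plus (h : L2T) : set L2T :=
  [set u | exists2 g, L2plus g & \forall z \ae m, u z = h z * g z].

Definition model_space (h : L2T) : set L2T :=
  [set f | L2plus f /\ forall u, mulL2plus h u -> L2dot f u = 0].

(* Only meaningful on [model_space h], where it is P (M_z restricted). *)
Definition model_op (h f : L2T) : L2T :=
  orthproj (@L2dot _ _ _ m) (model_space h) (mulz f).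

Definition model_vec (h : L2T) : L2T :=
  orthproj (@L2dot _ _ _ m) (model_space h) one_L2.

Definition similar_to_model (H : lmodType R[i]) (dot : {dot H for conjC})
    (T : H -> H) (f0 : H) (h : L2T) : Prop :=
  similar dot (@L2dot _ _ _ m) T f0 (model_space h) (model_op h) (model_vec h).

End Hardy.

(* Main.v *)
(* Let S : L2+ -> H be the synthesis map sending z^n to T^n f0, with adjoint S'.
   When the orbit is a Bessel sequence, S intertwines multiplication by z with T, so
   ker S is a closed shift-invariant subspace of L2+, and Beurling's theorem gives
   ker S = h L2+ with h inner or h = 0.  The frame inequality says that S S' is
   coercive; by Lax-Milgram V = S' (S S')^-1 is a bounded map with V S = P, the
   projection onto the model space of h, and V is the required similarity.
   Conversely, a similarity V sends T^n f0 to P z^n, so V S = P: this gives the frame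
   bounds and forces ker S = h L2+, which determines h up to a unimodular constant.
   Since ker S = 0 exactly when the frame is a Riesz basis, that case is h = 0.
   A finite Blaschke product is excluded because Euclidean division by its linear
   factors shows that its model space is finite-dimensional. *)
Require Import Defs.
From HB Require Import structures.
From mathcomp Require Import all_boot all_order all_algebra.
From mathcomp Require Import sesquilinear complex.
From mathcomp Require Import all_classical all_reals all_analysis.
From mathcomp Require Import measurable_realfun ring lra.

Set Implicit Arguments.
Unset Strict Implicit.
Unset Printing Implicit Defensive.
Import Order.TTheory GRing.Theory Num.Def Num.Theory.
Import numFieldNormedType.Exports.

Local Open Scope classical_set_scope.
Local Open Scope ring_scope.
Local Open Scope complex_scope.
Local Notation Re := (@complex.Re _).
Local Notation Im := (@complex.Im _).

(** * Hilbert spaces over R[i] *)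

Section Modulus.
Variable R : realType.
Implicit Types a b : R[i].

(** [L2] is only a module with a dot product, while [H] also has a norm and a topology. The Hilbert
    space tools are therefore phrased through the real-valued norm [dnorm] and through sequences, so
    that they serve both; several are stated relative to a closed subspace [M], because the model
    operators act on a subset of [L2] and not on a type of their own. A similarity comes with a
    bounded map but with no bound on its inverse, and the upper frame bound needs one: it is
    recovered from uniform boundedness applied to the adjoint, followed by Lax-Milgram. Elements of
    [L2] are classes, so inner functions are unimodular only almost everywhere and must be handled
    as multipliers with a bounded representative. Fourier uniqueness, which underlies both
    Beurling's theorem and the uniqueness of [h], comes from studying which bounded functions
    preserve the vanishing of all Fourier coefficients. Finally, a Riesz basis asks for an
    orthonormal basis of [H] itself, which has to be manufactured from the orbit. *)

Definition cmod a : R := Re `|a|.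

Lemma cmodE a : `|a| = (cmod a)%:C.
Proof. by rewrite /cmod normc_def. Qed.

Lemma cmod_def a : cmod a = Num.sqrt (Re a ^+ 2 + Im a ^+ 2).
Proof. by rewrite /cmod normc_def. Qed.

Lemma cmod_ge0 a : 0 <= cmod a.
Proof. by rewrite cmod_def sqrtr_ge0. Qed.

Lemma cmodM a b : cmod (a * b) = cmod a * cmod b.
Proof. by apply: complexI; rewrite -cmodE normrM !cmodE -rmorphM. Qed.

Lemma cmodD a b : cmod (a + b) <= cmod a + cmod b.
Proof. by rewrite -lecR -cmodE rmorphD/= -!cmodE ler_normD. Qed.

Lemma cmodN a : cmod (- a) = cmod a.
Proof. by rewrite /cmod normrN. Qed.

Lemma cmod0 : cmod 0 = 0.
Proof. by rewrite /cmod normr0. Qed.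

Lemma cmod1 : cmod 1 = 1.
Proof. by rewrite /cmod normr1. Qed.

Lemma cmod_eq0 a : (cmod a == 0) = (a == 0).
Proof.
by rewrite -[RHS]normr_eq0 cmodE -(rmorph0 (real_complex R)) (inj_eq (@complexI R)).
Qed.

Lemma cmodV a : cmod a^-1 = (cmod a)^-1.
Proof. by apply: complexI; rewrite -cmodE normfV cmodE -fmorphV. Qed.

Lemma cmodX a n : cmod (a ^+ n) = cmod a ^+ n.
Proof. by apply: complexI; rewrite -cmodE normrX cmodE rmorphXn. Qed.

Lemma cmodR (r : R) : cmod r%:C = `|r|.
Proof. by rewrite cmod_def/= expr0n addr0 sqrtr_sqr. Qed.

Lemma cmod_nat n : cmod n%:R = n%:R.
Proof. by rewrite -(rmorph_nat (real_complex R)) cmodR ger0_norm. Qed.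

Lemma cmodJ a : cmod (conjC a) = cmod a.
Proof. by rewrite /cmod norm_conjC. Qed.

Lemma sqr_cmod a : cmod a ^+ 2 = Re a ^+ 2 + Im a ^+ 2.
Proof. by rewrite cmod_def sqr_sqrtr// addr_ge0 ?sqr_ge0. Qed.

Lemma mul_conjC a : a * conjC a = (cmod a ^+ 2)%:C.
Proof. by rewrite -normCK cmodE rmorphXn. Qed.

Lemma ler_Re_cmod a : Re a <= cmod a.
Proof.
rewrite cmod_def (le_trans (ler_norm _))// -sqrtr_sqr ler_wsqrtr// lerDl.
exact: sqr_ge0.
Qed.

Lemma ReJ a : Re (conjC a) = Re a.
Proof. by case: a. Qed.

Lemma ImJ a : Im (conjC a) = - Im a.
Proof. by case: a. Qed.

Lemma conjCR (r : R) : conjC r%:C = r%:C.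
Proof. exact: conjc_real. Qed.

End Modulus.

(** * Inner products, norms and sequential limits *)

Section DotTheory.
Variables (R : realType) (U : lmodType R[i]) (dot : {dot U for conjC}).
Local Notation "''[' u , v ]" := (dot u v).
Local Notation N := (dnorm dot).
Implicit Types (x y z : U) (a : R[i]).

Lemma dotC x y : '[x, y] = conjC '[y, x].
Proof. by rewrite hermC expr0 mul1r. Qed.

Lemma dotDl x y z : '[x + y, z] = '[x, z] + '[y, z].
Proof. exact: linearDl. Qed.
Lemma dotDr x y z : '[x, y + z] = '[x, y] + '[x, z].
Proof. exact: linearDr. Qed.
Lemma dotBl x y z : '[x - y, z] = '[x, z] - '[y, z].
Proof. exact: linearBl. Qed.
Lemma dotBr x y z : '[x, y - z] = '[x, y] - '[x, z].
Proof. exact: linearBr. Qed.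
Lemma dotZl a x y : '[a *: x, y] = a * '[x, y].
Proof. exact: linearZl_LR. Qed.
Lemma dotZr a x y : '[x, a *: y] = conjC a * '[x, y].
Proof. exact: linearZr_LR. Qed.
Lemma dot0l x : '[0, x] = 0.
Proof. exact: linear0l. Qed.
Lemma dot0r x : '[x, 0] = 0.
Proof. exact: linear0r. Qed.
Lemma dot_suml I (r : seq I) P (F : I -> U) y :
  '[\sum_(i <- r | P i) F i, y] = \sum_(i <- r | P i) '[F i, y].
Proof. exact: linear_sumlz. Qed.
Lemma dot_sumr I (r : seq I) P (F : I -> U) y :
  '[y, \sum_(i <- r | P i) F i] = \sum_(i <- r | P i) '[y, F i].
Proof. exact: linear_sumr. Qed.

Lemma dot_dnorm x : '[x, x] = (N x ^+ 2)%:C.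
Proof.
have := dnorm_ge0 dot x; rewrite lecE /dnorm /= => /andP[/eqP im0 re0].
by rewrite sqr_sqrtr//; apply/eqP; rewrite eq_complex/= im0 !eqxx.
Qed.

Lemma dnormE x : N x ^+ 2 = Re '[x, x].
Proof. by rewrite dot_dnorm. Qed.

Lemma dnormr_ge0 x : 0 <= N x.
Proof. exact: sqrtr_ge0. Qed.

Lemma dnormr_eq0 x : (N x == 0) = (x == 0).
Proof.
rewrite -(dnorm_eq0 dot) dot_dnorm -(rmorph0 (real_complex R)).
by rewrite (inj_eq (@complexI R)) sqrf_eq0.
Qed.

Lemma dnormr0 : N 0 = 0.
Proof. by apply/eqP; rewrite dnormr_eq0. Qed.

Lemma dnormrZ a x : N (a *: x) = cmod a * N x.
Proof.
apply/eqP; rewrite -(@eqrXn2 _ 2) ?mulr_ge0 ?cmod_ge0 ?dnormr_ge0//.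
by apply/eqP/complexI; rewrite -dot_dnorm dnormZ cmodE dot_dnorm exprMn -rmorphXn -rmorphM.
Qed.

Lemma dnormrN x : N (- x) = N x.
Proof. by rewrite -scaleN1r dnormrZ cmodN cmod1 mul1r. Qed.

Lemma dnormrC x y : N (x - y) = N (y - x).
Proof. by rewrite -dnormrN opprB. Qed.

Lemma sqr_dnormD x y : N (x + y) ^+ 2 = N x ^+ 2 + N y ^+ 2 + Re '[x, y] *+ 2.
Proof.
rewrite !dnormE dotDl !dotDr (dotC y x) !raddfD/= ReJ mulr2n; ring.
Qed.

Lemma sqr_dnormB x y : N (x - y) ^+ 2 = N x ^+ 2 + N y ^+ 2 - Re '[x, y] *+ 2.
Proof. by rewrite sqr_dnormD dnormrN -scaleN1r dotZr rmorphN1 mulN1r raddfN/= mulNrn. Qed.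

(** The subtracted vector is the projection of [x] on the line of [y]. Nonnegativity of the left
    side is Cauchy-Schwarz, and the drop below [N x ^+ 2] is what makes a nearest point an
    orthogonal projection. *)
Lemma sqr_dnorm_sub_proj x y : y != 0 ->
  N (x - ('[x, y] / (N y ^+ 2)%:C) *: y) ^+ 2 = N x ^+ 2 - cmod '[x, y] ^+ 2 / N y ^+ 2.
Proof.
move=> y0; have Ny : N y != 0 by rewrite dnormr_eq0.
rewrite sqr_dnormB dnormrZ dotZr.
have -> : conjC ('[x, y] / (N y ^+ 2)%:C) = conjC '[x, y] / (N y ^+ 2)%:C.
  by rewrite rmorphM fmorphV/= conjCR.
rewrite mulrAC [_ * '[x, y]]mulrC mul_conjC -fmorph_div cmodM cmodV cmodR ger0_norm ?sqr_ge0//.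
by rewrite mulr2n /=; field.
Qed.

Lemma dot_le x y : cmod '[x, y] <= N x * N y.
Proof.
have [->|y0] := eqVneq y 0; first by rewrite dot0r cmod0 dnormr0 mulr0.
rewrite -(@ler_pXn2r _ 2) ?nnegrE ?mulr_ge0 ?cmod_ge0 ?dnormr_ge0//.
have Ny : 0 < N y ^+ 2 by rewrite exprn_gt0// lt_neqAle eq_sym dnormr_eq0 y0 dnormr_ge0.
by rewrite exprMn -ler_pdivrMr// -subr_ge0 -sqr_dnorm_sub_proj ?sqr_ge0.
Qed.

Lemma dnormrD x y : N (x + y) <= N x + N y.
Proof.
rewrite -(@ler_pXn2r _ 2) ?nnegrE ?addr_ge0 ?dnormr_ge0//.
rewrite sqr_dnormD sqrrD addrAC lerD2r lerD2l.
by rewrite lerMn2r (le_trans (ler_Re_cmod _))// dot_le.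
Qed.

Lemma ler_dnorm_dist x y : N x - N y <= N (x - y).
Proof. by rewrite lerBlDr (le_trans _ (dnormrD _ _))// subrK. Qed.

Lemma dnormr_triangle z x y : N (x - y) <= N (x - z) + N (z - y).
Proof. by rewrite (le_trans _ (dnormrD _ _))// addrA subrK. Qed.

Lemma pythagoras x y : '[x, y] = 0 -> N (x + y) ^+ 2 = N x ^+ 2 + N y ^+ 2.
Proof. by move=> xy; rewrite sqr_dnormD xy mul0rn addr0. Qed.

Definition seq_lim (u : nat -> U) (l : U) : Prop :=
  N (u n - l) @[n --> \oo] --> (0 : R).

Definition seq_cauchy (u : nat -> U) : Prop :=
  forall e : R, 0 < e -> exists n0, forall m n, (n0 <= m)%N -> (n0 <= n)%N ->
    N (u m - u n) < e.

Definition hilbert : Prop := forall u, seq_cauchy u -> exists l, seq_lim u l.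

Lemma seq_limP u l : seq_lim u l <->
  forall e : R, 0 < e -> exists n0, forall n, (n0 <= n)%N -> N (u n - l) < e.
Proof.
split=> [ul e e0|H].
  have /cvgrPdist_lt/(_ e e0)[n0 _ H] := ul.
  by exists n0 => n /H /=; rewrite sub0r normrN ger0_norm ?dnormr_ge0.
apply/cvgrPdist_lt => e e0; have [n0 H0] := H e e0; exists n0 => // n /H0 /=.
by rewrite sub0r normrN ger0_norm ?dnormr_ge0.
Qed.

Lemma seq_lim_le u l (v : nat -> R) : (forall n, N (u n - l) <= v n) ->
  v n @[n --> \oo] --> (0 : R) -> seq_lim u l.
Proof.
move=> uv v0; apply: (@squeeze_cvgr _ _ _ _ (cst 0) v) => //; last exact: cvg_cst.
by near=> n; rewrite dnormr_ge0 uv.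
Unshelve. all: by end_near. Qed.

Lemma seq_lim_unique u l l' : seq_lim u l -> seq_lim u l' -> l = l'.
Proof.
move=> /seq_limP ul /seq_limP ul'; apply/eqP; rewrite -subr_eq0 -dnormr_eq0.
rewrite eq_le dnormr_ge0 andbT leNgt; apply/negP => d0.
have d2 : 0 < N (l - l') / 2 by rewrite divr_gt0.
have [n1 H1] := ul _ d2; have [n2 H2] := ul' _ d2.
have := dnormr_triangle (u (maxn n1 n2)) l l'; rewrite leNgt => /negP; apply.
rewrite [ltRHS]splitr ltrD// ?H2 ?leq_maxr// dnormrC H1// leq_maxl//.
Qed.

Lemma seq_lim_cst l : seq_lim (fun=> l) l.
Proof. by rewrite /seq_lim subrr dnormr0; exact: cvg_cst. Qed.

Lemma seq_limSE u l : seq_lim (fun n => u n.+1) l -> seq_lim u l.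
Proof. by move=> ul; rewrite /seq_lim -(cvg_shiftS (fun n => N (u n - l))). Qed.

Lemma seq_limD u v l l' : seq_lim u l -> seq_lim v l' ->
  seq_lim (fun n => u n + v n) (l + l').
Proof.
move=> ul vl; apply: (@seq_lim_le _ _ (fun n => N (u n - l) + N (v n - l'))).
  by move=> n; rewrite opprD addrACA dnormrD.
by rewrite -[X in _ --> X](addr0 0); exact: cvgD.
Qed.

Lemma seq_limZ a u l : seq_lim u l -> seq_lim (fun n => a *: u n) (a *: l).
Proof.
move=> ul; apply: (@seq_lim_le _ _ (fun n => cmod a * N (u n - l))).
  by move=> n; rewrite -scalerBr dnormrZ.
by rewrite -[X in _ --> X](mulr0 (cmod a)); exact: cvgMr.
Qed.

Lemma seq_limB u v l l' : seq_lim u l -> seq_lim v l' ->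
  seq_lim (fun n => u n - v n) (l - l').
Proof.
move=> ul vl; rewrite -scaleN1r; under [X in seq_lim X]eq_fun do rewrite -scaleN1r.
exact: seq_limD (seq_limZ _ _).
Qed.

Lemma dot_lim_unique u l y a : seq_lim u l ->
  cmod ('[u n, y] - a) @[n --> \oo] --> (0 : R) -> '[l, y] = a.
Proof.
move=> ul ua; apply/eqP; rewrite -subr_eq0 -cmod_eq0; apply/eqP.
apply: (@cvg_unique _ (@norm_hausdorff _ R^o) ((fun _ : nat => cmod ('[l, y] - a)) @ \oo)).
  exact: cvg_cst.
apply: (@squeeze_cvgr _ _ _ _ (cst 0)
  (fun n => N (u n - l) * N y + cmod ('[u n, y] - a))); last 2 first.
- exact: cvg_cst.
- rewrite -[X in _ --> X](addr0 0); apply: cvgD => //.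
  by rewrite -[X in _ --> X](mul0r (N y)); exact: cvgMl.
near=> n; rewrite cmod_ge0/=.
have -> : '[l, y] - a = '[l - u n, y] + ('[u n, y] - a).
  by rewrite dotBl addrA subrK.
by rewrite (le_trans (cmodD _ _))// lerD2r dnormrC dot_le.
Unshelve. all: by end_near. Qed.

Lemma dot_lim_eq u l y a : seq_lim u l -> (forall n, '[u n, y] = a) -> '[l, y] = a.
Proof.
move=> ul H; apply: (dot_lim_unique ul).
by under eq_fun do rewrite H subrr cmod0; exact: cvg_cst.
Qed.

Lemma dnorm_lim u l : seq_lim u l -> N (u n) @[n --> \oo] --> N l.
Proof.
move=> ul; apply/cvgrPdist_lt => e e0.
have /seq_limP/(_ e e0)[n0 H] := ul; exists n0 => // n /= /H; apply: le_lt_trans.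
rewrite ler_norml; apply/andP; split.
  by rewrite lerNl opprB ler_dnorm_dist.
by rewrite dnormrC ler_dnorm_dist.
Qed.

Lemma dnorm_lim_le u l c : seq_lim u l -> (forall n, N (u n) <= c) -> N l <= c.
Proof.
move=> /dnorm_lim ul H; have <- := cvg_lim (@norm_hausdorff _ R^o) ul.
by apply: limr_le; [exact: (cvgP _ ul)|near=> n].
Unshelve. all: by end_near. Qed.

(** The factor [1 - q ^+ k] makes the bound the exact partial geometric sum, so the induction step
    closes with an identity. *)
Lemma geometric_dist u (c q : R) : q < 1 ->
  (forall n, N (u n.+1 - u n) <= c * q ^+ n) ->
  forall m k, N (u (m + k)%N - u m) <= c / (1 - q) * q ^+ m * (1 - q ^+ k).
Proof.
move=> q1 H m; elim=> [|k IH]; first by rewrite addn0 subrr dnormr0 expr0 subrr mulr0.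
rewrite addnS (le_trans (dnormr_triangle (u (m + k)%N) _ _))//.
rewrite (le_trans (lerD (H _) IH))// le_eqVlt; apply/orP; left; apply/eqP.
have q10 : 1 - q != 0 by rewrite subr_eq0 eq_sym lt_eqF.
by rewrite exprD exprS; field.
Qed.

Lemma geometric_tail u l (c q : R) : 0 <= q -> q < 1 ->
  (forall n, N (u n.+1 - u n) <= c * q ^+ n) -> seq_lim u l ->
  forall m, N (l - u m) <= c / (1 - q) * q ^+ m.
Proof.
move=> q0 q1 H ul m.
have c0 : 0 <= c by have := H 0%N; rewrite mulr1; apply: le_trans; rewrite dnormr_ge0.
have Hu : seq_lim (fun n => u (m + n)%N - u m) (l - u m).
  apply: seq_limB; last exact: seq_lim_cst.
  apply/seq_limP => e e0; have /seq_limP/(_ e e0)[n0 Hn] := ul.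
  by exists n0 => n hn; apply: Hn; rewrite (leq_trans hn)// leq_addl.
apply: (dnorm_lim_le Hu) => n; rewrite (le_trans (geometric_dist q1 H _ _))//.
rewrite ler_piMr ?mulr_ge0 ?exprn_ge0 ?invr_ge0 ?subr_ge0 ?(ltW q1)//.
by rewrite lerBlDr lerDl exprn_ge0.
Qed.

Lemma geometric_cauchy u (c q : R) : 0 <= q -> q < 1 ->
  (forall n, N (u n.+1 - u n) <= c * q ^+ n) -> seq_cauchy u.
Proof.
move=> q0 q1 H.
have c0 : 0 <= c by have := H 0%N; rewrite mulr1; apply: le_trans; rewrite dnormr_ge0.
have q10 : 0 <= (1 - q)^-1 by rewrite invr_ge0 subr_ge0 ltW.
move=> e e0.
have : (fun n => c / (1 - q) * q ^+ n) @ \oo --> (0 : R).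
  rewrite -[X in _ --> X](mulr0 (c / (1 - q))); apply: cvgMr.
  by apply: cvg_expr; rewrite ger0_norm.
move=> /cvgrPdist_lt/(_ e e0)[n0 _ Hn].
have Hm m n : (n0 <= m)%N -> (m <= n)%N -> N (u n - u m) < e.
  move=> mn0 mn; rewrite -(subnKC mn) (le_lt_trans (geometric_dist q1 H _ _))//.
  have /= := Hn _ mn0; rewrite sub0r normrN ger0_norm ?mulr_ge0 ?exprn_ge0//.
  apply: le_lt_trans; rewrite ler_piMr ?mulr_ge0 ?exprn_ge0//.
  by rewrite lerBlDr lerDl exprn_ge0.
exists n0 => m n hm hn; case: (leqP m n) => [mn|/ltnW nm].
  by rewrite dnormrC Hm.
exact: Hm.
Qed.

End DotTheory.

(** * Closed subspaces and orthogonal projections *)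

Section ClosedSubspaces.
Variables (R : realType) (U : lmodType R[i]) (dot : {dot U for conjC}).
Local Notation "''[' u , v ]" := (dot u v).
Local Notation N := (dnorm dot).
Implicit Types (x y z : U) (a : R[i]) (M : set U).

Definition closed_subspace M : Prop :=
  [/\ M 0, forall a x y, M x -> M y -> M (a *: x + y) &
      forall u l, (forall n : nat, M (u n)) -> seq_lim dot u l -> M l].

Definition perp (A : set U) : set U := [set x | forall y, A y -> '[x, y] = 0].

Section ClosedSubspaceClosure.
Variables (M : set U) (cM : closed_subspace M).

Lemma closed_subspace0 : M 0. Proof. by case: cM. Qed.

Lemma closed_subspaceD x y : M x -> M y -> M (x + y).
Proof. by case: cM => _ H _ Mx My; rewrite -[x]scale1r; exact: H. Qed.

Lemma closed_subspaceZ a x : M x -> M (a *: x).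
Proof. by case: cM => M0 H _ Mx; rewrite -[_ *: _]addr0; exact: H. Qed.

Lemma closed_subspaceB x y : M x -> M y -> M (x - y).
Proof.
by move=> Mx My; rewrite -scaleN1r; apply: closed_subspaceD => //; exact: closed_subspaceZ.
Qed.

Lemma closed_subspace_sum (I : Type) (r : seq I) (P : pred I) (F : I -> U) :
  (forall i, P i -> M (F i)) -> M (\sum_(i <- r | P i) F i).
Proof.
by move=> H; apply: big_ind => //; [exact: closed_subspace0|exact: closed_subspaceD].
Qed.

Lemma closed_subspace_lim u l : (forall n, M (u n)) -> seq_lim dot u l -> M l.
Proof. by case: cM => _ _; exact. Qed.

End ClosedSubspaceClosure.

(** The main source of closedness below: the Hardy space, [h L2+] and the kernel of the synthesis
    map are all rewritten with [perp]. *)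
Lemma closed_subspace_perp A : closed_subspace (perp A).
Proof.
split; first by move=> a _; exact: dot0l.
  by move=> a x y Hx Hy b Ab; rewrite dotDl dotZl Hx// Hy// mulr0 addr0.
by move=> u l Hu ul b Ab; apply: (dot_lim_eq ul) => n; exact: Hu.
Qed.

Lemma closed_subspaceI M M' : closed_subspace M -> closed_subspace M' ->
  closed_subspace (M `&` M').
Proof.
move=> [M0 MZD Ml] [M0' MZD' Ml']; split => //.
- by move=> a x y [? ?] [? ?]; split; [exact: MZD|exact: MZD'].
- by move=> u l Mu ul; split; [apply: Ml ul|apply: Ml' ul] => n; case: (Mu n).
Qed.

Lemma subrBB (V : zmodType) (x y z : V) : (x - y) - (x - z) = z - y.
Proof. by rewrite opprB addrC addrA subrK. Qed.

Lemma is_orthproj_unique M x p q : closed_subspace M ->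
  is_orthproj dot M x p -> is_orthproj dot M x q -> p = q.
Proof.
move=> cM [Mp Hp] [Mq Hq]; apply/eqP; rewrite -subr_eq0 -(dnorm_eq0 dot); apply/eqP.
have Mpq := closed_subspaceB cM Mp Mq.
rewrite -[X in '[X, _]](subrBB x) dotBl Hq// Hp// subrr.
by [].
Qed.

Lemma orthprojE M x p : closed_subspace M -> is_orthproj dot M x p ->
  orthproj dot M x = p.
Proof.
move=> cM H; rewrite /orthproj; case: xgetP => [q _ Hq|/(_ p)//].
exact: is_orthproj_unique Hq H.
Qed.

Lemma parallelogram x y :
  N (x + y) ^+ 2 + N (x - y) ^+ 2 = N x ^+ 2 *+ 2 + N y ^+ 2 *+ 2.
Proof. by rewrite sqr_dnormD sqr_dnormB !mulr2n; ring. Qed.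

(* A minimizing sequence for the distance to M is Cauchy by the parallelogram law. *)
Theorem orthproj_exists M x : hilbert dot -> closed_subspace M ->
  exists p, is_orthproj dot M x p.
Proof.
move=> cU cM; pose D : set R := [set N (x - m) ^+ 2 | m in M].
have infD : has_inf D.
  split; first by exists (N (x - 0) ^+ 2), 0 => //; exact: closed_subspace0 cM.
  by exists 0 => _ [m _ <-]; exact: sqr_ge0.
pose d := inf D.
have dle m : M m -> d <= N (x - m) ^+ 2.
  by move=> Mm; apply: ge_inf; [case: infD|exists m].
have /choice[m Hm] (n : nat) : exists m, M m /\ N (x - m) ^+ 2 < d + n.+1%:R^-1.
  have n0 : 0 < n.+1%:R^-1 :> R by rewrite invr_gt0.
  by have [_ [m Mm <-] lt] := inf_adherent n0 infD; exists m.
have dm p q : N (m p - m q) ^+ 2 <= p.+1%:R^-1 *+ 2 + q.+1%:R^-1 *+ 2.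
  have [[Mp lp] [Mq lq]] := (Hm p, Hm q).
  have Mpq : M (2^-1 *: (m p + m q)).
    by apply: (closed_subspaceZ cM); exact: closed_subspaceD.
  (* Half the sum of the two vectors is [x] minus a midpoint in [M], whose squared norm is at least
     [d]; near-minimality then bounds the difference. *)
  have := parallelogram (x - m p) (x - m q).
  have -> : x - m p - (x - m q) = m q - m p by rewrite subrBB.
  have -> : x - m p + (x - m q) = (2 : R[i]) *: (x - 2^-1 *: (m p + m q)).
    by rewrite scalerBr scalerA divff// scale1r scaler_nat mulr2n opprD addrACA.
  rewrite dnormrZ exprMn dnormrC.
  rewrite cmod_nat.
  have := dle _ Mpq; move: lp lq.
  set a := p.+1%:R^-1; set b := q.+1%:R^-1; set X := N _ ^+ 2; set Y := N _ ^+ 2.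
  set Z := N _ ^+ 2; set W := N _ ^+ 2; lra.
have cm : seq_cauchy dot m.
  move=> e e0; have e4 : 0 < e ^+ 2 / 4 by rewrite divr_gt0 ?exprn_gt0.
  have := @cvg_harmonic R; move/cvgrPdist_lt => /(_ _ e4)[n0 _ H].
  exists n0 => p q hp hq; rewrite -(@ltr_pXn2r _ 2)// ?nnegrE ?dnormr_ge0 ?ltW//.
  rewrite (le_lt_trans (dm _ _))//.
  have := H p hp; have := H q hq; rewrite /= !sub0r !normrN /harmonic.
  rewrite !ger0_norm ?invr_ge0//.
  set a := p.+1%:R^-1; set b := q.+1%:R^-1; set E := e ^+ 2; lra.
have [p mp] := cU _ cm; have Mp : M p by apply: (closed_subspace_lim cM) mp => n; case: (Hm n).
have Np : N (x - p) ^+ 2 <= d.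
  have : (fun n => N (x - m n)) @ \oo --> N (x - p).
    by apply: dnorm_lim; apply: seq_limB => //; exact: seq_lim_cst.
  move=> xm; have xm2 : (fun n => N (x - m n) ^+ 2) @ \oo --> N (x - p) ^+ 2.
    by under eq_fun do rewrite expr2; rewrite expr2; exact: cvgM.
  have dh : (fun n => d + n.+1%:R^-1) @ \oo --> d.
    by rewrite -[X in _ --> X]addr0; apply: cvgD; [exact: cvg_cst|exact: cvg_harmonic].
  apply: (ler_cvg_to xm2 dh); near=> n; exact: ltW (Hm n).2.
exists p; split => // y My; have [->|y0] := eqVneq y 0; first exact: dot0r.
have Ny : N y != 0 by rewrite dnormr_eq0.
(* Moving from [p] by [t *: y] lowers the squared distance by [cmod '[x - p, y] ^+ 2 / N y ^+ 2],
   which minimality forbids unless the product vanishes. *)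
pose t := '[x - p, y] / (N y ^+ 2)%:C.
have := dle _ (closed_subspaceD cM Mp (closed_subspaceZ cM t My)).
rewrite opprD addrA sqr_dnorm_sub_proj// => H.
apply/eqP; rewrite -cmod_eq0 -sqrf_eq0 eq_le sqr_ge0 andbT.
have : 0 <= - (cmod '[x - p, y] ^+ 2 / N y ^+ 2) by lra.
by rewrite oppr_ge0 pmulr_lle0// invr_gt0 exprn_gt0// lt_neqAle eq_sym Ny dnormr_ge0.
Unshelve. all: by end_near. Qed.

Lemma orthprojP M x : hilbert dot -> closed_subspace M ->
  is_orthproj dot M x (orthproj dot M x).
Proof.
by move=> cU cM; have [p Hp] := orthproj_exists x cU cM; rewrite (orthprojE cM Hp).
Qed.

End ClosedSubspaces.

(** * Riesz representation and adjoints *)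

Section Riesz.
Variables (R : realType) (U W : lmodType R[i]).
Variables (dU : {dot U for conjC}) (dW : {dot W for conjC}).

Lemma bounded_opP (V : U -> W) : bounded_op dU dW V ->
  exists2 K, 0 < K & forall x, dnorm dW (V x) <= K * dnorm dU x.
Proof.
move=> [K HK]; exists (`|K| + 1) => [|x]; first by rewrite ltr_wpDl.
rewrite (le_trans (HK x))// ler_wpM2r ?dnormr_ge0//.
by rewrite (le_trans (ler_norm K))// lerDl.
Qed.

Lemma bounded_op_lim (V : {linear U -> W}) u l : bounded_op dU dW V ->
  seq_lim dU u l -> seq_lim dW (fun n => V (u n)) (V l).
Proof.
move=> [K HK] ul; apply: (@seq_lim_le _ _ _ _ _ (fun n => K * dnorm dU (u n - l))).
  by move=> n; rewrite -linearB HK.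
by rewrite -[X in _ --> X](mulr0 K); exact: cvgMr.
Qed.

Theorem riesz_representation (F : U -> R[i]) (K : R) : hilbert dU ->
  (forall a x y, F (a *: x + y) = a * F x + F y) ->
  (forall x, cmod (F x) <= K * dnorm dU x) ->
  exists y, forall x, F x = dU x y.
Proof.
move=> cU FL FK.
have F0 : F 0 = 0.
  by have := FL 1 0 0; rewrite scale1r addr0 mul1r => /eqP; rewrite -subr_eq subrr => /eqP.
have FB x y : F (x - y) = F x - F y.
  by rewrite addrC -scaleN1r FL mulN1r addrC.
have FZ a x : F (a *: x) = a * F x by rewrite -[_ *: _]addr0 FL F0 addr0.
have cM : closed_subspace dU [set x | F x = 0].
  split => //= [a x y Fx Fy|u l Fu ul]; first by rewrite FL Fx Fy mulr0 addr0.
  apply/eqP; rewrite -cmod_eq0; apply/eqP.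
  apply: (@cvg_unique _ (@norm_hausdorff _ R^o) ((fun _ : nat => cmod (F l)) @ \oo)).
    exact: cvg_cst.
  apply: (@squeeze_cvgr _ _ _ _ (cst 0) (fun n => K * dnorm dU (u n - l))); last 2 first.
  - exact: cvg_cst.
  - by rewrite -[X in _ --> X](mulr0 K); exact: cvgMr.
  near=> n; rewrite cmod_ge0/= (le_trans _ (FK _))// FB Fu sub0r cmodN//.
have [allF|/existsNP[x Fx]] := pselect (forall x, F x = 0).
  by exists 0 => x; rewrite allF dot0r.
have [p [/= Fp Hp]] := orthproj_exists x cU cM; set z := x - p in Hp.
have Fz : F z = F x by rewrite /z FB Fp subr0.
have z0 : dU z z != 0.
  by rewrite dnorm_eq0; apply: contra_not_neq Fx => z0; rewrite -Fz z0.
exists (conjC (F z / dU z z) *: z) => y; rewrite dotZr conjCK.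
(* This combination lies in the kernel of [F], hence is orthogonal to [z]; expanding that
   orthogonality reads off [F y]. *)
have /Hp : F (F z *: y - F y *: z) = 0 by rewrite FB !FZ mulrC subrr.
rewrite dotC => /eqP; rewrite conjC_eq0 dotBl !dotZl subr_eq0 => /eqP H.
by apply: (mulIf z0); rewrite -H mulrAC divfK.
Unshelve. all: by end_near. Qed.

Corollary adjoint_exists (V : {linear U -> W}) : hilbert dU -> bounded_op dU dW V ->
  exists V' : W -> U, forall x y, dW (V x) y = dU x (V' y).
Proof.
move=> cU [K HK]; suff /choice[V' H] : forall y, exists z, forall x, dW (V x) y = dU x z.
  by exists V' => x y; exact: H.
move=> y; apply: (@riesz_representation _ (K * dnorm dW y)) => //.
  by move=> a x x'; rewrite linearP dotDl dotZl.
move=> x; rewrite (le_trans (dot_le _ _ _))// mulrAC.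
by rewrite ler_wpM2r ?dnormr_ge0.
Qed.

End Riesz.

(** * Coercive operators *)

Section LaxMilgram.
Variables (R : realType) (U : lmodType R[i]) (dot : {dot U for conjC}).
Local Notation N := (dnorm dot).

(* With [t = A / B ^ 2] the map [1 - t S] contracts the norm, so the residual of
   the iteration [x |-> x + t (y - S x)] decays geometrically. *)
Theorem lax_milgram (M : set U) (S : U -> U) (A B : R) :
  hilbert dot -> closed_subspace dot M -> 0 < A -> 0 < B ->
  (forall x, M x -> M (S x)) ->
  (forall a x y, M x -> M y -> S (a *: x + y) = a *: S x + S y) ->
  (forall x, M x -> N (S x) <= B * N x) ->
  (forall x, M x -> A * N x ^+ 2 <= Re (dot (S x) x)) ->
  forall y, M y -> exists2 x, M x & S x = y.
Proof.
move=> cU cM A0 B0 MS SL SB SA y My.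
have MD := closed_subspaceD cM; have MZ := closed_subspaceZ cM.
have MB := closed_subspaceB cM; have M0 := closed_subspace0 cM.
have S0 : S 0 = 0.
  by have := SL 1 0 0 M0 M0; rewrite !scale1r addr0 => /eqP; rewrite -subr_eq subrr => /eqP.
have SB' x z : M x -> M z -> S (x - z) = S x - S z.
  by move=> Mx Mz; rewrite addrC -scaleN1r SL// scaleN1r addrC.
(* This [t] minimizes [1 - 2 t A + t^2 B^2], with value [1 - A^2 / B^2]. The maximum with 0 in [q2]
   guards the square root when [M] is zero, where nothing forces [A <= B]. *)
pose t := A / B ^+ 2; have t0 : 0 < t by rewrite divr_gt0 ?exprn_gt0.
pose q2 := Num.max 0 (1 - A ^+ 2 / B ^+ 2); pose q := Num.sqrt q2.
have q0 : 0 <= q by exact: sqrtr_ge0.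
have q20 : 0 <= q2 by rewrite le_max lexx.
have q1 : q < 1.
  rewrite /q -sqrtr1 ltr_sqrt// gt_max ltr01/= gtrBl.
  by rewrite divr_gt0 ?exprn_gt0.
have contr x : M x -> N (x - t%:C *: S x) <= q * N x.
  move=> Mx; rewrite -(@ler_pXn2r _ 2) ?nnegrE ?mulr_ge0 ?dnormr_ge0//.
  rewrite sqr_dnormB dnormrZ cmodR (ger0_norm (ltW t0)) dotZr conjCR Defs.ReM/= mul0r subr0.
  rewrite [(q * _) ^+ 2]exprMn (sqr_sqrtr q20).
  have xS : Re (dot x (S x)) = Re (dot (S x) x) by rewrite dotC ReJ.
  have H1 := SA _ Mx.
  have H2 : N (S x) ^+ 2 <= B ^+ 2 * N x ^+ 2.
    by rewrite -exprMn ler_pXn2r ?nnegrE ?SB ?mulr_ge0 ?dnormr_ge0 ?ltW.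
  have H3 : t * (A * N x ^+ 2) <= t * Re (dot x (S x)) by rewrite xS ler_pM2l.
  have H4 : (t * N (S x)) ^+ 2 <= t ^+ 2 * (B ^+ 2 * N x ^+ 2).
    by rewrite exprMn ler_pM2l// exprn_gt0.
  have tB : t ^+ 2 * (B ^+ 2 * N x ^+ 2) = A ^+ 2 / B ^+ 2 * N x ^+ 2.
    rewrite /t; field; exact: lt0r_neq0.
  have tA : t * (A * N x ^+ 2) = A ^+ 2 / B ^+ 2 * N x ^+ 2.
    rewrite /t; field; exact: lt0r_neq0.
  have : (1 - A ^+ 2 / B ^+ 2) * N x ^+ 2 <= q2 * N x ^+ 2.
    by rewrite ler_wpM2r ?sqr_ge0// le_max lexx orbT.
  by rewrite mulrBl mul1r; lra.
pose u := fix u n := if n is n'.+1 then u n' + t%:C *: (y - S (u n')) else 0 : U.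
have Mu n : M (u n) by elim: n => //= n IH; apply: (MD) => //; apply: (MZ); apply: (MB) => //; exact: MS.
have res n : N (y - S (u n)) <= q ^+ n * N y.
  elim: n => [|n IH]; first by rewrite S0 subr0 mul1r.
  rewrite /= [u n + _]addrC SL//; last by apply: (MB) => //; exact: MS.
  set d := y - S (u n) in IH *.
  have -> : y - (t%:C *: S d + S (u n)) = d - t%:C *: S d.
    by rewrite opprD addrCA addrC.
  rewrite (le_trans (contr _ _))//; first by apply: (MB) => //; exact: MS.
  by rewrite exprS -mulrA ler_wpM2l.
have cu : seq_cauchy dot u.
  apply: (@geometric_cauchy _ _ _ _ (t * N y) q) => // n.
  rewrite /= [_ + _ *: _]addrC addrK dnormrZ cmodR (ger0_norm (ltW t0)).
  by rewrite -mulrA ler_wpM2l ?(ltW t0)// mulrC.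
have [x ux] := cU _ cu; have Mx := closed_subspace_lim cM Mu ux.
exists x => //; apply: (@seq_lim_unique _ _ dot (fun n => S (u n))).
  apply: (@seq_lim_le _ _ _ _ _ (fun n => B * N (u n - x))).
    by move=> n; rewrite -SB' ?SB//; exact: MB.
  by rewrite -[X in _ --> X](mulr0 B); exact: cvgMr.
apply: (@seq_lim_le _ _ _ _ _ (fun n => q ^+ n * N y)).
  by move=> n; rewrite dnormrC.
rewrite -[X in _ --> X](mul0r (N y)); apply: cvgMl.
by apply: cvg_expr; rewrite ger0_norm.
Qed.

End LaxMilgram.

(** * Uniform boundedness and bounded inverses *)

Section BoundedInverse.
Variables (R : realType) (U W : lmodType R[i]).
Variables (dU : {dot U for conjC}) (dW : {dot W for conjC}).

(* Gliding hump: perturb [x] by a small multiple of each bad vector in turn, with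
   the sign that does not decrease the inner product. *)
Theorem uniform_boundedness (M A : set W) : hilbert dW -> closed_subspace dW M ->
  A `<=` M ->
  (forall x, M x -> exists K : R, forall y, A y -> cmod (dW x y) <= K) ->
  exists C : R, forall y, A y -> dnorm dW y <= C.
Proof.
move=> cW cM AM ptw; apply: contrapT => /forallNP unb.
(* The [n]-th perturbation has norm [3^-n], and all later ones together at most half of that. So
   half of the hump [3^-n * dnorm dW (y n) > n] survives in the limit, which contradicts a pointwise
   bound. *)
have /choice[y Hy] (n : nat) : exists y, A y /\ n%:R * 3 ^+ n < dnorm dW y.
  have /existsNP[y /not_implyP[Ay /negP]] := unb (n%:R * 3 ^+ n).
  by rewrite -ltNge; exists y.
have step (p : W * nat) : exists x', [/\ M p.1 -> M x',
    dnorm dW (x' - p.1) <= 1 * 3^-1 ^+ p.2 &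
    3^-1 ^+ p.2 * dnorm dW (y p.2) <= cmod (dW x' (y p.2))].
  case: p => x n /=; have [Ay ny] := Hy n.
  have y0 : 0 < dnorm dW (y n) by rewrite (le_lt_trans _ ny)// mulr_ge0.
  pose b := (3^-1 ^+ n / dnorm dW (y n))%:C *: y n.
  have Mb : M b by apply: (closed_subspaceZ cM); exact: AM.
  have Nb : dnorm dW b = 3^-1 ^+ n.
    rewrite dnormrZ cmodR ger0_norm ?divr_ge0 ?exprn_ge0 ?dnormr_ge0//.
    by rewrite divfK// gt_eqF.
  have by_ : dW b (y n) = (3^-1 ^+ n * dnorm dW (y n))%:C.
    rewrite dotZl dot_dnorm -rmorphM; congr real_complex_def.
    by field; rewrite gt_eqF.
  have [|lt] := leP (3^-1 ^+ n * dnorm dW (y n)) (cmod (dW (x + b) (y n))).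
    move=> le; exists (x + b); split => //; first by move=> Mx; exact: (closed_subspaceD cM).
    by rewrite addrAC subrr add0r Nb mul1r.
  exists (x - b); split => //.
  - by move=> Mx; exact: (closed_subspaceB cM).
  - by rewrite addrAC subrr add0r dnormrN Nb mul1r.
  (* The two candidates differ by [2 b], whose product with [y n] is twice the required size: if
     [x + b] falls short, [x - b] cannot. *)
  - have := cmodD (dW (x + b) (y n)) (- dW (x - b) (y n)).
    rewrite cmodN -dotBl opprD opprK addrACA subrr add0r (dotDl _ b b) by_ -rmorphD cmodR.
    rewrite ger0_norm; last by rewrite addr_ge0// mulr_ge0 ?exprn_ge0 ?dnormr_ge0.
    by move: lt; lra.
have [f Hf] := choice step.
pose u := fix u n := if n is n'.+1 then f (u n', n') else 0 : W.
have Mu n : M (u n).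
  by elim: n => [|n IH]; [exact: closed_subspace0 cM|case: (Hf (u n, n)) => + _ _; exact].
have du n : dnorm dW (u n.+1 - u n) <= 1 * 3^-1 ^+ n by case: (Hf (u n, n)).
have q0 : 0 <= 3^-1 :> R by rewrite invr_ge0.
have q1 : 3^-1 < 1 :> R by rewrite invf_lt1// ltr1n.
have [l ul] := cW _ (geometric_cauchy q0 q1 du).
have Ml := closed_subspace_lim cM Mu ul.
have [K HK] := ptw _ Ml.
have big n : n%:R <= 2 * K.
  have [Ay ny] := Hy n; have := HK _ Ay.
  have := geometric_tail q0 q1 du ul n.+1; have [_ _ /= Hn] := Hf (u n, n).
  have := dot_le dW (u n.+1 - l) (y n); rewrite dnormrC dotBl.
  have := cmodD (dW (u n.+1) (y n) - dW l (y n)) (dW l (y n)); rewrite subrK.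
  move: Hn; rewrite -/(u n.+1) => Hn tri cs tl lK.
  have H3 : 0 < 3^-1 ^+ n :> R by rewrite exprn_gt0// invr_gt0.
  have ny' : n%:R < 3^-1 ^+ n * dnorm dW (y n).
    have -> : n%:R = 3^-1 ^+ n * (n%:R * 3 ^+ n) :> R by rewrite exprVn; field.
    by rewrite ltr_pM2l.
  have tl' : dnorm dW (l - u n.+1) * dnorm dW (y n) <=
      2^-1 * (3^-1 ^+ n * dnorm dW (y n)).
    rewrite mulrA ler_wpM2r ?dnormr_ge0// (le_trans tl)// exprS le_eqVlt.
    by apply/orP; left; apply/eqP; field.
  lra.
have := archi_boundP (_ : 0 <= 2 * K); rewrite (le_trans _ (big 0%N))// => /(_ isT).
by rewrite ltNge big.
Qed.

(* The adjoint is bounded below by uniform boundedness, so V V^* is coercive on M. *)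
Theorem bounded_inverse (M : set W) (V : {linear U -> W}) :
  hilbert dU -> hilbert dW -> closed_subspace dW M ->
  bounded_op dU dW V -> injective V ->
  (forall x, M (V x)) -> (forall y, M y -> exists x, V x = y) ->
  exists C : R, forall x, dnorm dU x <= C * dnorm dW (V x).
Proof.
move=> cU cW cM bV Vi MV VM; have [V' HV'] := adjoint_exists cU bV.
have dotI (x x' : U) : (forall z, dU z x = dU z x') -> x = x'.
  move=> H; apply/eqP; rewrite -subr_eq0 -(dnorm_eq0 dU) dotBr H subrr//.
have V'L a y z : V' (a *: y + z) = a *: V' y + V' z.
  by apply: dotI => x; rewrite dotDr dotZr -!HV' dotDr dotZr.
(* Pointwise boundedness comes from surjectivity: each [x] in [M] is some [V z], and the product of
   [V z] with [m] equals that of [z] with [V' m], at most [dnorm dU z]. *)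
have [C1 HC1] : exists C : R, forall y, [set m | M m /\ dnorm dU (V' m) <= 1] y ->
    dnorm dW y <= C.
  apply: (@uniform_boundedness M) => //; first by move=> m [].
  move=> x Mx; have [z <-] := VM x Mx; exists (dnorm dU z) => m [Mm Vm].
  rewrite HV' (le_trans (dot_le _ _ _))//.
  by rewrite ler_piMr ?dnormr_ge0.
have [K K0 HK] := bounded_opP bV.
pose C := Num.max 1 C1; have C0 : 0 < C by rewrite lt_max ltr01.
have V'low m : M m -> dnorm dW m <= C * dnorm dU (V' m).
  move=> Mm; have [V'0|V'0] := eqVneq (V' m) 0.
    have [z zm] := VM _ Mm; have : dW m m = 0 by rewrite -{1}zm HV' V'0 dot0r.
    by move=> /eqP; rewrite dnorm_eq0 => /eqP ->; rewrite dnormr0 mulr_ge0 ?dnormr_ge0 ?ltW.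
  have n0 : 0 < dnorm dU (V' m) by rewrite lt_neqAle eq_sym dnormr_eq0 V'0 dnormr_ge0.
  have /= := HC1 ((dnorm dU (V' m))^-1%:C *: m).
  have V'Z a z : V' (a *: z) = a *: V' z.
    by apply: dotI => x; rewrite dotZr -!HV' dotZr.
  rewrite V'Z !dnormrZ cmodR ger0_norm ?invr_ge0 ?(ltW n0)// mulVf ?gt_eqF//= => H.
  have := H (conj (closed_subspaceZ cM _ Mm) (lexx _)).
  rewrite mulrC ler_pdivrMr// => /le_trans; apply.
  by rewrite ler_pM2r// le_max lexx orbT.
have V'up m : dnorm dU (V' m) <= K * dnorm dW m.
  have [->|V'0] := eqVneq (V' m) 0; first by rewrite dnormr0 mulr_ge0 ?dnormr_ge0 ?ltW.
  have n0 : 0 < dnorm dU (V' m) by rewrite lt_neqAle eq_sym dnormr_eq0 V'0 dnormr_ge0.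
  rewrite -(ler_pM2r n0) -expr2 dnormE -HV' (le_trans (ler_Re_cmod _))//.
  rewrite (le_trans (dot_le _ _ _))// mulrAC ler_wpM2r ?dnormr_ge0//.
(* Coercivity holds with constant [C ^- 2] because the product of [V (V' m)] with [m] is the squared
   norm of [V' m]. *)
have LM y : M y -> exists2 m, M m & V (V' m) = y.
  apply: (@lax_milgram _ _ dW M (fun m => V (V' m)) (C ^- 2) (K * K)) => //.
  - by rewrite invr_gt0 exprn_gt0.
  - by rewrite mulr_gt0.
  - by move=> a x z _ _; rewrite V'L linearP.
  - by move=> x _; rewrite (le_trans (HK _))// -mulrA ler_wpM2l ?V'up// ltW.
  - move=> x Mx; rewrite HV' -dnormE mulrC ler_pdivrMr ?exprn_gt0// mulrC -exprMn.
    by rewrite ler_pXn2r ?nnegrE ?V'low ?mulr_ge0 ?dnormr_ge0 ?ltW.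
(* Injectivity turns [V (V' m) = V x] into [x = V' m]. Then the squared norm of [x] is the product
   of [V x] with [m], and [m] has norm at most [C] times that of [x]. *)
exists C => x; have [m Mm /Vi xm] := LM _ (MV x).
have [->|x0] := eqVneq x 0; first by rewrite linear0 !dnormr0 mulr0.
have n0 : 0 < dnorm dU x by rewrite lt_neqAle eq_sym dnormr_eq0 x0 dnormr_ge0.
rewrite -(ler_pM2r n0) -expr2 dnormE -{2}xm -HV' (le_trans (ler_Re_cmod _))//.
rewrite (le_trans (dot_le _ _ _))// mulrAC mulrC ler_wpM2r ?dnormr_ge0//.
by rewrite -xm V'low.
Qed.

End BoundedInverse.

Lemma sum_nat_sub (V : zmodType) (F : nat -> V) m n : (m <= n)%N ->
  \sum_(k < n) F k - \sum_(k < m) F k = \sum_(m <= k < n) F k.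
Proof.
move=> mn; rewrite -!(big_mkord xpredT F) (big_cat_nat (leq0n m) mn)/=.
by rewrite addrAC subrr add0r.
Qed.

(** * Bessel sequences and synthesis operators *)

Section Synthesis.
Variables (R : realType) (U : lmodType R[i]) (dot : {dot U for conjC}).
Local Notation N := (dnorm dot).
Implicit Types (b e : nat -> U) (c d : nat -> R[i]) (g x y : U).

Definition bessel b (B : R) : Prop :=
  forall g n, \sum_(k < n) cmod (dot g (b k)) ^+ 2 <= B * N g ^+ 2.

Definition square_summable c : Prop :=
  exists K : R, forall n, \sum_(k < n) cmod (c k) ^+ 2 <= K.

Definition orthonormal_seq e : Prop := forall m n, dot (e m) (e n) = (m == n)%:R.

(* Junk value 0 when the series diverges. *)
Definition synth b c : U :=
  xget 0 [set l | seq_lim dot (fun n => \sum_(k < n) c k *: b k) l].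

Lemma synthE b c l : seq_lim dot (fun n => \sum_(k < n) c k *: b k) l -> synth b c = l.
Proof.
move=> H; rewrite /synth; case: xgetP => [l' _ Hl'|/(_ l)//].
exact: seq_lim_unique Hl' H.
Qed.

Lemma bessel_square_summable b B g : bessel b B -> square_summable (fun k => dot g (b k)).
Proof. by move=> H; exists (B * N g ^+ 2) => n; exact: H. Qed.

Lemma square_summable_tail c : square_summable c -> forall e : R, 0 < e ->
  exists n0, forall m n, (n0 <= m)%N -> (m <= n)%N ->
    \sum_(m <= k < n) cmod (c k) ^+ 2 < e.
Proof.
move=> [K HK] e e0; pose s n := \sum_(k < n) cmod (c k) ^+ 2.
have sE m n : (m <= n)%N -> s n - s m = \sum_(m <= k < n) cmod (c k) ^+ 2.
  exact: (sum_nat_sub (fun k => cmod (c k) ^+ 2)).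
have ss : nondecreasing_seq s.
  by move=> m n mn; rewrite -subr_ge0 sE// sumr_ge0// => k _; exact: sqr_ge0.
have : cvgn s.
  apply: nondecreasing_is_cvgn => //; exists K => _ [n _ <-]; exact: HK.
move=> /cvgrPdist_lt/(_ (e / 2))[|n0 _ H]; first by rewrite divr_gt0.
exists n0 => m n hm mn; rewrite -sE//.
have /= := H m hm; have /= := H n (leq_trans hm mn).
by rewrite !ltr_norml => /andP[? ?] /andP[? ?]; lra.
Qed.

(* AM-GM: [2 |c| |d| <= B |c|^2 + |d|^2 / B]. *)
Lemma bessel_sum_le b B c m n : 0 < B -> bessel b B ->
  N (\sum_(m <= k < n) c k *: b k) ^+ 2 <= B * \sum_(m <= k < n) cmod (c k) ^+ 2.
Proof.
move=> B0 bB; set s := \sum_(m <= k < n) _.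
have sB : \sum_(m <= k < n) cmod (dot s (b k)) ^+ 2 <= B * N s ^+ 2.
  apply: le_trans (bB s n); rewrite -(big_mkord xpredT (fun k => cmod (dot s (b k)) ^+ 2)).
  have [mn|/ltnW nm] := leqP m n; last first.
    by rewrite [leLHS]big_geq// sumr_ge0// => k _; exact: sqr_ge0.
  by rewrite [leRHS](big_cat_nat (leq0n m) mn)/= lerDr sumr_ge0// => k _; exact: sqr_ge0.
(* The sum [s] is paired with itself; after the termwise estimate, the Bessel bound for [s] turns
   the second half of the sum into at most [N s ^+ 2 / 2], which is absorbed on the left. *)
have : N s ^+ 2 <= \sum_(m <= k < n)
    ((B * cmod (c k) ^+ 2 + B^-1 * cmod (dot s (b k)) ^+ 2) / 2).
  rewrite dnormE {1}/s dot_suml raddf_sum/=; apply: ler_sum => k _.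
  rewrite (le_trans (ler_Re_cmod _))// dotZl cmodM dotC cmodJ.
  set u := cmod (c k); set v := cmod _.
  have : 0 <= B^-1 * (B * u - v) ^+ 2 by rewrite mulr_ge0 ?sqr_ge0 ?invr_ge0 ?ltW.
  have -> : B^-1 * (B * u - v) ^+ 2 = B * u ^+ 2 + B^-1 * v ^+ 2 - 2 * (u * v).
    by field; rewrite gt_eqF.
  lra.
rewrite -mulr_suml big_split/= -!mulr_sumr.
have : B^-1 * \sum_(m <= k < n) cmod (dot s (b k)) ^+ 2 <= N s ^+ 2.
  by rewrite mulrC ler_pdivrMr// mulrC.
lra.
Qed.

Lemma bessel_sum_le0 b B c n : 0 < B -> bessel b B ->
  N (\sum_(k < n) c k *: b k) ^+ 2 <= B * \sum_(k < n) cmod (c k) ^+ 2.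
Proof.
move=> B0 bB; have := bessel_sum_le c 0 n B0 bB.
by rewrite !big_mkord.
Qed.

Lemma synth_lim b B c : hilbert dot -> 0 < B -> bessel b B -> square_summable c ->
  seq_lim dot (fun n => \sum_(k < n) c k *: b k) (synth b c).
Proof.
move=> cU B0 bB sc; set u := fun n => _.
have uB m n : (m <= n)%N -> u n - u m = \sum_(m <= k < n) c k *: b k.
  exact: (sum_nat_sub (fun k => c k *: b k)).
have [l ul] : exists l, seq_lim dot u l.
  apply: cU => e e0; have eB : 0 < e ^+ 2 / B by rewrite divr_gt0// exprn_gt0.
  have [n0 H] := square_summable_tail sc eB.
  have H' m n : (n0 <= m)%N -> (m <= n)%N -> N (u n - u m) < e.
    move=> hm mn; rewrite -(@ltr_pXn2r _ 2) ?nnegrE ?dnormr_ge0 ?(ltW e0)//.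
    rewrite uB// (le_lt_trans (bessel_sum_le _ _ _ B0 bB))//.
    by rewrite mulrC -ltr_pdivlMr// H.
  exists n0 => m n hm hn; have [mn|/ltnW nm] := leqP m n; last exact: H'.
  by rewrite dnormrC H'.
by rewrite (synthE ul).
Qed.

Lemma dnorm_synth_le b B c (K : R) : hilbert dot -> 0 < B -> bessel b B ->
  (forall n, \sum_(k < n) cmod (c k) ^+ 2 <= K) ->
  N (synth b c) ^+ 2 <= B * K.
Proof.
move=> cU B0 bB HK; have sc : square_summable c by exists K.
have K0 : 0 <= K by have := HK 0%N; rewrite big_ord0.
rewrite -[leRHS]sqr_sqrtr ?mulr_ge0 ?(ltW B0)//.
rewrite ler_pXn2r ?nnegrE ?dnormr_ge0 ?sqrtr_ge0//.
apply: (dnorm_lim_le (synth_lim cU B0 bB sc)) => n.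
rewrite -(@ler_pXn2r _ 2) ?nnegrE ?dnormr_ge0 ?sqrtr_ge0//.
rewrite [leRHS]sqr_sqrtr ?mulr_ge0 ?(ltW B0)// (le_trans (bessel_sum_le0 _ _ B0 bB))//.
by rewrite ler_pM2l.
Qed.

Lemma synthD b B a c d : hilbert dot -> 0 < B -> bessel b B ->
  square_summable c -> square_summable d ->
  synth b (fun k => a * c k + d k) = a *: synth b c + synth b d.
Proof.
move=> cU B0 bB sc sd; apply: synthE.
have := seq_limD (seq_limZ a (synth_lim cU B0 bB sc)) (synth_lim cU B0 bB sd).
congr seq_lim; apply/funext => n; rewrite scaler_sumr -big_split/=.
by apply: eq_bigr => k _; rewrite scalerDl scalerA.
Qed.

Section Orthonormal.
Variables (e : nat -> U) (oe : orthonormal_seq e).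

Lemma dot_orthonormal_sum c n k :
  dot (\sum_(i < n) c i *: e i) (e k) = if (k < n)%N then c k else 0.
Proof.
rewrite dot_suml; under eq_bigr do rewrite dotZl oe.
case: ifPn => [kn|]; last first.
  rewrite -leqNgt => nk; rewrite big1// => i _.
  by rewrite ltn_eqF ?mulr0// (leq_trans (ltn_ord i)).
rewrite (bigD1 (Ordinal kn))//= eqxx mulr1 big1 ?addr0// => i /negP ik.
case: eqP => [ik'|_]; last by rewrite mulr0.
by exfalso; apply: ik; apply/eqP/val_inj.
Qed.

Lemma sqr_dnorm_orthonormal_sum c n :
  N (\sum_(k < n) c k *: e k) ^+ 2 = \sum_(k < n) cmod (c k) ^+ 2.
Proof.
rewrite dnormE dot_sumr raddf_sum/=; apply: eq_bigr => k _.
by rewrite dotZr dot_orthonormal_sum ltn_ord mulrC mul_conjC.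
Qed.

Lemma bessel_orthonormal : bessel e 1.
Proof.
move=> g n; rewrite mul1r; set p := \sum_(k < n) dot g (e k) *: e k.
have gp : Re (dot g p) = \sum_(k < n) cmod (dot g (e k)) ^+ 2.
  rewrite dot_sumr raddf_sum/=; apply: eq_bigr => k _.
  by rewrite dotZr mulrC mul_conjC.
have := sqr_ge0 (N (g - p)); rewrite sqr_dnormB gp.
rewrite /p (sqr_dnorm_orthonormal_sum (fun k => dot g (e k))).
by rewrite mulr2n; lra.
Qed.

Hypothesis cU : hilbert dot.

Lemma dot_synth c k : square_summable c -> dot (synth e c) (e k) = c k.
Proof.
move=> sc; apply: (dot_lim_unique (synth_lim cU ltr01 bessel_orthonormal sc)).
apply: cvg_near_cst; exists k.+1 => // n /= kn.
by rewrite dot_orthonormal_sum kn subrr cmod0.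
Qed.

Lemma parseval_synth c : square_summable c ->
  \sum_(k < n) cmod (c k) ^+ 2 @[n --> \oo] --> N (synth e c) ^+ 2.
Proof.
move=> sc; have ul := dnorm_lim (synth_lim cU ltr01 bessel_orthonormal sc).
rewrite expr2; under eq_fun do rewrite -sqr_dnorm_orthonormal_sum expr2.
exact: cvgM.
Qed.

End Orthonormal.

End Synthesis.

(** * Analysis along one family followed by synthesis along another *)

Section MixedFrameOperator.
Variables (R : realType) (U W : lmodType R[i]).
Variables (dU : {dot U for conjC}) (dW : {dot W for conjC}).
Implicit Types (a : nat -> U) (b : nat -> W).

(** One formula for several operators: with [a] orthonormal it is the synthesis map of [b], with [b]
    orthonormal the analysis map of [a], with both orthonormal a partial isometry. *)
Definition mixop a b (x : U) : W := synth dW b (fun k => dU x (a k)).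

Variables (a : nat -> U) (b : nat -> W) (A B : R).
Hypotheses (cU : hilbert dU) (cW : hilbert dW) (A0 : 0 < A) (B0 : 0 < B).
Hypotheses (aA : bessel dU a A) (bB : bessel dW b B).

Lemma mixop_lim x : seq_lim dW (fun n => \sum_(k < n) dU x (a k) *: b k) (mixop a b x).
Proof. by apply: (synth_lim cW B0 bB); exact: bessel_square_summable aA. Qed.

Lemma mixop_linear : linear (mixop a b).
Proof.
move=> s x y; rewrite /mixop -(synthD _ cW B0 bB).
- by congr synth; apply/funext => k; rewrite dotDl dotZl.
- exact: bessel_square_summable aA.
- exact: bessel_square_summable aA.
Qed.

Lemma mixop_bounded x : dnorm dW (mixop a b x) ^+ 2 <= B * A * dnorm dU x ^+ 2.
Proof. by rewrite -mulrA; apply: dnorm_synth_le => // n; exact: aA. Qed.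

Lemma mixop_bounded_op : bounded_op dU dW (mixop a b).
Proof.
exists (Num.sqrt (B * A)) => x.
rewrite -(@ler_pXn2r _ 2) ?nnegrE ?mulr_ge0 ?dnormr_ge0 ?sqrtr_ge0//.
rewrite exprMn (@sqr_sqrtr _ (B * A)) ?mixop_bounded//.
by rewrite mulr_ge0 ?ltW.
Qed.

Lemma mixop_dotC x y (q : U) :
  seq_lim dU (fun n => \sum_(k < n) dW y (b k) *: a k) q ->
  dW (mixop a b x) y = dU x q.
Proof.
move=> vq; apply: (dot_lim_unique (mixop_lim x)).
apply: (@squeeze_cvgr _ _ _ _ (cst 0)
  (fun n => dnorm dU x * dnorm dU (\sum_(k < n) dW y (b k) *: a k - q))); last 2 first.
- exact: cvg_cst.
- by rewrite -[X in _ --> X](mulr0 (dnorm dU x)); exact: cvgMr.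
near=> n; rewrite cmod_ge0/=.
have -> : dW (\sum_(k < n) dU x (a k) *: b k) y =
    dU x (\sum_(k < n) dW y (b k) *: a k).
  rewrite dot_suml dot_sumr; apply: eq_bigr => k _.
  by rewrite dotZl dotZr mulrC -dotC.
by rewrite -dotBr dot_le.
Unshelve. all: by end_near. Qed.

Lemma mixop_comp_linear (V : lmodType R[i]) (dV : {dot V for conjC}) (L : {linear W -> V}) x :
  bounded_op dW dV L -> L (mixop a b x) = synth dV (fun k => L (b k)) (fun k => dU x (a k)).
Proof.
move=> bL; apply/esym/synthE; have := bounded_op_lim bL (mixop_lim x).
congr seq_lim; apply/funext => n; rewrite linear_sum/=.
by apply: eq_bigr => k _; rewrite linearZ.
Qed.

End MixedFrameOperator.

(** Exchanging the two families gives the adjoint; in particular analysis and synthesis along the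
    same orbit are adjoint to each other. *)
Lemma mixop_adjoint (R : realType) (U W : lmodType R[i])
    (dU : {dot U for conjC}) (dW : {dot W for conjC}) a b (A B : R) :
  hilbert dU -> hilbert dW -> 0 < A -> 0 < B -> bessel dU a A -> bessel dW b B ->
  forall x y, dW (mixop dU dW a b x) y = dU x (mixop dW dU b a y).
Proof.
move=> cU cW A0 B0 aA bB x y; apply: (mixop_dotC cW B0 aA bB).
exact: (mixop_lim cU A0 bB aA).
Qed.

(** * Completeness of L2 *)

Section L2Completeness.
Context d (T : measurableType d) (R : realType).
Variable mu : {measure set T -> \bar R}.

Lemma Lfun2P (u : T -> R) : u \in Lfun mu 2%:E <->
  measurable_fun setT u /\ (\int[mu]_x (u x ^+ 2)%:E < +oo)%E.
Proof.
split=> [u2|[mu_ u2]].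
  have /integrableP[_ ] := Lfun2_integrable_sqr u2.
  under eq_integral do rewrite /= ger0_norm ?sqr_ge0//.
  by move=> H; split => //; have := sub_Lfun_mfun u2; rewrite inE.
apply/andP; split; rewrite inE//=.
rewrite /finite_norm unlock.
apply: poweR_lty.
under eq_integral do rewrite /= powR_mulrn ?normr_ge0// real_normK ?num_real//.
by [].
Qed.

Lemma measurable_sqr_EFin (u : T -> R) : measurable_fun setT u ->
  measurable_fun setT (fun x => (u x ^+ 2)%:E).
Proof. by move=> mu_; apply/measurable_EFinP; exact: measurable_funX. Qed.

Hypothesis mu1 : mu setT = 1%E.

(** Integrating [|u| <= u^2 / (2 r) + r / 2] over total mass 1 gives [r]. This converts an L2 rate
    into an L1 rate. *)
Lemma integral_abs_le (u : T -> R) (r : R) : 0 < r -> measurable_fun setT u ->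
  (\int[mu]_x (u x ^+ 2)%:E <= (r ^+ 2)%:E)%E -> (\int[mu]_x `|u x|%:E <= r%:E)%E.
Proof.
move=> r0 mu_ ur.
have H x : (`|u x|%:E <= ((2 * r)^-1)%:E * (u x ^+ 2)%:E + (r / 2)%:E)%E.
  rewrite -EFinM -EFinD lee_fin; have := sqr_ge0 (`|u x| - r).
  rewrite sqrrB real_normK ?num_real// => h.
  have -> : (2 * r)^-1 * u x ^+ 2 + r / 2 = `|u x| +
      (2 * r)^-1 * (u x ^+ 2 - `|u x| * r *+ 2 + r ^+ 2).
    by rewrite mulr2n; field; rewrite gt_eqF.
  by rewrite lerDl mulr_ge0// invr_ge0 mulr_ge0 ?ltW.
apply: (@le_trans _ _ (\int[mu]_x (((2 * r)^-1)%:E * (u x ^+ 2)%:E + (r / 2)%:E))%E).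
  apply: ge0_le_integral => //=.
  - by apply/measurable_EFinP; exact: measurableT_comp.
  - apply: emeasurable_funD => //; apply: measurable_funeM; exact: measurable_sqr_EFin.
rewrite ge0_integralD//=; first last.
- by move=> x _; rewrite lee_fin divr_ge0 ?ltW.
- by apply: measurable_funeM; exact: measurable_sqr_EFin.
- by move=> x _; rewrite lee_fin mulr_ge0 ?sqr_ge0// invr_ge0 mulr_ge0 ?ltW.
rewrite ge0_integralZl//=; first last.
- by rewrite lee_fin invr_ge0 mulr_ge0 ?ltW.
- by move=> x _; rewrite lee_fin sqr_ge0.
- exact: measurable_sqr_EFin.
rewrite integral_cst//= mu1 mule1.
apply: (@le_trans _ _ (((2 * r)^-1)%:E * (r ^+ 2)%:E + (r / 2)%:E)%E).
  by rewrite leeD2r// lee_wpmul2l// lee_fin invr_ge0 mulr_ge0 ?ltW.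
rewrite -EFinM -EFinD lee_fin le_eqVlt; apply/orP; left; apply/eqP.
by field; rewrite gt_eqF.
Qed.

(* Riesz-Fischer: the increments are summable in L1, hence a.e. absolutely summable. *)
Lemma fast_cauchy_L2_lim (u : nat -> T -> R) :
  (forall n, measurable_fun setT (u n)) ->
  (forall m n, (n <= m)%N ->
     (\int[mu]_x ((u m x - u n x) ^+ 2)%:E <= ((2^-1 ^+ n) ^+ 2)%:E)%E) ->
  exists2 v : T -> R, measurable_fun setT v & forall n,
    (\int[mu]_x ((v x - u n x) ^+ 2)%:E <= ((2^-1 ^+ n) ^+ 2)%:E)%E.
Proof.
move=> mu_ H; pose D n x := u n.+1 x - u n x.
have mD n : measurable_fun setT (D n) by exact: measurable_funB.
have q0 n : 0 < 2^-1 ^+ n :> R by rewrite exprn_gt0// invr_gt0.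
have intD n : (\int[mu]_x `|D n x|%:E <= (2^-1 ^+ n)%:E)%E.
  by apply: integral_abs_le => //; exact: H.
have mabs n : measurable_fun setT (fun x => `|D n x|%:E).
  by apply/measurable_EFinP; exact: measurableT_comp.
pose S x := (\sum_(0 <= n <oo) `|D n x|%:E)%E.
have mS : measurable_fun setT S by apply: ge0_emeasurable_sum => // *; rewrite lee_fin.
have S0 x : (0 <= S x)%E by apply: nneseries_ge0 => // *; rewrite lee_fin.
have intS : (\int[mu]_x S x < +oo)%E.
  rewrite /S integral_nneseries//.
  apply: (@le_lt_trans _ _ (\sum_(0 <= n <oo) (2^-1 ^+ n)%:E)%E).
    apply: lee_nneseries => [n _ _|n _]; last exact: intD.
    by apply: integral_ge0 => x _; rewrite lee_fin.
  have := @cvg_geometric_series R 1 2^-1.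
  rewrite ger0_norm ?invr_ge0// invf_lt1// ltr1n => /(_ isT) cvgs.
  have : (\sum_(0 <= n < k) (2^-1 ^+ n : R)%:E)%E @[k --> \oo] --> (1 / (1 - 2^-1) : R)%:E.
    under eq_fun do rewrite sumEFin.
    apply: cvg_EFin; first by near=> x.
    move: cvgs; apply: cvg_trans; apply: near_eq_cvg; near=> k => /=.
    by rewrite /series /geometric /=; apply: eq_bigr => i _; rewrite mul1r.
  by move=> /cvg_lim -> //; rewrite ltry.
have aeS : \forall x \ae mu, (S x \is a fin_num).
  have : mu.-integrable setT S.
    by apply/integrableP; split => //; under eq_integral do rewrite gee0_abs//.
  by move=> /(integrable_ae measurableT); apply: filterS => x; exact.
(* The upper limit is measurable on the whole space, and it is the actual limit wherever [S] is
   finite, hence almost everywhere. *)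
pose v x := fine (limn_esup (fun n => (u n x)%:E)).
have mv : measurable_fun setT v.
  apply: measurableT_comp => //; apply: measurable_fun_limn_esup => n.
  exact/measurable_EFinP.
have aev : \forall x \ae mu, u n x @[n --> \oo] --> v x.
  apply: filterS aeS => x fS.
  have cD : cvgn (series (fun n => D n x)).
    apply: normed_cvg => /=; have cS : cvgn (fun n => (\sum_(0 <= k < n) `|D k x|%:E)%E).
      by apply: is_cvg_nneseries => *; rewrite lee_fin.
    have /fine_cvgP[_ cf] : (\sum_(0 <= k < n) `|D k x|%:E)%E @[n --> \oo] --> (fine (S x))%:E.
      by rewrite fineK.
    apply: cvgP; move: cf; apply: cvg_trans; apply: near_eq_cvg; near=> k => /=.
    by rewrite sumEFin.
  have cu : cvgn (fun n => u n x).
    rewrite (_ : (fun n => _) = (fun n => u 0%N x + series (fun n => D n x) n)).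
      by apply: is_cvgD => //; exact: is_cvg_cst.
    by apply/funext => n; rewrite /series/= /D telescope_sumr// addrC subrK.
  suff -> : v x = limn (fun n => u n x) by [].
  rewrite /v; have -> : limn_esup (fun n => (u n x)%:E) = (limn (fun n => u n x))%:E.
    have [] := @cvg_limn_einf_sup _ (fun n => (u n x)%:E) (limn (fun n => u n x))%:E; last by [].
    by apply: cvg_EFin => //; near=> n.
  by [].
exists v => // n.
have mvn : measurable_fun setT (fun x => ((v x - u n x) ^+ 2)%:E).
  by apply: measurable_sqr_EFin; exact: measurable_funB.
have mun m : measurable_fun setT (fun x => ((u (m + n)%N x - u n x) ^+ 2)%:E).
  by apply: measurable_sqr_EFin; exact: measurable_funB.
(* Fatou's lemma carries the bound on [u (m + n) - u n], uniform in [m], over to [v - u n]. *)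
have -> : (\int[mu]_x ((v x - u n x) ^+ 2)%:E =
   \int[mu]_x limn_einf (fun m => ((u (m + n)%N x - u n x) ^+ 2)%:E))%E.
  apply: ae_eq_integral => //.
    apply: measurableT_comp => //; apply: measurable_fun_limn_esup => m.
    by apply: measurableT_comp => //; exact: mun.
  apply: filterS aev => x ux _; apply/esym.
  have [] := @cvg_limn_einf_sup _ (fun m => ((u (m + n)%N x - u n x) ^+ 2)%:E)
    ((v x - u n x) ^+ 2)%:E; last by [].
  apply: cvg_EFin; first by near=> m.
  have unx : u (m + n)%N x @[m --> \oo] --> v x by rewrite (cvg_shiftn n (fun m => u m x)).
  under eq_fun do rewrite /= expr2; rewrite expr2.
  by apply: cvgM; apply: cvgB => //; exact: cvg_cst.
apply: (le_trans (fatou mu measurableT mun _)) => [m x _|]; first by rewrite lee_fin sqr_ge0.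
rewrite limn_einf_lim; apply: lime_le; first exact: is_cvg_einfs.
near=> k; apply: (@le_trans _ _ (\int[mu]_x ((u (k + n)%N x - u n x) ^+ 2)%:E)%E).
  by apply: ereal_inf_lbound; exists k => /=.
by apply: H; rewrite leq_addl.
Unshelve. all: by end_near. Qed.

End L2Completeness.

Section L2Facts.
Context d (T : measurableType d) (R : realType).
Variable mu : {measure set T -> \bar R}.
Local Notation L2T := (L2 mu).
Local Notation N := (dnorm (@L2dot _ _ _ mu)).
Implicit Types (f g : L2T) (a : R[i]).

Lemma L2_ext f g : (\forall x \ae mu, f x = g x) -> f = g.
Proof. by move=> fg; rewrite -[f]reprK -[g]reprK; apply/L2_eqP. Qed.

Lemma L2DE f g : \forall x \ae mu, (f + g : L2T) x = f x + g x.
Proof. by have := L2_linE 1 f g; rewrite scale1r; apply: filterS => x ->; rewrite mul1r. Qed.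

Lemma L2_0E : \forall x \ae mu, (0 : L2T) x = 0.
Proof.
by have := L2_linE (-1) (0 : L2T) 0; rewrite scaler0 addr0; apply: filterS => x; rewrite mulN1r addNr.
Qed.

Lemma L2ZE a f : \forall x \ae mu, (a *: f : L2T) x = a * f x.
Proof.
have := L2_linE a f 0; rewrite addr0; apply: filterS2 L2_0E => x -> ->.
by rewrite addr0.
Qed.

Lemma L2BE f g : \forall x \ae mu, (f - g : L2T) x = f x - g x.
Proof.
have := L2_linE (-1) g f; rewrite scaleN1r addrC.
by apply: filterS => x ->; rewrite mulN1r addrC.
Qed.

Lemma cLfun_measurable (p : \bar R) (F : T -> R[i]) : F \in cLfun mu p ->
  measurable_fun setT (Re \o F) /\ measurable_fun setT (Im \o F).
Proof.
by move=> /andP[/sub_Lfun_mfun + /sub_Lfun_mfun]; rewrite !inE.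
Qed.

Lemma sqr_dnorm_L2 f : ((N f ^+ 2)%:E =
  \int[mu]_x (Re (f x) ^+ 2)%:E + \int[mu]_x (Im (f x) ^+ 2)%:E)%E.
Proof.
have /andP[f1 f2] := L2P f.
have i1 := Lfun2_integrable_sqr f1; have i2 := Lfun2_integrable_sqr f2.
rewrite dnormE /= /L2dot /cintegral/=.
under eq_Rintegral do rewrite mul_conjC /= sqr_cmod.
rewrite (RintegralD measurableT i1 i2) EFinD /Rintegral !fineK//.
- exact: (integrable_fin_num measurableT i2).
- exact: (integrable_fin_num measurableT i1).
Qed.

Lemma sqr_dnorm_L2B f (F : T -> R[i]) g : F \in cLfun mu 2%:E ->
  (\forall x \ae mu, f x = F x) -> ((N (f - g) ^+ 2)%:E =
  \int[mu]_x ((Re (F x) - Re (g x)) ^+ 2)%:E +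
  \int[mu]_x ((Im (F x) - Im (g x)) ^+ 2)%:E)%E.
Proof.
move=> F2 fF; rewrite sqr_dnorm_L2.
have [m1 m2] := cLfun_measurable F2; have [m3 m4] := cLfun_measurable (L2P g).
have [m5 m6] := cLfun_measurable (L2P (f - g)).
congr (_ + _)%E; apply: ae_eq_integral => //; try apply: measurable_sqr_EFin => //.
- exact: measurable_funB.
- by apply: filterS2 fF (L2BE f g) => x fFx -> _; rewrite fFx raddfB.
- exact: measurable_funB.
- by apply: filterS2 fF (L2BE f g) => x fFx -> _; rewrite fFx raddfB.
Qed.

Lemma LfunB2 (u v : T -> R) : u \in Lfun mu 2%:E -> v \in Lfun mu 2%:E ->
  (fun x => u x - v x) \in Lfun mu 2%:E.
Proof.
move=> u2 v2; have le12 : (1 <= 2%:E :> \bar R)%E by rewrite lee_fin ler1n.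
have [_ LZD] := Lfun_submod_closed mu le12.
rewrite (_ : (fun x => _) = (-1) *: v + u); first exact: LZD.
by apply/funext => x; rewrite !fctE /GRing.scale/= mulN1r addrC.
Qed.

Hypothesis mu1 : mu setT = 1%E.

Theorem L2_hilbert : hilbert (@L2dot _ _ _ mu).
Proof.
suff H (f : nat -> L2T) : seq_cauchy (@L2dot _ _ _ mu) f ->
  exists l : L2T, seq_lim (@L2dot _ _ _ mu) f l by exact: H.
move=> fC.
have /choice[n0 Hn0] (k : nat) : exists n0, forall m n, (n0 <= m)%N -> (n0 <= n)%N ->
    N (f m - f n) < 2^-1 ^+ k.
  by apply: fC; rewrite exprn_gt0// invr_gt0.
(* Summing the thresholds makes [phi] nondecreasing and at least [n0 k], so the subsequence along
   [phi] has the geometric rate that the real and imaginary parts require. *)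
pose phi k := (\sum_(i < k.+1) n0 i)%N.
have phi_ge k : (n0 k <= phi k)%N by rewrite /phi big_ord_recr/= leq_addl.
have phi_mono k l : (k <= l)%N -> (phi k <= phi l)%N.
  move=> /subnKC <-; elim: (l - k)%N => [|j IH]; first by rewrite addn0.
  by rewrite (leq_trans IH)// addnS /phi [leqRHS]big_ord_recr/= leq_addr.
have Hphi k l : (k <= l)%N ->
    (\int[mu]_x ((Re (f (phi l) x) - Re (f (phi k) x)) ^+ 2)%:E +
     \int[mu]_x ((Im (f (phi l) x) - Im (f (phi k) x)) ^+ 2)%:E <=
     ((2^-1 ^+ k) ^+ 2)%:E)%E.
  move=> kl; rewrite -(@sqr_dnorm_L2B (f (phi l)) (f (phi l)) (f (phi k))) ?L2P//; last exact: aeW.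
  rewrite lee_fin ler_pXn2r ?nnegrE ?dnormr_ge0 ?exprn_ge0 ?invr_ge0//.
  by rewrite ltW// Hn0// (leq_trans _ (phi_mono _ _ kl)).
have mf k := cLfun_measurable (L2P (f k)).
have int0 (u : T -> R) : (0 <= \int[mu]_x ((u x) ^+ 2)%:E)%E.
  by apply: integral_ge0 => x _; rewrite lee_fin sqr_ge0.
have [v mv Hv] : exists2 v : T -> R, measurable_fun setT v & forall n,
    (\int[mu]_x ((v x - Re (f (phi n) x)) ^+ 2)%:E <= ((2^-1 ^+ n) ^+ 2)%:E)%E.
  apply: (fast_cauchy_L2_lim mu1 (fun k => (mf (phi k)).1)) => m n nm.
  by apply: le_trans (Hphi _ _ nm); rewrite leeDl.
have [w mw Hw] : exists2 w : T -> R, measurable_fun setT w & forall n,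
    (\int[mu]_x ((w x - Im (f (phi n) x)) ^+ 2)%:E <= ((2^-1 ^+ n) ^+ 2)%:E)%E.
  apply: (fast_cauchy_L2_lim mu1 (fun k => (mf (phi k)).2)) => m n nm.
  by apply: le_trans (Hphi _ _ nm); rewrite leeDr.
have /andP[f01 f02] := L2P (f (phi 0%N)).
have L2of (u u0 : T -> R) (r : R) : measurable_fun setT u -> u0 \in Lfun mu 2%:E ->
    (\int[mu]_x ((u x - u0 x) ^+ 2)%:E <= r%:E)%E -> u \in Lfun mu 2%:E.
  move=> mu_ u02 ur.
  have mu0 : measurable_fun setT u0 by have := sub_Lfun_mfun u02; rewrite inE.
  have uu0 : (fun x => u0 x - u x) \in Lfun mu 2%:E.
    apply/Lfun2P; split; first exact: measurable_funB.
    apply: le_lt_trans (ltry r); apply: le_trans ur.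
    by rewrite le_eqVlt; apply/orP; left; apply/eqP/eq_integral => x _; rewrite -sqrrN opprB.
  rewrite (_ : u = fun x => u0 x - (u0 x - u x)); first exact: LfunB2.
  by apply/funext => x; rewrite opprB addrC subrK.
have v2 : v \in Lfun mu 2%:E := L2of _ _ _ mv f01 (Hv 0%N).
have w2 : w \in Lfun mu 2%:E := L2of _ _ _ mw f02 (Hw 0%N).
pose F x := v x +i* w x.
have F2 : F \in sqint mu by apply/andP; split.
pose l := toL2 mu F; have lF := toL2E F2.
(* Real and imaginary errors of [2^-k] each combine to the square root of 2 times [2^-k], rounded up
   to 2. The Cauchy estimate adds one more [2^-k], whence the factor 3 below. *)
have dl k : N (l - f (phi k)) <= 2 * 2^-1 ^+ k.
  rewrite -(@ler_pXn2r _ 2) ?nnegrE ?dnormr_ge0 ?mulr_ge0 ?exprn_ge0 ?invr_ge0//.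
  rewrite -lee_fin (sqr_dnorm_L2B _ F2 lF) exprMn.
  apply: (@le_trans _ _ (((2^-1 ^+ k) ^+ 2)%:E + ((2^-1 ^+ k) ^+ 2)%:E)%E).
    by apply: leeD; [exact: Hv|exact: Hw].
  rewrite -EFinD lee_fin; have := sqr_ge0 (2^-1 ^+ k : R); lra.
exists l; apply/seq_limP => e e0.
have : (fun k => 3 * 2^-1 ^+ k) @ \oo --> (0 : R).
  rewrite -[X in _ --> X](mulr0 3); apply: cvgMr; apply: cvg_expr.
  by rewrite ger0_norm ?invr_ge0// invf_lt1// ltr1n.
move=> /cvgrPdist_lt/(_ e e0)[k _ Hk].
exists (phi k) => n kn; rewrite (le_lt_trans (dnormr_triangle _ (f (phi k)) _ _))//.
rewrite addrC [X in X + _]dnormrC.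
have := Hk k (leqnn k); rewrite /= sub0r normrN ger0_norm ?mulr_ge0 ?exprn_ge0 ?invr_ge0//.
have := Hn0 k n (phi k) (leq_trans (phi_ge k) kn) (phi_ge k); have := dl k.
lra.
Qed.

End L2Facts.

(** * Multiplication by bounded measurable functions *)

Section BoundedMultiplication.
Context d (T : measurableType d) (R : realType).
Variable mu : {measure set T -> \bar R}.
Implicit Types (f g : T -> R[i]).

Definition bounded_measurable g : Prop :=
  [/\ measurable_fun setT (Re \o g), measurable_fun setT (Im \o g) &
      exists K : R, forall x, cmod (g x) <= K].

Lemma bounded_measurable_cst a : bounded_measurable (fun=> a).
Proof. by split; [exact: measurable_cst|exact: measurable_cst|exists (cmod a)]. Qed.

Lemma bounded_measurableD f g : bounded_measurable f -> bounded_measurable g ->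
  bounded_measurable (fun x => f x + g x).
Proof.
move=> [f1 f2 [K HK]] [g1 g2 [L HL]]; split.
- rewrite (_ : _ \o _ = (Re \o f) \+ (Re \o g)); first exact: measurable_funD.
  by apply/funext => x /=; rewrite raddfD.
- rewrite (_ : _ \o _ = (Im \o f) \+ (Im \o g)); first exact: measurable_funD.
  by apply/funext => x /=; rewrite raddfD.
- by exists (K + L) => x; rewrite (le_trans (cmodD _ _))// lerD.
Qed.

Lemma bounded_measurableM f g : bounded_measurable f -> bounded_measurable g ->
  bounded_measurable (fun x => f x * g x).
Proof.
move=> [f1 f2 [K HK]] [g1 g2 [L HL]]; split.
- rewrite (_ : _ \o _ = ((Re \o f) \* (Re \o g)) \- ((Im \o f) \* (Im \o g))).
    by apply: measurable_funB; exact: measurable_funM.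
  by apply/funext => x /=; rewrite Defs.ReM.
- rewrite (_ : _ \o _ = ((Re \o f) \* (Im \o g)) \+ ((Im \o f) \* (Re \o g))).
    by apply: measurable_funD; exact: measurable_funM.
  by apply/funext => x /=; rewrite Defs.ImM.
- by exists (K * L) => x; rewrite cmodM ler_pM ?cmod_ge0.
Qed.

Lemma bounded_measurable_conj f : bounded_measurable f ->
  bounded_measurable (fun x => conjC (f x)).
Proof.
move=> [f1 f2 [K HK]]; split.
- by rewrite (_ : _ \o _ = (Re \o f))//; apply/funext => x /=; rewrite ReJ.
- rewrite (_ : _ \o _ = \- (Im \o f)); first exact: measurableT_comp.
  by apply/funext => x /=; rewrite ImJ.
- by exists K => x; rewrite cmodJ.
Qed.

Lemma bounded_measurableX f n : bounded_measurable f ->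
  bounded_measurable (fun x => f x ^+ n).
Proof.
move=> bf; elim: n => [|n IH]; first exact: bounded_measurable_cst.
by under eq_fun do rewrite exprS; exact: bounded_measurableM.
Qed.

Lemma Lfun1_bounded_mul (b u : T -> R) (K : R) : measurable_fun setT b ->
  (forall x, `|b x| <= K) -> u \in Lfun mu 1 -> (fun x => b x * u x) \in Lfun mu 1.
Proof.
move=> mb bK /Lfun1_integrable u1; apply/Lfun1_integrable.
have mu_ : measurable_fun setT u by exact/measurable_EFinP/(measurable_int mu u1).
apply: (@le_integrable _ _ _ _ _ measurableT _ (fun x => K%:E * (EFin \o u) x)%E).
- by apply/measurable_EFinP; exact: measurable_funM.
- move=> x _; rewrite /= lee_fin !normrM ler_wpM2r//.
  exact: le_trans (bK x) (ler_norm _).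
- exact: integrableZl.
Qed.

Lemma Lfun2_bounded_mulr (b u : T -> R) (K : R) : measurable_fun setT b ->
  (forall x, `|b x| <= K) -> u \in Lfun mu 2%:E -> (fun x => b x * u x) \in Lfun mu 2%:E.
Proof.
move=> mb bK /Lfun2P[mu_ u2]; apply/Lfun2P; split; first exact: measurable_funM.
apply: (@le_lt_trans _ _ (\int[mu]_x ((K ^+ 2)%:E * (u x ^+ 2)%:E))%E).
  apply: ge0_le_integral => //=.
  - by move=> x _; rewrite lee_fin sqr_ge0.
  - by apply: measurable_sqr_EFin; exact: measurable_funM.
  - by apply: measurable_funeM; exact: measurable_sqr_EFin.
  - move=> x _; rewrite lee_fin exprMn ler_wpM2r ?sqr_ge0//.
    by rewrite -(real_normK (num_real (b x))) lerXn2r ?nnegrE// (le_trans _ (bK x)).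
rewrite ge0_integralZl//=.
- by rewrite lte_mul_pinfty// lee_fin sqr_ge0.
- exact: measurable_sqr_EFin.
- by move=> x _; rewrite lee_fin sqr_ge0.
- by rewrite lee_fin sqr_ge0.
Qed.

Lemma cmod_ge_Re a : `|Re a| <= cmod a :> R.
Proof. by rewrite cmod_def -sqrtr_sqr ler_wsqrtr// lerDl sqr_ge0. Qed.

Lemma cmod_ge_Im a : `|Im a| <= cmod a :> R.
Proof. by rewrite cmod_def -sqrtr_sqr ler_wsqrtr// lerDr sqr_ge0. Qed.

Lemma cLfun_mul_closed (p : \bar R) f g : (1 <= p)%E -> bounded_measurable g ->
  (forall (b u : T -> R) (K : R), measurable_fun setT b -> (forall x, `|b x| <= K) ->
     u \in Lfun mu p -> (fun x => b x * u x) \in Lfun mu p) ->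
  f \in cLfun mu p -> (fun x => g x * f x) \in cLfun mu p.
Proof.
move=> p1 [g1 g2 [K HK]] H /andP[f1 f2].
have [_ LZD] := Lfun_submod_closed mu p1.
have bR x : `|Re (g x)| <= K by rewrite (le_trans (cmod_ge_Re _)).
have bI x : `|Im (g x)| <= K by rewrite (le_trans (cmod_ge_Im _)).
apply/andP; split.
- rewrite (_ : _ \o _ = (-1) *: (fun x => Im (g x) * Im (f x)) + (fun x => Re (g x) * Re (f x))).
    by apply: LZD; apply: (H _ _ K).
  by apply/funext => x; rewrite !fctE/= Defs.ReM /GRing.scale/= mulN1r addrC.
- rewrite (_ : _ \o _ = 1 *: (fun x => Im (g x) * Re (f x)) + (fun x => Re (g x) * Im (f x))).
    by apply: LZD; apply: (H _ _ K).
  by apply/funext => x; rewrite !fctE/= Defs.ImM /GRing.scale/= mul1r addrC.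
Qed.

Lemma cLfun1_bounded_mul f g : bounded_measurable g -> f \in cLfun mu 1 ->
  (fun x => g x * f x) \in cLfun mu 1.
Proof. by move=> bg; apply: cLfun_mul_closed => //; exact: Lfun1_bounded_mul. Qed.

Lemma cLfun2_bounded_mul f g : bounded_measurable g -> f \in cLfun mu 2%:E ->
  (fun x => g x * f x) \in cLfun mu 2%:E.
Proof.
move=> bg; apply: cLfun_mul_closed => //; first by rewrite lee_fin ler1n.
exact: Lfun2_bounded_mulr.
Qed.

Lemma cLfun_linear (p : \bar R) a f g : (1 <= p)%E -> f \in cLfun mu p -> g \in cLfun mu p ->
  (fun x => a * f x + g x) \in cLfun mu p.
Proof. by move=> p1 f1 g1; have [_ LZD] := cLfun_submod_closed mu p1; exact: LZD. Qed.

Lemma cLfun_conj (p : \bar R) f : (1 <= p)%E -> f \in cLfun mu p ->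
  (fun x => conjC (f x)) \in cLfun mu p.
Proof.
move=> p1 /andP[f1 f2]; apply/andP; split.
  by rewrite (_ : _ \o _ = (Re \o f))//; apply/funext => x /=; rewrite ReJ.
have [L0 LZD] := Lfun_submod_closed mu p1.
rewrite (_ : _ \o _ = (-1) *: (Im \o f) + 0); first exact: LZD.
by apply/funext => x; rewrite !fctE /= addr0 ImJ /GRing.scale/= mulN1r.
Qed.

(** Dominated convergence under [K |u|]. It is what closes the null multipliers under bounded
    pointwise limits. *)
Lemma Rintegral_bounded_lim (u : T -> R) (p_ : nat -> T -> R) (p : T -> R) (K : R) :
  u \in Lfun mu 1 -> (forall n, measurable_fun setT (p_ n)) -> measurable_fun setT p ->
  (forall n x, `|p_ n x| <= K) -> (forall x, p_ n x @[n --> \oo] --> p x) ->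
  (forall n, \int[mu]_x (p_ n x * u x) = 0)%R -> (\int[mu]_x (p x * u x) = 0)%R.
Proof.
move=> u1 mp_ mp pK pl int0; have /Lfun1_integrable iu := u1.
have mu_ : measurable_fun setT u by exact/measurable_EFinP/(measurable_int mu iu).
have := @dominated_convergence _ _ _ mu setT measurableT
  (fun n x => (p_ n x * u x)%:E) (fun x => (p x * u x)%:E) (fun x => (K%:E * `|(u x)%:E|)%E).
case.
- by move=> n; apply/measurable_EFinP; exact: measurable_funM.
- by apply/measurable_EFinP; exact: measurable_funM.
- apply: aeW => x _; apply: cvg_EFin; first by near=> n.
  by apply: cvgMl => //; exact: pl.
- by apply: integrableZl => //; exact: integrable_abse.
- by apply: aeW => x n _; rewrite /= lee_fin normrM ler_wpM2r.
move=> _ _ H; rewrite /Rintegral.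
have -> : (\int[mu]_x (p x * u x)%:E = 0)%E; last by [].
apply: (@cvg_unique _ (@ereal_hausdorff R) _ _ _ _ H) => //.
have -> : [sequence (\int[mu]_x (p_ n x * u x)%:E)%E]_n = fun=> 0%E.
  apply/funext => n /=; have /Lfun1_integrable ip := Lfun1_bounded_mul (mp_ n) (pK n) u1.
  rewrite -[LHS]fineK; first by rewrite -[fine _]/(Rintegral mu setT _) int0.
  exact: (integrable_fin_num measurableT ip).
exact: cvg_cst.
Unshelve. all: by end_near. Qed.

End BoundedMultiplication.

(** * Completeness of the trigonometric system *)

Section ThresholdPowers.
Variable R : realType.
Implicit Types x y : R.

Lemma bernoulli_ge1 y n : 0 <= y -> 1 + n%:R * y <= (1 + y) ^+ n.
Proof.
move=> y0; elim: n => [|n IH]; first by rewrite mul0r addr0.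
rewrite exprS (le_trans _ (ler_wpM2l _ IH)) ?addr_ge0//.
have : 0 <= n%:R * (y * y) by rewrite !mulr_ge0.
rewrite -natr1; lra.
Qed.

Lemma bernoulli_le1 y n : 0 <= y <= 1 -> 1 - n%:R * y <= (1 - y) ^+ n.
Proof.
move=> /andP[y0 y1]; elim: n => [|n IH]; first by rewrite mul0r subr0.
have y10 : 0 <= 1 - y by rewrite subr_ge0.
rewrite exprS (le_trans _ (ler_wpM2l y10 IH))//.
have : 0 <= n%:R * (y * y) by rewrite !mulr_ge0.
rewrite -natr1; lra.
Qed.

(** With [x = s * s], Bernoulli's inequality bounds [n s^n], and the other factor [s^n] tends to
    0. *)
Lemma cvg_natr_expr x : 0 <= x < 1 -> n%:R * x ^+ n @[n --> \oo] --> (0 : R).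
Proof.
move=> /andP[x0 x1]; have [->|xn0] := eqVneq x 0.
  apply: cvg_near_cst; exists 1%N => // -[//|n] _ /=.
  by rewrite expr0n/= mulr0.
have xp : 0 < x by rewrite lt_neqAle eq_sym xn0.
pose s := Num.sqrt x; have s0 : 0 < s by rewrite sqrtr_gt0.
have s1 : s < 1 by rewrite -sqrtr1 ltr_sqrt.
have xs : x = s * s by rewrite -expr2 sqr_sqrtr.
pose c := s^-1 - 1; have c0 : 0 < c by rewrite subr_gt0 invf_gt1.
have H n : n%:R * s ^+ n <= c^-1.
  have := bernoulli_ge1 n (ltW c0); rewrite /c addrCA subrr addr0 -/c exprVn => h.
  have sn : 0 < s ^+ n by rewrite exprn_gt0.
  rewrite -(ler_pM2l c0) divff ?gt_eqF// mulrA -(ler_pM2r (_ : 0 < (s ^+ n)^-1)) ?invr_gt0//.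
  rewrite mulfK ?gt_eqF// mul1r; lra.
apply: (@squeeze_cvgr _ _ _ _ (cst 0) (fun n => c^-1 * s ^+ n)); last 2 first.
- exact: cvg_cst.
- rewrite -[X in _ --> X](mulr0 c^-1); apply: cvgMr; apply: cvg_expr.
  by rewrite ger0_norm// ltW.
near=> n; rewrite mulr_ge0 ?exprn_ge0//= {1}xs exprMn mulrA.
by rewrite ler_wpM2r// exprn_ge0// ltW.
Unshelve. all: by end_near. Qed.

(* [(1 - x^n)^(n 2^n)] is about [exp (- n (2x)^n)]: the factor n in the exponent
   makes it vanish at the threshold [x = 1/2] too. *)
Lemma cvg_threshold x : 0 <= x <= 1 ->
  (1 - x ^+ n) ^+ (n * 2 ^ n)%N @[n --> \oo] --> ((x < 2^-1)%R%:R : R).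
Proof.
move=> /andP[x0 x1]; have xn n : 0 <= 1 - x ^+ n <= 1.
  by rewrite subr_ge0 exprn_ile1//= lerBlDr lerDl exprn_ge0.
have p0 n : 0 <= (1 - x ^+ n) ^+ (n * 2 ^ n)%N by case/andP: (xn n) => *; exact: exprn_ge0.
have p1 n : (1 - x ^+ n) ^+ (n * 2 ^ n)%N <= 1 by case/andP: (xn n) => *; exact: exprn_ile1.
case: ltP => [x2|x2].
  apply: (@squeeze_cvgr _ _ _ _ (fun n => 1 - n%:R * (2 * x) ^+ n) (cst 1)); last 2 first.
  - rewrite -[X in _ --> X](subr0 1); apply: cvgB; first exact: cvg_cst.
    by apply: cvg_natr_expr; apply/andP; split; lra.
  - exact: cvg_cst.
  near=> n; rewrite p1 andbT (le_trans _ (bernoulli_le1 _ _))//.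
    by rewrite exprMn natrM natrX mulrA.
  by rewrite exprn_ge0//= exprn_ile1.
apply: (@squeeze_cvgr _ _ _ _ (cst 0) (fun n => n.+1%:R^-1)); last 2 first.
- exact: cvg_cst.
- exact: cvg_harmonic.
near=> n; rewrite p0/=; set q := 2^-1 ^+ n : R.
have q01 : 0 <= q <= 1 by rewrite exprn_ge0 ?invr_ge0//= exprn_ile1 ?invr_ge0// invf_le1// ler1n.
have q0 : 0 <= 1 - q by rewrite subr_ge0; case/andP: q01.
have xq : 1 - x ^+ n <= 1 - q by rewrite lerD2l lerN2 lerXn2r ?nnegrE ?invr_ge0.
rewrite (@le_trans _ _ ((1 - q) ^+ (n * 2 ^ n)%N))//.
  by rewrite lerXn2r ?nnegrE//; case/andP: (xn n).
have q1 : 0 < 1 + q by rewrite ltr_pwDl//; case/andP: q01.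
(* Since [(1 - q) (1 + q) <= 1], the power is at most the inverse of [(1 + q)^(n 2^n)], which by
   Bernoulli is at least [1 + n] when [q = 2^-n]. *)
have : (1 - q) ^+ (n * 2 ^ n)%N * (1 + q) ^+ (n * 2 ^ n)%N <= 1.
  rewrite -exprMn; apply: exprn_ile1; first exact: mulr_ge0 q0 (ltW q1).
  by have := sqr_ge0 q; lra.
move=> H; rewrite -ler_pdivlMr ?exprn_gt0// in H.
apply: (le_trans H); rewrite div1r lef_pV2 ?posrE ?exprn_gt0//.
apply: le_trans (bernoulli_ge1 _ _); last by case/andP: q01.
rewrite natrM natrX /q exprVn mulfK ?gt_eqF ?exprn_gt0//.
by rewrite -natr1 addrC.
Unshelve. all: by end_near. Qed.

End ThresholdPowers.

(** * Functions with vanishing Fourier coefficients *)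

Section FourierUniqueness.
Variable R : realType.
Local Notation m := (@arc_length R).
Implicit Types (f g : circleT R -> R[i]) (p q : circleT R -> R) (z : circleT R) (n k : int).

Lemma arc_length_setT : m setT = 1%E.
Proof. exact: (@probability_setT _ _ R (@arc_length R)). Qed.

Lemma cmod_circle z : cmod (z : R[i]) = 1.
Proof. by case: z => z /= /eqP z1; rewrite /cmod z1. Qed.

Lemma circle_neq0 z : (z : R[i]) != 0.
Proof. by rewrite -cmod_eq0 cmod_circle oner_eq0. Qed.

Lemma conj_circle z : conjC (z : R[i]) = (z : R[i])^-1.
Proof.
apply: (mulfI (circle_neq0 z)); rewrite divff ?circle_neq0// mul_conjC cmod_circle.
by rewrite expr1n.
Qed.

Lemma conj_circleXz z n : conjC ((z : R[i]) ^ n) = (z : R[i]) ^ (- n).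
Proof. by rewrite fmorphXz /= conj_circle exprz_inv. Qed.

Lemma bounded_measurable_circle : bounded_measurable (fun z : circleT R => z : R[i]).
Proof.
split.
- move=> _ B mB; rewrite setTI; exists (fst @^-1` B); last by rewrite setTI.
  by rewrite -[X in measurable X]setTI; exact: measurable_fst.
- move=> _ B mB; rewrite setTI; exists (snd @^-1` B); last by rewrite setTI.
  by rewrite -[X in measurable X]setTI; exact: measurable_snd.
- by exists 1 => z; rewrite cmod_circle.
Qed.

Lemma bounded_measurable_circleXz n : bounded_measurable (fun z : circleT R => (z : R[i]) ^ n).
Proof.
case: n => n; first exact: bounded_measurableX bounded_measurable_circle.
rewrite (_ : (fun z => _) = (fun z : circleT R => conjC ((z : R[i]) ^+ n.+1))).
  by apply: bounded_measurable_conj; exact: bounded_measurableX bounded_measurable_circle.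
by apply/funext => z; rewrite NegzE exprnP conj_circleXz.
Qed.

Definition null_coefs f : Prop := f \in cLfun m 1 /\
  forall n, cintegral m (fun z => f z * (z : R[i]) ^ n) = 0.

Lemma cLfun1_mulXz f n : f \in cLfun m 1 -> (fun z => f z * (z : R[i]) ^ n) \in cLfun m 1.
Proof.
move=> f1; under eq_fun do rewrite mulrC.
exact: cLfun1_bounded_mul (bounded_measurable_circleXz n) f1.
Qed.

Lemma null_coefs_linear a f g : null_coefs f -> null_coefs g ->
  null_coefs (fun z => a * f z + g z).
Proof.
move=> [f1 f0] [g1 g0]; split=> [|n]; first exact: cLfun_linear.
under eq_fun do rewrite mulrDl -mulrA.
by rewrite (cintegral_linear _ (cLfun1_mulXz n f1) (cLfun1_mulXz n g1)) f0 g0 mulr0 addr0.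
Qed.

Lemma null_coefs0 : null_coefs (fun=> 0).
Proof.
have [L0 _] := cLfun_submod_closed m (lexx 1%E); split=> [|n]; first exact: L0.
under eq_fun do rewrite mul0r.
by rewrite /cintegral (@Rintegral_cst _ _ _ m setT measurableT 0) mul0r.
Qed.

Lemma null_coefs_mulXz f k : null_coefs f -> null_coefs (fun z => (z : R[i]) ^ k * f z).
Proof.
move=> [f1 f0]; split=> [|n].
  exact: cLfun1_bounded_mul (bounded_measurable_circleXz k) f1.
rewrite -(f0 (k + n)); congr cintegral; apply/funext => z.
by rewrite expfzDr ?circle_neq0// mulrCA mulrA.
Qed.

(** The device behind Fourier uniqueness. These functions form an algebra closed under bounded
    pointwise limits; it contains the two coordinates of the circle, hence the indicators of all
    Borel sets. *)
Definition null_multiplier p : Prop := [/\ measurable_fun setT p,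
  exists K, forall z, `|p z| <= K &
  forall f, null_coefs f -> null_coefs (fun z => (p z)%:C * f z)].

Lemma null_multiplier_cst a : null_multiplier (fun=> a).
Proof.
split; [exact: measurable_cst|by exists `|a| => _|].
move=> f f0; have := null_coefs_linear a%:C f0 null_coefs0.
by under eq_fun do rewrite addr0.
Qed.

Lemma null_multiplierD p q : null_multiplier p -> null_multiplier q ->
  null_multiplier (fun z => p z + q z).
Proof.
move=> [mp [K pK] p0] [mq [L qL] q0]; split; first exact: measurable_funD.
  by exists (K + L) => z; rewrite (le_trans (ler_normD _ _))// lerD.
move=> f f0; have := null_coefs_linear 1 (p0 _ f0) (q0 _ f0).
by under eq_fun do rewrite mul1r -mulrDl -rmorphD.
Qed.

Lemma null_multiplierM p q : null_multiplier p -> null_multiplier q ->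
  null_multiplier (fun z => p z * q z).
Proof.
move=> [mp [K pK] p0] [mq [L qL] q0]; split; first exact: measurable_funM.
  by exists (K * L) => z; rewrite normrM ler_pM.
by move=> f /q0/p0; under eq_fun do rewrite mulrA -rmorphM.
Qed.

Lemma null_multiplierB p q : null_multiplier p -> null_multiplier q ->
  null_multiplier (fun z => p z - q z).
Proof.
move=> np nq; have := null_multiplierD np (null_multiplierM (null_multiplier_cst (-1)) nq).
by under eq_fun do rewrite mulN1r.
Qed.

Lemma null_multiplierX p (k : nat) : null_multiplier p -> null_multiplier (fun z => p z ^+ k).
Proof.
move=> np; elim: k => [|k IH]; first exact: null_multiplier_cst.
by under eq_fun do rewrite exprS; exact: null_multiplierM.
Qed.

(** On the circle [Re z = (z + z^-1) / 2], and multiplication by a power of [z] only shifts the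
    coefficients. The imaginary part is treated alike. *)
Lemma null_multiplier_Re : null_multiplier (fun z => Re (z : R[i])).
Proof.
have [m1 _ _] := bounded_measurable_circle; split => //.
  by exists 1 => z; rewrite -(cmod_circle z) cmod_ge_Re.
move=> f f0; have := null_coefs_linear 2^-1 (null_coefs_mulXz 1 f0)
  (null_coefs_linear 2^-1 (null_coefs_mulXz (-1) f0) null_coefs0).
congr null_coefs; apply/funext => z; rewrite addr0 !mulrA -mulrDl; congr (_ * _).
rewrite expr1z exprN1 -conj_circle.
by rewrite ReJ_add /= mulrDl [(z : R[i]) / _]mulrC [conjC _ / _]mulrC.
Qed.

Lemma null_multiplier_Im : null_multiplier (fun z => Im (z : R[i])).
Proof.
have [_ m2 _] := bounded_measurable_circle; split => //.
  by exists 1 => z; rewrite -(cmod_circle z) cmod_ge_Im.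
move=> f f0; have := null_coefs_linear (- (2^-1 * 'i%C)) (null_coefs_mulXz 1 f0)
  (null_coefs_linear (2^-1 * 'i%C) (null_coefs_mulXz (-1) f0) null_coefs0).
congr null_coefs; apply/funext => z; rewrite addr0 !mulrA -mulrDl; congr (_ * _).
rewrite expr1z exprN1 -conj_circle.
rewrite ImJ_sub /=; ring.
Qed.

Lemma null_multiplier_lim (p_ : nat -> circleT R -> R) p (K : R) :
  (forall j, null_multiplier (p_ j)) -> (forall j z, `|p_ j z| <= K) ->
  (forall z, p_ j z @[j --> \oo] --> p z) -> null_multiplier p.
Proof.
move=> np pK pl.
have mp : measurable_fun setT p.
  by apply: (measurable_fun_cvg (h := p_)) => [j|z _]; [case: (np j)|exact: pl].
have pK' z : `|p z| <= K.
  have h : `|p_ j z| @[j --> \oo] --> `|p z| by apply: cvg_norm; exact: pl.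
  rewrite -(cvg_lim (@norm_hausdorff _ R^o) h).
  by apply: limr_le; [exact: cvgP h|near=> j; exact: pK].
split => //; first by exists K.
move=> f [f1 f0]; split=> [|n].
  apply: (@cLfun1_bounded_mul _ _ _ m f (fun z => (p z)%:C)) => //; split => //.
    exact: measurable_cst.
  by exists K => z; rewrite cmodR.
have fn := cLfun1_mulXz n f1; have /andP[r1 i1] := fn.
have H j : cintegral m (fun z => (p_ j z)%:C * (f z * (z : R[i]) ^ n)) = 0.
  have [_ _ /(_ f (conj f1 f0))[_ /(_ n) <-]] := np j.
  by congr cintegral; apply/funext => z; rewrite mulrA.
have ReRM (r : R) (a : R[i]) : Re (r%:C * a) = r * Re a.
  by rewrite Defs.ReM/= mul0r subr0.
have ImRM (r : R) (a : R[i]) : Im (r%:C * a) = r * Im a.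
  by rewrite Defs.ImM/= mul0r addr0.
apply/eqP; rewrite /cintegral eq_complex/=; apply/andP; split; apply/eqP.
- under eq_Rintegral do rewrite -mulrA ReRM.
  apply: (Rintegral_bounded_lim r1 _ mp pK pl) => j; first by case: (np j).
  by have := congr1 Re (H j); rewrite /cintegral/= => <-; apply: eq_Rintegral => z _; rewrite ReRM.
- under eq_Rintegral do rewrite -mulrA ImRM.
  apply: (Rintegral_bounded_lim i1 _ mp pK pl) => j; first by case: (np j).
  by have := congr1 Im (H j); rewrite /cintegral/= => <-; apply: eq_Rintegral => z _; rewrite ImRM.
Unshelve. all: by end_near. Qed.

(** The indicator is the limit of the polynomials [(1 - p^j)^(j 2^j)] in [p], which stay in the unit
    interval. *)
Lemma null_multiplier_threshold p : null_multiplier p -> (forall z, 0 <= p z <= 1) ->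
  null_multiplier (fun z => (p z < 2^-1)%R%:R).
Proof.
move=> np p01.
apply: (@null_multiplier_lim (fun j z => (1 - p z ^+ j) ^+ (j * 2 ^ j)%N) _ 1).
- move=> j; apply: null_multiplierX; apply: null_multiplierB; first exact: null_multiplier_cst.
  exact: null_multiplierX.
- move=> j z; have /andP[p0 p1] := p01 z.
  have h0 : 0 <= 1 - p z ^+ j by rewrite subr_ge0 exprn_ile1.
  by rewrite ger0_norm ?exprn_ge0// exprn_ile1// lerBlDr lerDl exprn_ge0.
- by move=> z; exact: cvg_threshold.
Qed.

Definition null_set (A : set (circleT R)) : Prop := null_multiplier (\1_A : circleT R -> R).

Lemma sigma_algebra_null_set : sigma_algebra setT null_set.
Proof.
split.
- rewrite /null_set (_ : \1_set0 = fun=> 0); first exact: null_multiplier_cst.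
  by apply/funext => z; rewrite indicE in_set0.
- move=> A nA; rewrite /null_set (_ : \1_(_) = fun z => 1 - \1_A z).
    by apply: null_multiplierB => //; exact: null_multiplier_cst.
  apply/funext => z; rewrite setTD !indicE in_setC.
  by case: (z \in A); rewrite ?subrr ?subr0.
(* The indicator of the union of the first [j] sets, written as a polynomial in their indicators; at
   each point it is eventually constant in [j]. *)
- move=> A nA; pose p_ j z : R := 1 - \prod_(i < j) (1 - \1_(A i) z).
  have prodE j z : \prod_(i < j) (1 - \1_(A i) z) = (~~ [exists i : 'I_j, z \in A i])%:R :> R.
    case: existsP => [[i zi]|H] /=.
      by rewrite (bigD1 i)//= indicE zi subrr mul0r.
    rewrite big1// => i _; rewrite indicE; case: (boolP (z \in A i)) => zi; last by rewrite subr0.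
    by exfalso; apply: H; exists i.
  apply: (@null_multiplier_lim p_ _ 1).
  + move=> j; apply: null_multiplierB; first exact: null_multiplier_cst.
    elim: j => [|j IH].
      by under eq_fun do rewrite big_ord0; exact: null_multiplier_cst.
    under eq_fun do rewrite big_ord_recr/=; apply: null_multiplierM => //.
    by apply: null_multiplierB; [exact: null_multiplier_cst|exact: nA].
  + move=> j z; rewrite /p_ prodE.
    by case: [exists i, _]; rewrite ?subr0 ?subrr ?normr0 ?normr1.
  + move=> z; apply: cvg_near_cst; rewrite indicE.
    have [/set_mem[i _ zi]|zA] := boolP (z \in _).
      exists i.+1 => // j /= ij; rewrite /p_ prodE.
      have -> : [exists i : 'I_j, z \in A i] by apply/existsP; exists (Ordinal ij); exact: mem_set.
      by rewrite subr0.
    exists 0%N => // j _; rewrite /p_ prodE.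
    have -> : [exists i : 'I_j, z \in A i] = false; last by rewrite subrr.
    apply/negbTE/existsP => -[i /set_mem zi]; move: zA; rewrite notin_setE; apply.
    by exists i.
Qed.

Lemma null_set_lt (c : circleT R -> R) (a : R) : null_multiplier c ->
  (forall z, `|c z| <= 1) -> null_set (c @^-1` `]-oo, a[).
Proof.
(* An affine change of variable moves the threshold [a] to [1/2]. As [|c - a| <= 1 + |a|], dividing
   by [K] keeps the values within [1/2] of [1/2]. *)
move=> nc c1; pose K := 2 * (1 + `|a|); have K0 : 0 < K by rewrite mulr_gt0// ltr_pwDl.
have := @null_multiplier_threshold (fun z => 2^-1 + K^-1 * (c z - a)).
rewrite /null_set => H.
have -> : \1_(c @^-1` `]-oo, a[) = (fun z => (2^-1 + K^-1 * (c z - a) < 2^-1)%R%:R : R).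
  apply/funext => z; rewrite indicE; congr ((nat_of_bool _)%:R).
  rewrite -[ltRHS]addr0 ltrD2l pmulr_rlt0 ?invr_gt0// subr_lt0.
  by apply/idP/idP => [/set_mem/=|h]; [rewrite in_itv|apply: mem_set; rewrite /= in_itv].
apply: H.
  apply: null_multiplierD; first exact: null_multiplier_cst.
  apply: null_multiplierM; first exact: null_multiplier_cst.
  by apply: null_multiplierB => //; exact: null_multiplier_cst.
move=> z; have : `|K^-1 * (c z - a)| <= 2^-1.
  rewrite normrM ger0_norm ?invr_ge0 ?(ltW K0)// mulrC ler_pdivrMr// /K mulrA mulVf// mul1r.
  by rewrite (le_trans (ler_normB _ _))// lerD2r.
by rewrite ler_norml => /andP[? ?]; apply/andP; split; lra.
Qed.

Lemma null_set_preimage (c : circleT R -> R) : null_multiplier c ->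
  (forall z, `|c z| <= 1) -> forall B : set (measurableTypeR R), measurable B -> null_set (c @^-1` B).
Proof.
move=> nc c1 B; have [s0 sC sU] := sigma_algebra_null_set.
rewrite -[measurable B]/((@ocitv R).-sigma.-measurable B) RGenInftyO.measurableE.
suff : <<s @RGenInftyO.G R >> `<=` [set B | null_set (c @^-1` B)] by exact.
apply: smallest_sub; last by move=> _ [a ->]; exact: null_set_lt.
split => /=.
- by rewrite preimage_set0.
- by move=> A nA; rewrite setTD preimage_setC -setTD; exact: sC.
- by move=> A nA; rewrite preimage_bigcup; exact: sU.
Qed.

(** The sigma-algebra is traced from the plane, where rectangles generate; the trace of a rectangle
    is an intersection of preimages under [Re] and [Im], and intersecting multiplies indicators. *)
Lemma measurable_null_set (A : set (circleT R)) : measurable A -> null_set A.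
Proof.
move=> [B mB <-]; rewrite setTI; have [s0 sC sU] := sigma_algebra_null_set.
have nI A1 A2 : null_set A1 -> null_set A2 -> null_set (A1 `&` A2).
  move=> n1 n2; rewrite /null_set (_ : \1_(_) = fun z => \1_A1 z * \1_A2 z).
    exact: null_multiplierM.
  by apply/funext => z; rewrite !indicE in_setI -natrM mulnb.
move: B mB; rewrite measurable_prod_measurableType.
apply: (@smallest_sub _ _ _ [set B | null_set (@circle_coord R @^-1` B)]).
- split => /=.
  + by rewrite preimage_set0.
  + by move=> A' nA; rewrite setTD preimage_setC -setTD; exact: sC.
  + by move=> A' nA; rewrite preimage_bigcup; exact: sU.
- move=> _ [A1 mA1 [A2 mA2 <-]] /=.
  rewrite (_ : _ @^-1` _ = (fun z : circleT R => Re (z : R[i])) @^-1` A1 `&`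
     (fun z : circleT R => Im (z : R[i])) @^-1` A2)//.
  apply: nI; apply: null_set_preimage => //.
  + exact: null_multiplier_Re.
  + by move=> z; rewrite -(cmod_circle z) cmod_ge_Re.
  + exact: null_multiplier_Im.
  + by move=> z; rewrite -(cmod_circle z) cmod_ge_Im.
Qed.

(** Testing on [{u > 0}] and on its complement gives the integral of [|u|]. *)
Lemma Lfun1_null_integrals (u : circleT R -> R) : u \in Lfun m 1 ->
  (forall A : set (circleT R), measurable A -> (\int[m]_z (\1_A z * u z) = 0)%R) ->
  \forall z \ae m, u z = 0.
Proof.
move=> u1 H; have /Lfun1_integrable iu := u1.
have mu_ : measurable_fun setT u by exact/measurable_EFinP/(measurable_int m iu).
pose A := [set z | 0 < u z].
have mA : measurable A.
  rewrite -[A]setTI; have -> : A = u @^-1` `]0, +oo[.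
    by apply/seteqP; split => z; rewrite /A /= in_itv/= andbT.
  exact: mu_.
have b1 (B : set (circleT R)) : measurable B -> (fun z => \1_B z * u z) \in Lfun m 1.
  move=> mB; apply: (@Lfun1_bounded_mul _ _ _ m (\1_B) u 1) => //.
  by move=> z; rewrite indicE; case: (_ \in _); rewrite ?normr1 ?normr0.
have iA := b1 _ mA; have iC := b1 _ (measurableC mA).
have : (\int[m]_z `|u z| = 0)%R.
  transitivity (\int[m]_z (\1_A z * u z - \1_(~` A) z * u z)).
    apply: eq_Rintegral => z _; rewrite !indicE in_setC.
    have [/set_mem|/negP zA] := boolP (z \in A).
      by rewrite /A/= => u0; rewrite mul1r mul0r subr0 gtr0_norm.
    rewrite mul0r mul1r sub0r ler0_norm// leNgt; apply/negP => u0; apply: zA.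
    exact: mem_set.
  rewrite RintegralB//; [|exact/Lfun1_integrable|exact/Lfun1_integrable].
  by rewrite (H _ mA) (H _ (measurableC mA)) subrr.
move=> int0; have : (\int[m]_z `|(u z)%:E| = 0)%E.
  rewrite -[LHS]fineK; first by rewrite -[fine _]/(Rintegral m setT (fun z => `|u z|)) int0.
  exact: (integrable_fin_num measurableT (integrable_abse iu)).
move=> /(ae_eq_integral_abs m measurableT (measurable_int m iu)).
by apply: filterS => z /(_ I) [].
Qed.

(** Indicators are null multipliers, so the coefficient of index 0 of [\1_A f] says that [f] has
    zero integral over every measurable [A]. *)
Theorem fourier_uniqueness f : null_coefs f -> \forall z \ae m, f z = 0.
Proof.
move=> f0; have [f1 _] := f0; have /andP[r1 i1] := f1.
have H A : measurable A -> cintegral m (fun z => (\1_A z)%:C * f z) = 0.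
  move=> /measurable_null_set[_ _ /(_ f f0)[_ /(_ 0) <-]].
  by congr cintegral; apply/funext => z; rewrite expr0z mulr1.
have u0 : \forall z \ae m, Re (f z) = 0.
  apply: (Lfun1_null_integrals r1) => A mA; rewrite -[RHS](congr1 Re (H A mA)).
  by apply: eq_Rintegral => z _; rewrite Defs.ReM/= mul0r subr0.
have v0 : \forall z \ae m, Im (f z) = 0.
  apply: (Lfun1_null_integrals i1) => A mA; rewrite -[RHS](congr1 Im (H A mA)).
  by apply: eq_Rintegral => z _; rewrite Defs.ImM/= mul0r addr0.
apply: filterS2 u0 v0 => z uz vz; apply/eqP.
by rewrite eq_complex /= [Re _]uz [Im _]vz !eqxx.
Qed.

End FourierUniqueness.

(** * Integrals of the powers of z *)

Section TrigonometricMoments.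
Variable R : realType.
Local Notation m := (@arc_length R).

Lemma integral_mrestr d (T : measurableType d) (mu : {measure set T -> \bar R})
    (D : set T) (mD : measurable D) (f : T -> \bar R) : measurable_fun setT f ->
  (\int[mrestr mu mD]_x f x = \int[mu]_(x in D) f x)%E.
Proof.
move=> mf; transitivity (\int[mrestr mu mD]_(x in D) f x)%E.
  rewrite [RHS]integral_mkcond; apply: ae_eq_integral => //.
    by apply/(measurable_restrictT f mD); exact: measurable_funTS.
  exists (~` D); split.
  - exact: measurableC.
  - by transitivity (mu (~` D `&` D)) => //; rewrite setICl measure0.
  - move=> x /= /not_implyP[_ H] Dx; apply: H.
    by rewrite patchE mem_set.
apply: eq_measure_integral => A mA AD; by transitivity (mu (A `&` D)) => //; rewrite setIidl.
Qed.

Lemma integral_arc_length (u : circleT R -> R) (K : R) : measurable_fun setT u ->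
  (forall z, `|u z| <= K) ->
  (\int[m]_z (u z)%:E = \int[lebesgue_measure]_(t in `[0%R, 1%R]) (u (turn t))%:E)%E.
Proof.
move=> mu_ uK.
have mut : measurable_fun setT (u \o @turn R) by apply: measurableT_comp => //; exact: measurable_turn.
rewrite /arc_length integral_pushforward//=.
- rewrite preimage_setT integral_mrestr//=; exact/measurable_EFinP.
- exact/measurable_EFinP.
- rewrite preimage_setT; apply/integrableP; split; first exact/measurable_EFinP.
  rewrite integral_mrestr; last first.
    by apply: measurableT_comp => //; exact/measurable_EFinP.
  apply: (@le_lt_trans _ _ (\int[lebesgue_measure]_(t in `[0%R, 1%R]) K%:E)%E).
    apply: ge0_le_integral => //=.
      by apply/measurable_EFinP; apply: measurable_funTS; exact: measurableT_comp.
    by move=> t _; rewrite lee_fin.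
  rewrite integral_cst//= lebesgue_measure_itv/= lte_fin ltr01 sube0 mule1.
  exact: ltry.
Qed.

Lemma turnX (t : R) n : ((turn t : circleT R) : R[i]) ^+ n =
  cos (n%:R * (2 * pi * t)) +i* sin (n%:R * (2 * pi * t)).
Proof.
elim: n => [|n IH]; first by rewrite mul0r cos0 sin0.
have -> : n.+1%:R * (2 * pi * t) = n%:R * (2 * pi * t) + 2 * pi * t by rewrite -natr1 mulrDl mul1r.
rewrite exprS IH cosD sinD; apply/eqP; rewrite eq_complex /=.
by apply/andP; split; apply/eqP; ring.
Qed.

Lemma cos_2pi_nat n : cos (n%:R * (2 * pi)) = 1 :> R.
Proof.
elim: n => [|n IH]; first by rewrite mul0r cos0.
by rewrite -natr1 mulrDl mul1r cosD IH mulr_natl cos2pi sin2pi mulr1 mulr0 subr0.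
Qed.

Lemma sin_2pi_nat n : sin (n%:R * (2 * pi)) = 0 :> R.
Proof.
elim: n => [|n IH]; first by rewrite mul0r sin0.
by rewrite -natr1 mulrDl mul1r sinD IH mulr_natl cos2pi sin2pi mul0r mulr0 addr0.
Qed.

Lemma integral_period (F f : R -> R) : continuous f ->
  (forall t : R, is_derive t 1 F (f t)) -> F 0 = F 1 ->
  (\int[lebesgue_measure]_(t in `[0%R, 1%R]) (f t)%:E = 0)%E.
Proof.
move=> cf dF F01.
have cF : continuous F.
  move=> t; apply/differentiable_continuous/derivable1_diffP.
  by have [] := dF t.
rewrite (@continuous_FTC2 _ f F 0 1)//.
- by rewrite F01 subee.
- exact: continuous_subspaceT.
- split.
  + by move=> t _; have [] := dF t.
  + by apply: cvg_at_right_filter; exact: cF.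
  + by apply: cvg_at_left_filter; exact: cF.
- by move=> t _; rewrite derive1E; have [_ ->] := dF t.
Qed.

Lemma cintegral_circleX n : (0 < n)%N ->
  cintegral m (fun z : circleT R => (z : R[i]) ^+ n) = 0.
Proof.
move=> n0; have [m1 m2 [K HK]] := bounded_measurableX n (@bounded_measurable_circle R).
(* The integrands become [cos (w t)] and [sin (w t)] on the unit interval; their antiderivatives
   have period [1/n], hence equal values at 0 and 1. *)
pose w : R := n%:R * (2 * pi).
have w0 : w != 0 by rewrite mulf_neq0 ?pnatr_eq0 -?lt0n// mulf_neq0// gt_eqF// pi_gt0.
have wt t : n%:R * (2 * pi * t) = w * t :> R by rewrite /w mulrA.
have cw : continuous (fun t : R => w * t) by move=> t; apply: cvgMr; exact: cvg_id.
rewrite /cintegral /Rintegral.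
rewrite (@integral_arc_length (Re \o (fun z : circleT R => (z : R[i]) ^+ n)) K)//=; last first.
  by move=> z; rewrite (le_trans (cmod_ge_Re _)).
rewrite (@integral_arc_length (Im \o (fun z : circleT R => (z : R[i]) ^+ n)) K)//=; last first.
  by move=> z; rewrite (le_trans (cmod_ge_Im _)).
under eq_integral do rewrite turnX /= wt.
under [X in _ +i* fine X]eq_integral do rewrite turnX /= wt.
have dw t : is_derive (t : R) 1 (fun t : R => w * t) w.
  exact: (is_derive_eq (is_deriveZ w (is_derive_id t 1)) (mulr1 w)).
have dsin t : is_derive (t : R) 1 (fun t : R => w^-1 * sin (w * t)) (cos (w * t)).
  have := is_deriveZ w^-1 (is_derive1_comp (is_derive_sin (w * t)) (dw t)).
  by move=> H; apply: (is_derive_eq H); rewrite /GRing.scale/= mulrCA mulVf ?mulr1.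
have dcos t : is_derive (t : R) 1 (fun t : R => - w^-1 * cos (w * t)) (sin (w * t)).
  have := is_deriveZ (- w^-1) (is_derive1_comp (is_derive_cos (w * t)) (dw t)).
  move=> H; apply: (is_derive_eq H).
  by rewrite /GRing.scale/= mulNr mulrCA mulVf// mulr1 opprK.
have ccos : continuous (fun t : R => cos (w * t)).
  by move=> t; apply: (continuous_comp (cw t)); exact: continuous_cos.
have csin : continuous (fun t : R => sin (w * t)).
  by move=> t; apply: (continuous_comp (cw t)); exact: continuous_sin.
rewrite (integral_period ccos dsin) ?(integral_period csin dcos)//.
- by rewrite mulr0 cos0 mulr1 /w cos_2pi_nat.
- by rewrite mulr0 sin0 mulr1 /w sin_2pi_nat.
Qed.

Lemma cintegral_circleXz (n : int) :
  cintegral m (fun z : circleT R => (z : R[i]) ^ n) = (n == 0)%:R.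
Proof.
have H k : (0 < k)%N -> cintegral m (fun z : circleT R => (z : R[i]) ^ (- k%:Z)) = 0.
  move=> k0; rewrite (_ : (fun z => _) = (fun z : circleT R => conjC ((z : R[i]) ^+ k))).
    rewrite cintegral_conj ?cintegral_circleX ?conjC0//.
    rewrite (_ : (fun z => _) = (fun z : circleT R => (z : R[i]) ^+ k * 1)).
      apply: (cLfun1_bounded_mul (bounded_measurableX k (@bounded_measurable_circle R))).
      by apply/andP; split; exact: Lfun_cst.
    by apply/funext => z; rewrite mulr1.
  by apply/funext => z; rewrite exprnP conj_circleXz.
case: n => [[|k]|k].
- under eq_fun do rewrite expr0z.
  rewrite /cintegral !(@Rintegral_cst _ _ _ m setT measurableT) /= mul0r mul1r.
  by rewrite (_ : m _ = 1%E) ?arc_length_setT.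
- exact: cintegral_circleX.
- by rewrite NegzE H.
Qed.

End TrigonometricMoments.

(* The packed dot product: stated with it, the abstract lemmas rewrite syntactically. *)
Definition L2dotp d (T : measurableType d) (R : realType) (mu : {measure set T -> \bar R}) :
  {dot (L2 mu) for conjC} := @L2dot _ _ _ mu.

(** * Multiplication operators and the Hardy space *)

Section Multipliers.
Context d (T : measurableType d) (R : realType).
Variable mu : {measure set T -> \bar R}.
Local Notation L2T := (L2 mu).
Local Notation dot := (L2dotp mu).
Implicit Types (f g : L2T) (h : T -> R[i]) (a : R[i]).

Lemma dot_ae f g (F G : T -> R[i]) : F \in cLfun mu 2%:E -> G \in cLfun mu 2%:E ->
  (\forall x \ae mu, f x = F x) -> (\forall x \ae mu, g x = G x) ->
  dot f g = cintegral mu (fun x => F x * conjC (G x)).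
Proof.
move=> F2 G2 fF gG; apply: eq_cintegral.
- exact: cLfun2_mul_conj (L2P _) (L2P _).
- exact: cLfun2_mul_conj.
- by apply: filterS2 fF gG => x -> ->.
Qed.

(** The representative of an inner function has modulus 1 only almost everywhere and may be
    unbounded elsewhere, so boundedness is asked only of a function [F] equal to it almost
    everywhere. *)
Definition multiplier h : Prop :=
  [/\ measurable_fun setT (Re \o h), measurable_fun setT (Im \o h) &
      exists2 F, bounded_measurable F & \forall x \ae mu, h x = F x].

(* Junk value: the class of 0 if [h f] is not square integrable. *)
Definition mulL2 h f : L2T := toL2 mu (fun x => h x * f x).

(** Null sets may have nonmeasurable subsets, so the measurability of [G] does not follow from that
    of [F] and is asked separately. *)
Lemma cLfun2_ae (F G : T -> R[i]) : measurable_fun setT (Re \o G) ->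
  measurable_fun setT (Im \o G) -> (\forall x \ae mu, G x = F x) ->
  F \in cLfun mu 2%:E -> G \in cLfun mu 2%:E.
Proof.
move=> m1 m2 GF /andP[/Lfun2P[f1 i1] /Lfun2P[f2 i2]].
apply/andP; split; apply/Lfun2P; split => //.
- rewrite (ae_eq_integral (fun x => (Re (F x) ^+ 2)%:E))//.
  + exact: measurable_sqr_EFin.
  + exact: measurable_sqr_EFin.
  + by apply: filterS GF => x /= ->.
- rewrite (ae_eq_integral (fun x => (Im (F x) ^+ 2)%:E))//.
  + exact: measurable_sqr_EFin.
  + exact: measurable_sqr_EFin.
  + by apply: filterS GF => x /= ->.
Qed.

Lemma bounded_multiplier h : bounded_measurable h -> multiplier h.
Proof. by move=> bh; have [m1 m2 _] := bh; split => //; exists h => //; exact: aeW. Qed.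

Lemma multiplier_conj h : multiplier h -> multiplier (fun x => conjC (h x)).
Proof.
move=> [m1 m2 [F bF hF]]; split.
- by rewrite (_ : _ \o _ = (Re \o h))//; apply/funext => x /=; rewrite ReJ.
- rewrite (_ : _ \o _ = \- (Im \o h)); first exact: measurableT_comp.
  by apply/funext => x /=; rewrite ImJ.
- exists (fun x => conjC (F x)); first exact: bounded_measurable_conj.
  by apply: filterS hF => x ->.
Qed.

Lemma multiplier_sqint h f : multiplier h -> (fun x => h x * f x) \in sqint mu.
Proof.
move=> [m1 m2 [F bF hF]]; have [f1 f2] := cLfun_measurable (L2P f).
apply: (@cLfun2_ae (fun x => F x * f x)).
- rewrite (_ : _ \o _ = ((Re \o h) \* (Re \o f)) \- ((Im \o h) \* (Im \o f))).
    by apply: measurable_funB; exact: measurable_funM.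
  by apply/funext => x /=; rewrite Defs.ReM.
- rewrite (_ : _ \o _ = ((Re \o h) \* (Im \o f)) \+ ((Im \o h) \* (Re \o f))).
    by apply: measurable_funD; exact: measurable_funM.
  by apply/funext => x /=; rewrite Defs.ImM.
- by apply: filterS hF => x ->.
- exact: cLfun2_bounded_mul bF (L2P f).
Qed.

Lemma mulL2E h f : multiplier h -> \forall x \ae mu, mulL2 h f x = h x * f x.
Proof. by move=> mh; apply: toL2E; exact: multiplier_sqint. Qed.

Lemma mulL2_linear h : multiplier h -> linear (mulL2 h).
Proof.
move=> mh a f g; apply: L2_ext.
apply: filterS (filterI (filterI (L2_linE a (mulL2 h f) (mulL2 h g)) (mulL2E (a *: f + g) mh))
  (filterI (L2_linE a f g) (filterI (mulL2E f mh) (mulL2E g mh)))) => x.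
by move=> [[-> ->] [-> [-> ->]]]; rewrite mulrDr mulrCA.
Qed.

Lemma mulL2M h h' f : multiplier h -> multiplier h' -> multiplier (fun x => h x * h' x) ->
  mulL2 h (mulL2 h' f) = mulL2 (fun x => h x * h' x) f.
Proof.
move=> mh mh' mhh'; apply: L2_ext.
apply: filterS (filterI (mulL2E (mulL2 h' f) mh) (filterI (mulL2E f mh') (mulL2E f mhh'))) => x.
by move=> [-> [-> ->]]; rewrite mulrA.
Qed.

Lemma multiplierM h h' : multiplier h -> multiplier h' -> multiplier (fun x => h x * h' x).
Proof.
move=> [m1 m2 [F bF hF]] [m3 m4 [F' bF' hF']]; split.
- rewrite (_ : _ \o _ = ((Re \o h) \* (Re \o h')) \- ((Im \o h) \* (Im \o h'))).
    by apply: measurable_funB; exact: measurable_funM.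
  by apply/funext => x /=; rewrite Defs.ReM.
- rewrite (_ : _ \o _ = ((Re \o h) \* (Im \o h')) \+ ((Im \o h) \* (Re \o h'))).
    by apply: measurable_funD; exact: measurable_funM.
  by apply/funext => x /=; rewrite Defs.ImM.
- exists (fun x => F x * F' x); first exact: bounded_measurableM.
  by apply: filterS2 hF hF' => x -> ->.
Qed.

Lemma dot_mulL2l h f g : multiplier h ->
  dot (mulL2 h f) g = cintegral mu (fun x => h x * f x * conjC (g x)).
Proof.
move=> mh; apply: dot_ae; first exact: multiplier_sqint.
- exact: L2P.
- exact: mulL2E.
- exact: aeW.
Qed.

Lemma dot_mulL2 h f g : multiplier h ->
  dot (mulL2 h f) g = dot f (mulL2 (fun x => conjC (h x)) g).
Proof.
move=> mh; rewrite dot_mulL2l// [RHS]dotC dot_mulL2l; last exact: multiplier_conj.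
rewrite -cintegral_conj; first by congr cintegral; apply/funext => x; rewrite !rmorphM/= !conjCK mulrAC mulrC.
rewrite (_ : (fun x => _) = (fun x => conjC (h x) * g x * conjC (f x)))//.
by apply: cLfun2_mul_conj; [apply: multiplier_sqint; exact: multiplier_conj|exact: L2P].
Qed.

Definition unimodular (f : T -> R[i]) : Prop := \forall x \ae mu, `|f x| = 1.

Lemma unimodular_multiplier h : measurable_fun setT (Re \o h) ->
  measurable_fun setT (Im \o h) -> unimodular h -> multiplier h.
Proof.
move=> m1 m2 h1; split => //.
(* Cutting [h] to 0 where its modulus exceeds 1 changes it on a null set only and makes it
   bounded. *)
pose b x : bool := (Re (h x) ^+ 2 + Im (h x) ^+ 2 <= 1)%R.
have mb : measurable_fun setT b.
  apply: measurable_fun_ler; last exact: measurable_cst.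
  by apply: measurable_funD; exact: measurable_funX.
exists (fun x => if b x then h x else 0).
  split.
  - rewrite (_ : _ \o _ = fun x => if b x then Re (h x) else 0).
      by apply: measurable_fun_ifT => //; exact: measurable_cst.
    by apply/funext => x /=; case: ifP.
  - rewrite (_ : _ \o _ = fun x => if b x then Im (h x) else 0).
      by apply: measurable_fun_ifT => //; exact: measurable_cst.
    by apply/funext => x /=; case: ifP.
  - exists 1 => x; case: ifPn => [|_]; last by rewrite cmod0.
    rewrite /b -sqr_cmod => bx.
    by rewrite -(@ler_pXn2r _ 2) ?nnegrE ?cmod_ge0// expr1n.
apply: filterS h1 => x hx; rewrite /b -sqr_cmod.
by rewrite /cmod hx /= expr1n lexx.
Qed.

Lemma unimodular_L2 f : unimodular f -> multiplier f.
Proof. by move=> f1; have [m1 m2] := cLfun_measurable (L2P f); exact: unimodular_multiplier. Qed.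

Lemma unimodular_conjK h : unimodular h -> \forall x \ae mu, conjC (h x) * h x = 1.
Proof. by apply: filterS => x hx; rewrite mulrC mul_conjC /cmod hx expr1n. Qed.

Lemma mulL2_conjK h f : multiplier h -> unimodular h ->
  mulL2 (fun x => conjC (h x)) (mulL2 h f) = f.
Proof.
move=> mh h1; apply: L2_ext; have mh' := multiplier_conj mh.
apply: filterS (filterI (mulL2E (mulL2 h f) mh') (filterI (mulL2E f mh) (unimodular_conjK h1))) => x.
by move=> [-> [-> H]]; rewrite mulrA H mul1r.
Qed.

Lemma mulL2_Kconj h f : multiplier h -> unimodular h ->
  mulL2 h (mulL2 (fun x => conjC (h x)) f) = f.
Proof.
move=> mh h1; apply: L2_ext; have mh' := multiplier_conj mh.
apply: filterS (filterI (mulL2E (mulL2 (fun x => conjC (h x)) f) mh)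
  (filterI (mulL2E f mh') (unimodular_conjK h1))) => x.
by move=> [-> [-> H]]; rewrite mulrA [h x * _]mulrC H mul1r.
Qed.

Lemma dot_mulL2_unimodular h f g : multiplier h -> unimodular h ->
  dot (mulL2 h f) (mulL2 h g) = dot f g.
Proof. by move=> mh h1; rewrite dot_mulL2// mulL2_conjK. Qed.

Lemma dnorm_mulL2 h f : multiplier h -> unimodular h -> dnorm dot (mulL2 h f) = dnorm dot f.
Proof. by move=> mh h1; rewrite /dnorm dot_mulL2_unimodular. Qed.

Lemma mulL2_lim h u f : multiplier h -> unimodular h -> seq_lim dot u f ->
  seq_lim dot (fun n => mulL2 h (u n)) (mulL2 h f).
Proof.
move=> mh h1 ul; apply: (seq_lim_le _ ul) => n.
rewrite -(dnorm_mulL2 (u n - f) mh h1) le_eqVlt; apply/orP; left; apply/eqP.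
congr dnorm; have := mulL2_linear mh (-1) f (u n); rewrite !scaleN1r.
by rewrite [- f + _]addrC [- mulL2 h f + _]addrC => ->.
Qed.

End Multipliers.

(** * Monomials, the Hardy space and inner functions *)

Section HardySpace.
Variable R : realType.
Local Notation m := (@arc_length R).
Local Notation L2T := (L2 m).
Local Notation dot := (L2dotp m).
Local Notation N := (dnorm dot).
Implicit Types (f g h u : L2T) (a : R[i]) (n k : int).

Lemma L2T_hilbert : hilbert dot.
Proof. exact: L2_hilbert (@arc_length_setT R). Qed.

Lemma unimodular_circleXz n : unimodular m (fun z : circleT R => (z : R[i]) ^ n).
Proof.
apply: aeW => z; rewrite cmodE; congr real_complex_def.
case: n => n; first by rewrite cmodX cmod_circle expr1n.
by rewrite NegzE -exprnN cmodV cmodX cmod_circle expr1n invr1.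
Qed.

Lemma multiplier_circleXz n : multiplier m (fun z : circleT R => (z : R[i]) ^ n).
Proof. exact/bounded_multiplier/bounded_measurable_circleXz. Qed.

Definition emono n : L2T := toL2 m (fun z => (z : R[i]) ^ n).

Lemma emono_sqint n : (fun z : circleT R => (z : R[i]) ^ n) \in sqint m.
Proof.
rewrite (_ : (fun z => _) = (fun z : circleT R => (z : R[i]) ^ n * 1)).
  apply: cLfun2_bounded_mul; first exact: bounded_measurable_circleXz.
  by apply/andP; split; exact: Lfun_cst.
by apply/funext => z; rewrite mulr1.
Qed.

Lemma emonoE n : \forall z \ae m, emono n z = (z : R[i]) ^ n.
Proof. exact: toL2E (emono_sqint n). Qed.

Lemma one_L2_emono : one_L2 R = emono 0.
Proof. by apply: L2_ext; apply: filterS2 (one_L2E R) (emonoE 0) => z -> ->. Qed.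

Lemma dot_emonor f n : dot f (emono n) = fourier_coef f n.
Proof.
rewrite (dot_ae (L2P f) (emono_sqint n) _ (emonoE n)); last exact: aeW.
by congr cintegral; apply/funext => z; rewrite conj_circleXz.
Qed.

Lemma dot_emono n k : dot (emono n) (emono k) = (n == k)%:R.
Proof.
rewrite (dot_ae (emono_sqint n) (emono_sqint k) (emonoE n) (emonoE k)).
rewrite -subr_eq0 -cintegral_circleXz; congr cintegral; apply/funext => z.
by rewrite conj_circleXz -expfzDr ?circle_neq0.
Qed.

Lemma cLfun2_cLfun1 (F : circleT R -> R[i]) : F \in cLfun m 2%:E -> F \in cLfun m 1.
Proof.
have fin : m setT \is a fin_num by rewrite arc_length_setT.
by move=> /andP[f1 f2]; apply/andP; split; exact: (Lfun_subset12 fin).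
Qed.

Lemma emono_total f : (forall n, dot f (emono n) = 0) -> f = 0.
Proof.
move=> H; apply: L2_ext; have n0 : null_coefs f; last first.
  by apply: filterS2 (L2_0E m) (fourier_uniqueness n0) => z -> ->.
split; first exact: cLfun2_cLfun1 (L2P f).
by move=> n; have := H (- n); rewrite dot_emonor /fourier_coef opprK.
Qed.

Lemma mulzE2 f : mulz f = mulL2 (fun z : circleT R => (z : R[i]) ^ 1) f.
Proof. by rewrite /mulz /mulL2; under [in RHS]eq_fun do rewrite expr1z. Qed.

Lemma mulXz_emono n k : mulL2 (fun z : circleT R => (z : R[i]) ^ n) (emono k) = emono (n + k).
Proof.
apply: L2_ext; apply: filterS (filterI (mulL2E (emono k) (multiplier_circleXz n))
  (filterI (emonoE k) (emonoE (n + k)))) => z [-> [-> ->]].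
by rewrite expfzDr ?circle_neq0.
Qed.

Lemma mulz_linear : linear (@mulz R).
Proof.
by move=> a f g; rewrite !mulzE2 (mulL2_linear (multiplier_circleXz 1)).
Qed.

Lemma mulz_emono n : mulz (emono n) = emono (n + 1).
Proof. by rewrite mulzE2 mulXz_emono addrC. Qed.

Lemma dot_mulz_emono f n : dot (mulz f) (emono n) = dot f (emono (n - 1)).
Proof.
rewrite -[n in LHS](subrK 1) -mulz_emono !mulzE2 dot_mulL2_unimodular//.
- exact: multiplier_circleXz.
- exact: unimodular_circleXz.
Qed.

Definition epos (k : nat) : L2T := emono k%:Z.

Lemma orthonormal_epos : orthonormal_seq dot epos.
Proof. by move=> i j; rewrite dot_emono eqz_nat. Qed.

Lemma bessel_epos : bessel dot epos 1.
Proof. exact: bessel_orthonormal orthonormal_epos. Qed.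

Lemma L2plusE : @L2plus R = perp dot [set f | exists2 n, n < 0 & f = emono n].
Proof.
apply/seteqP; split => f /=.
  by move=> Hf _ [n n0 ->]; rewrite dot_emonor Hf.
by move=> Hf n n0; rewrite -dot_emonor; apply: Hf; exists n.
Qed.

Lemma closed_L2plus : closed_subspace dot (@L2plus R).
Proof. by rewrite L2plusE; exact: closed_subspace_perp. Qed.

Lemma L2plusP f : L2plus f <-> forall n, n < 0 -> dot f (emono n) = 0.
Proof. by split=> H n n0; [rewrite dot_emonor|rewrite -dot_emonor]; exact: H. Qed.

Lemma L2plus_epos (k : nat) : L2plus (epos k).
Proof.
by apply/L2plusP => n n0; rewrite dot_emono; case: eqP n0 => // <-.
Qed.

Lemma L2plus_ext f g : L2plus f -> L2plus g ->
  (forall k : nat, dot f (epos k) = dot g (epos k)) -> f = g.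
Proof.
move=> /L2plusP f0 /L2plusP g0 H; apply/eqP; rewrite -subr_eq0; apply/eqP.
apply: emono_total => -[n|n]; rewrite dotBl; first by rewrite -/(epos n) H subrr.
by rewrite f0 ?g0 ?subrr.
Qed.

Lemma L2plus_mixop (x : L2T) : L2plus (mixop dot dot epos epos x).
Proof.
apply: (closed_subspace_lim closed_L2plus _
  (mixop_lim L2T_hilbert ltr01 bessel_epos bessel_epos x)) => n.
apply: (closed_subspace_sum closed_L2plus) => k _.
by apply: (closed_subspaceZ closed_L2plus); exact: L2plus_epos.
Qed.

(** The left side is the limit of the Fourier partial sums over nonnegative frequencies. It has the
    coefficients of [f], so the Fourier series of [f] converges to [f]. *)
Lemma mixop_epos f : L2plus f -> mixop dot dot epos epos f = f.
Proof.
move=> fp; apply: L2plus_ext => //; first exact: L2plus_mixop.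
move=> k; rewrite (dot_synth orthonormal_epos L2T_hilbert)//.
exact: bessel_square_summable bessel_epos.
Qed.

Lemma L2plus_lim f : L2plus f ->
  seq_lim dot (fun n : nat => \sum_(k < n) dot f (epos k) *: epos k) f.
Proof.
move=> fp; have := mixop_lim L2T_hilbert ltr01 bessel_epos bessel_epos f.
by rewrite mixop_epos.
Qed.

Lemma L2plus_orth f (y : L2T) : L2plus f -> (forall k : nat, dot (epos k) y = 0) -> dot f y = 0.
Proof.
move=> /L2plus_lim fl H; apply: (dot_lim_eq fl) => n.
by rewrite dot_suml big1// => k _; rewrite dotZl H mulr0.
Qed.

Lemma L2plus_mulz f : L2plus f -> L2plus (mulz f).
Proof.
move=> /L2plusP f0; apply/L2plusP => n n0; rewrite dot_mulz_emono f0//.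
by rewrite (lt_trans _ n0)// ltrBlDr ltrDl.
Qed.

Lemma mulz_mulL2 (h : circleT R -> R[i]) f : multiplier m h ->
  mulz (mulL2 h f) = mulL2 h (mulz f).
Proof.
move=> mh; rewrite !mulzE2; have mz := multiplier_circleXz 1.
rewrite !mulL2M//; try exact: multiplierM.
by congr mulL2; apply/funext => z; rewrite mulrC.
Qed.

Lemma mulL2plus_self h : mulL2plus h h.
Proof.
exists (one_L2 R); first by rewrite one_L2_emono; exact: L2plus_epos 0%N.
by apply: filterS (one_L2E R) => z ->; rewrite mulr1.
Qed.

Section InnerFunction.
Variables (h : L2T) (ih : inner h).

Lemma inner_unimodular : unimodular m h. Proof. by case: ih. Qed.

Lemma inner_multiplier : multiplier m h.
Proof. exact/unimodular_L2/inner_unimodular. Qed.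

Lemma mulL2plusP u : mulL2plus h u <-> exists2 g, L2plus g & u = mulL2 h g.
Proof.
split=> -[g gp H]; exists g => //.
  by apply: L2_ext; apply: filterS2 H (mulL2E g inner_multiplier) => z -> ->.
by rewrite H; exact: mulL2E inner_multiplier.
Qed.

(** Moving [h] to the other side as its conjugate reduces the claim to [f = z^k], where the
    coefficient of [h z^k] at [n < 0] is that of [h] at [n - k < 0]. *)
Lemma inner_mulL2 f : L2plus f -> L2plus (mulL2 h f).
Proof.
move=> fp; apply/L2plusP => n n0; rewrite dot_mulL2; last exact: inner_multiplier.
apply: (L2plus_orth fp) => k; rewrite -dot_mulL2; last exact: inner_multiplier.
have -> : mulL2 h (epos k) = mulL2 (fun z : circleT R => (z : R[i]) ^ (k%:Z)) h.
  apply: L2_ext; apply: filterS (filterI (mulL2E (epos k) inner_multiplier)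
    (filterI (mulL2E h (multiplier_circleXz k)) (emonoE k))) => z [-> [-> ->]].
  by rewrite mulrC.
have [/L2plusP hp _] := ih.
have -> : emono n = mulL2 (fun z : circleT R => (z : R[i]) ^ (k%:Z)) (emono (n - k%:Z)).
  by rewrite mulXz_emono addrC subrK.
rewrite dot_mulL2_unimodular; [|exact: multiplier_circleXz|exact: unimodular_circleXz].
by apply: hp; rewrite (le_lt_trans _ n0)// lerBlDr lerDl.
Qed.

(** Multiplication by the unimodular [h] is unitary on L2 and so carries the description of L2+ by
    negative frequencies to [h L2+]. This yields closedness and a membership test. *)
Lemma mulL2plus_perp : mulL2plus h =
  perp dot [set f | exists2 n, n < 0 & f = mulL2 h (emono n)].
Proof.
apply/seteqP; split => u /=.
  move=> /mulL2plusP[g /L2plusP gp ->] _ [n n0 ->].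
  by rewrite dot_mulL2_unimodular ?gp//; [exact: inner_multiplier|exact: inner_unimodular].
move=> H; apply/mulL2plusP; exists (mulL2 (fun z => conjC (h z)) u); last first.
  by rewrite mulL2_Kconj//; [exact: inner_multiplier|exact: inner_unimodular].
apply/L2plusP => n n0; rewrite dot_mulL2; last exact: multiplier_conj inner_multiplier.
under eq_fun do rewrite conjCK.
by apply: H; exists n.
Qed.

Lemma mulL2plus_inner_sub u : mulL2plus h u -> L2plus u.
Proof. by move=> /mulL2plusP[g gp ->]; exact: inner_mulL2. Qed.

Lemma mulL2plus_inner_mulz u : mulL2plus h u -> mulL2plus h (mulz u).
Proof.
move=> /mulL2plusP[g gp ->]; apply/mulL2plusP; exists (mulz g); first exact: L2plus_mulz.
by rewrite mulz_mulL2//; exact: inner_multiplier.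
Qed.

Lemma inner_neq0 : h != 0.
Proof.
apply/eqP => h0; have := inner_unimodular; rewrite h0 => H.
have : \forall z \ae m, False.
  apply: filterS2 (L2_0E m) H => z -> /eqP; rewrite normr0 eq_sym oner_eq0//.
move=> [A [mA A0 sA]]; have := @arc_length_setT R; rewrite -(_ : A = setT) ?A0.
  by move=> /eqP; rewrite eq_sym onee_eq0.
by apply/seteqP; split => // z _; apply: sA => /=.
Qed.

End InnerFunction.

Lemma mulL2plus0 : mulL2plus (0 : L2T) = [set 0].
Proof.
apply/seteqP; split => u /=.
  move=> [g _ H]; apply: L2_ext.
  by apply: filterS (filterI H (L2_0E m)) => z [-> ->]; rewrite mul0r.
move=> ->; exists 0; first exact: closed_subspace0 closed_L2plus.
by apply: filterS (L2_0E m) => z ->; rewrite mul0r.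
Qed.

Lemma closed_subspace_set0 : closed_subspace dot [set 0 : L2T].
Proof.
rewrite (_ : [set 0] = perp dot setT); first exact: closed_subspace_perp.
apply/seteqP; split => f /=; first by move=> -> g _; exact: dot0l.
by move=> /(_ f I) /eqP; rewrite dnorm_eq0 => /eqP.
Qed.

(** * Model spaces and their projections *)

Section ModelSpace.
Variables (h : L2T) (hP : inner h \/ h = 0).

Lemma closed_mulL2plus : closed_subspace dot (mulL2plus h).
Proof.
case: hP => [ih| ->]; last by rewrite mulL2plus0; exact: closed_subspace_set0.
by rewrite mulL2plus_perp//; exact: closed_subspace_perp.
Qed.

Lemma mulL2plus_sub u : mulL2plus h u -> L2plus u.
Proof.
case: hP => [ih| ->]; first exact: mulL2plus_inner_sub.
by rewrite mulL2plus0 => ->; exact: closed_subspace0 closed_L2plus.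
Qed.

Lemma mulL2plus_mulz u : mulL2plus h u -> mulL2plus h (mulz u).
Proof.
case: hP => [ih| ->]; first exact: mulL2plus_inner_mulz.
rewrite mulL2plus0 => ->.
by have := mulz_linear (-1) 0 0; rewrite scaler0 addr0 scaleN1r addNr.
Qed.

Lemma model_spaceE : model_space h = @L2plus R `&` perp dot (mulL2plus h).
Proof. by []. Qed.

Lemma closed_model_space : closed_subspace dot (model_space h).
Proof.
rewrite model_spaceE; apply: closed_subspaceI; first exact: closed_L2plus.
exact: closed_subspace_perp.
Qed.

Lemma model_orthproj x p : L2plus x -> model_space h p -> mulL2plus h (x - p) ->
  is_orthproj dot (model_space h) x p.
Proof.
move=> xp Mp xpM; split => // y [yp yM].
by rewrite dotC (_ : dot y (x - p) = 0) ?conjC0//; exact: yM.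
Qed.

(** The projection is made onto [h L2+] and [p] is the remainder; thus [x - p] lies in [h L2+]
    itself, which is the form in which shift invariance can be used. *)
Lemma model_decomposition x : L2plus x ->
  exists2 p, model_space h p & mulL2plus h (x - p).
Proof.
move=> xp; have [q [Mq Hq]] := orthproj_exists x L2T_hilbert closed_mulL2plus.
exists (x - q); last by rewrite opprB addrC subrK.
split; last by move=> u /Hq.
by apply: (closed_subspaceB closed_L2plus) => //; exact: mulL2plus_sub.
Qed.

Lemma model_projE x : L2plus x ->
  model_space h (orthproj dot (model_space h) x) /\
  mulL2plus h (x - orthproj dot (model_space h) x).
Proof.
move=> xp; have [p Mp xpM] := model_decomposition xp.
by rewrite (orthprojE closed_model_space (model_orthproj xp Mp xpM)).
Qed.

Lemma model_proj_eq x p : L2plus x -> model_space h p -> mulL2plus h (x - p) ->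
  orthproj dot (model_space h) x = p.
Proof.
by move=> xp Mp xpM; exact: orthprojE closed_model_space (model_orthproj xp Mp xpM).
Qed.

End ModelSpace.

End HardySpace.

(** * Beurling's theorem *)

Section Beurling.
Variable R : realType.
Local Notation m := (@arc_length R).
Local Notation L2T := (L2 m).
Local Notation dot := (L2dotp m).
Local Notation N := (dnorm dot).
Local Notation zpow n := (fun z : circleT R => (z : R[i]) ^ n).

Lemma mulz_mulXz (f : L2T) (n : int) : mulz (mulL2 (zpow n) f) = mulL2 (zpow (n + 1)) f.
Proof.
have mz := @multiplier_circleXz R; rewrite mulzE2 mulL2M//; last exact: multiplierM.
congr mulL2; apply/funext => z.
by rewrite addrC expfzDr ?circle_neq0.
Qed.

Lemma mulL2_1 (f : L2T) : mulL2 (zpow 0) f = f.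
Proof.
apply: L2_ext; apply: filterS (mulL2E f (@multiplier_circleXz R 0)) => z ->.
by rewrite expr0z mul1r.
Qed.

Lemma mulL2_sum (h : circleT R -> R[i]) (c : nat -> R[i]) (f : nat -> L2T) n :
  multiplier m h ->
  mulL2 h (\sum_(k < n) c k *: f k) = \sum_(k < n) c k *: mulL2 h (f k).
Proof.
move=> mh; have L := mulL2_linear mh; elim: n => [|n IH].
  by rewrite !big_ord0; have := L (-1) 0 0; rewrite scaler0 addr0 scaleN1r addNr.
by rewrite !big_ord_recr/= addrC L IH addrC.
Qed.

Lemma mulL2_emono (h : L2T) (n : int) : multiplier m h ->
  mulL2 h (emono R n) = mulL2 (zpow n) h.
Proof.
move=> mh; apply: L2_ext; apply: filterS (filterI (mulL2E (emono R n) mh)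
  (filterI (mulL2E h (@multiplier_circleXz R n)) (emonoE R n))) => z [-> [-> ->]].
by rewrite mulrC.
Qed.

(** The products of [z^n h] with [h] are the Fourier coefficients of [|h|^2]. They vanish for
    [n > 0] by hypothesis and for [n < 0] by conjugation, so [|h|^2 - 1] has only null
    coefficients. *)
Lemma unimodular_normP (h : L2T) : N h = 1 ->
  (forall n : nat, dot (mulL2 (zpow n.+1) h) h = 0) -> unimodular m h.
Proof.
move=> Nh Hn; have dotz (n : int) : dot (mulL2 (zpow n) h) h =
    cintegral m (fun z => h z * conjC (h z) * (z : R[i]) ^ n).
  rewrite dot_mulL2l; last exact: multiplier_circleXz.
  by congr cintegral; apply/funext => z; rewrite -mulrA mulrC.
have hh1 : (fun z => h z * conjC (h z)) \in cLfun m 1 := cLfun2_mul_conj (L2P h) (L2P h).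
have c1 : (fun=> 1 : R[i]) \in cLfun m 1 by apply/andP; split; exact: Lfun_cst.
have n0 : null_coefs (fun z => (-1) * 1 + h z * conjC (h z)).
  split; first exact: cLfun_linear.
  move=> n; transitivity (cintegral m (fun z =>
      -1 * (1 * (z : R[i]) ^ n) + h z * conjC (h z) * (z : R[i]) ^ n)).
    by congr cintegral; apply/funext => z; rewrite mulrDl mulrA.
  have := @cintegral_linear _ _ _ m (-1) (fun z => 1 * (z : R[i]) ^ n)
    (fun z => h z * conjC (h z) * (z : R[i]) ^ n) (cLfun1_mulXz n c1) (cLfun1_mulXz n hh1).
  move=> ->; under eq_fun do rewrite mul1r.
  rewrite cintegral_circleXz -dotz; case: n => [[|n]|n].
  - by rewrite mulL2_1 dot_dnorm Nh expr1n mulr1 addNr.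
  - by rewrite Hn mulr0 addr0.
  - rewrite mulr0 add0r dot_mulL2; last exact: multiplier_circleXz.
    rewrite dotC NegzE; under eq_fun do rewrite conj_circleXz opprK.
    by rewrite Hn conjC0.
apply: filterS (fourier_uniqueness n0) => z /eqP.
rewrite mulr1 addrC subr_eq0 => /eqP; rewrite mul_conjC => H.
have : cmod (h z) ^+ 2 = 1 by apply: complexI; rewrite H.
move=> /eqP; rewrite sqrf_eq1 => /orP[/eqP c|/eqP c]; first by rewrite cmodE c.
by have := cmod_ge0 (h z); rewrite c ler0N1.
Qed.

(* The function [h] is the projection on K of [z^k], where k is the first frequency
   present in K: it is orthogonal to zK because zK has no frequency below k + 1. *)
Theorem beurling (K : set L2T) : closed_subspace dot K -> K `<=` @L2plus R ->
  (forall x, K x -> K (mulz x)) -> (exists2 x, K x & x != 0) ->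
  exists2 h : L2T, inner h & K = mulL2plus h.
Proof.
move=> cK KL Kz [x0 Kx0 x0n].
pose P k := `[< exists2 x, K x & dot x (epos R k) != 0 >].
have exP : exists k, P k.
  apply: contrapT => /forallNP H; move/eqP: x0n; apply.
  apply: L2plus_ext; [exact: KL|exact: closed_subspace0 (@closed_L2plus R)|move=> k].
  rewrite dot0l; apply/eqP; apply: contra_notT (H k) => xk.
  by apply/asboolP; exists x0.
have [k0 /asboolP[x Kx xk] kmin] := ex_minnP exP.
have [Kg Hg] := orthprojP (epos R k0) (@L2T_hilbert R) cK.
set g := orthproj _ _ _ in Kg Hg.
(* On [K], pairing with [g] reads off the Fourier coefficient of index [k0]. *)
have gE y : K y -> dot y g = dot y (epos R k0).
  move=> Ky; apply/eqP; rewrite -subr_eq0 -dotBr dotC conjC_eq0 -opprB.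
  by rewrite -scaleN1r dotZl Hg// mulr0.
have g0 : g != 0.
  by apply: contra_neq xk => g0; rewrite -gE// g0 dot0r.
have zg y : K y -> dot (mulz y) g = 0.
  move=> Ky; rewrite gE; last exact: Kz.
  rewrite dot_mulz_emono; case: k0 kmin {xk Hg g Kg gE g0} => [|k] kmin.
    by move/L2plusP: (KL _ Ky); apply.
  have -> : k.+1%:Z - 1 = k%:Z by rewrite -addn1 PoszD addrK.
  apply/eqP; apply: contraT => yk.
  have /kmin : P k by apply/asboolP; exists y.
  by rewrite ltnn.
have Ng : N g != 0 by rewrite dnormr_eq0.
pose h : L2T := (N g)^-1%:C *: g.
have Kh : K h by exact: (closed_subspaceZ cK).
have Nh : N h = 1.
  by rewrite dnormrZ cmodR ger0_norm ?invr_ge0 ?dnormr_ge0// mulVf.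
have zh y : K y -> dot (mulz y) h = 0 by move=> Ky; rewrite dotZr zg// mulr0.
have KX y (n : nat) : K y -> K (mulL2 (zpow n) y).
  move=> Ky; elim: n => [|n IH]; first by rewrite mulL2_1.
  by rewrite -addn1 PoszD -mulz_mulXz; exact: Kz.
have zXh y (n : nat) : K y -> dot (mulL2 (zpow n.+1) y) h = 0.
  by move=> Ky; rewrite -addn1 PoszD -mulz_mulXz zh//; exact: KX.
have h1 : unimodular m h by apply: unimodular_normP => // n; exact: zXh.
have ih : inner h by split => //; exact: KL.
have mh := inner_multiplier ih.
exists h => //; apply/seteqP; split => y.
  (* Orthogonality of [y] to [z^n h] with [n < 0] is orthogonality of [z^(-n) y] to [h], and a
     positive power of [z] times an element of [K] is orthogonal to [h]. *)
  move=> Ky; rewrite (mulL2plus_perp ih) => _ [n n0 ->].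
  rewrite mulL2_emono// -[y]mulL2_1 -[n]opprK.
  case: n n0 => // n _; rewrite NegzE opprK.
  rewrite dotC dot_mulL2; last exact: multiplier_circleXz.
  under eq_fun do rewrite conj_circleXz opprK.
  by rewrite mulL2_1 dotC conjCK zXh.
move=> /(mulL2plusP ih)[f fp ->].
(* Conversely [K] contains [h] times every polynomial by shift invariance, and [f] is the limit of
   its Fourier polynomials. *)
apply: (closed_subspace_lim cK _ (mulL2_lim mh h1 (L2plus_lim fp))) => n.
rewrite (mulL2_sum (fun k => dot f (epos R k)) (epos R) n mh).
apply: (closed_subspace_sum cK) => k _; apply: (closed_subspaceZ cK).
by rewrite mulL2_emono//; exact: KX.
Qed.

(** Each function lies in the space of the other: [h1 = h2 g] and [h2 = h1 k] with [g], [k] in L2+.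
    Unimodularity makes [k] the conjugate of [g], so [g] has neither negative nor positive
    frequencies and is constant. *)
Lemma mulL2plus_eq_inner (h1 h2 : L2T) : (inner h1 \/ h1 = 0) -> (inner h2 \/ h2 = 0) ->
  mulL2plus h1 = mulL2plus h2 -> exists c : R[i], `|c| = 1 /\ h1 = c *: h2.
Proof.
have zero (h : L2T) : inner h -> mulL2plus h <> mulL2plus 0.
  move=> ih E; have := mulL2plus_self h; rewrite E mulL2plus0 /= => h0.
  by have := inner_neq0 ih; rewrite h0 eqxx.
move=> [ih1| ->] [ih2| ->] E.
- have m1 := inner_multiplier ih1; have m2 := inner_multiplier ih2.
  have u1 := inner_unimodular ih1; have u2 := inner_unimodular ih2.
  have : mulL2plus h2 h1 by rewrite -E; exact: mulL2plus_self.
  move=> /(mulL2plusP ih2)[g gp h1E].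
  have : mulL2plus h1 h2 by rewrite E; exact: mulL2plus_self.
  move=> /(mulL2plusP ih1)[k kp h2E].
  have gk : \forall z \ae m, `|g z| = 1 /\ k z = conjC (g z).
    have := mulL2E g m2; rewrite -h1E => e1; have := mulL2E k m1; rewrite -h2E => e2.
    apply: filterS (filterI e1 (filterI e2 (filterI u1 u2))) => z [e1z [e2z [u1z u2z]]].
    have h20 : h2 z != 0 by rewrite -normr_eq0 u2z oner_eq0.
    have g1 : `|g z| = 1 by have := u1z; rewrite e1z normrM u2z mul1r.
    split => //; have g0 : g z != 0 by rewrite -normr_eq0 g1 oner_eq0.
    apply: (mulfI g0); rewrite mul_conjC /cmod g1 expr1n.
    apply: (mulfI h20); rewrite mulr1.
    by rewrite [in RHS]e2z e1z mulrA.
  have gn (n : int) : n != 0 -> dot g (emono R n) = 0.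
    case: n => [[|n]|n] // _; last by move/L2plusP: gp; apply.
    have /L2plusP/(_ (- n.+1%:Z) isT) := kp.
    rewrite (dot_ae (L2P k) (emono_sqint _ (- n.+1%:Z)) _ (emonoE _ _)); last exact: aeW.
    rewrite (dot_ae (L2P g) (emono_sqint _ n.+1%:Z) _ (emonoE _ _)); last exact: aeW.
    move=> H; rewrite -[LHS]conjCK -cintegral_conj; last first.
      exact: cLfun2_mul_conj (L2P g) (emono_sqint _ _).
    rewrite -[RHS]conjC0 -H; congr conjC; apply: eq_cintegral.
    - apply: cLfun_conj => //; exact: cLfun2_mul_conj (L2P _) (emono_sqint _ _).
    - exact: cLfun2_mul_conj (L2P _) (emono_sqint _ _).
    - apply: filterS gk => z [_ ->]; rewrite rmorphM/= conjCK !conj_circleXz opprK//.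
  pose c := dot g (emono R 0).
  have gc : g = c *: emono R 0.
    apply/eqP; rewrite -subr_eq0; apply/eqP/emono_total => n.
    rewrite dotBl dotZl dot_emono; have [<-|n0] := eqVneq 0 n; first by rewrite mulr1 subrr.
    by rewrite gn 1?eq_sym// mulr0 subrr.
  exists c; have gz : \forall z \ae m, g z = c.
    by rewrite gc; apply: filterS2 (L2ZE c (emono R 0)) (emonoE R 0) => z -> ->; rewrite expr0z mulr1.
  split.
    have : \forall z \ae m, `|c| = 1 by apply: filterS2 gk gz => z [g1 _] gzE; rewrite -gzE.
    move=> H; apply: contrapT => c1; have : \forall z \ae m, False.
      by apply: filterS H.
    move=> [A [mA A0 sA]]; have := @arc_length_setT R; rewrite -(_ : A = setT) ?A0.
      by move=> /eqP; rewrite eq_sym onee_eq0.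
    by apply/seteqP; split => // z _; apply: sA => /=.
  rewrite h1E; apply: L2_ext.
  apply: filterS (filterI (mulL2E g m2) (filterI gz (L2ZE c h2))) => z [-> [-> ->]].
  by rewrite mulrC.
- by case: (zero _ ih1).
- by case: (zero _ ih2).
- by exists 1; rewrite normr1 scaler0.
Qed.

End Beurling.

(** * Model spaces of finite Blaschke products *)

Section FiniteBlaschke.
Variable R : realType.
Local Notation m := (@arc_length R).
Local Notation L2T := (L2 m).
Local Notation dot := (L2dotp m).
Local Notation N := (dnorm dot).
Implicit Types (f g : L2T) (a : R[i]).

(** Writing [1 / F] as the conjugate of [F] divided by [|F|^2] leaves only a positive real function
    to invert. *)
Lemma bounded_measurableV d (T : measurableType d) (F : T -> R[i]) (e : R) : 0 < e ->
  bounded_measurable F -> (forall x, e <= cmod (F x)) ->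
  bounded_measurable (fun x => (F x)^-1).
Proof.
move=> e0 bF Fe; have [m1 m2 [K HK]] := bF.
pose r x : R := (Re (F x) ^+ 2 + Im (F x) ^+ 2)^-1.
have br : bounded_measurable (fun x => (r x)%:C).
  split.
  - rewrite (_ : _ \o _ = (fun y : R => y `^ (-1)) \o
        (fun x => Re (F x) ^+ 2 + Im (F x) ^+ 2)).
      apply: measurableT_comp; first exact: measurable_powR.
      by apply: measurable_funD; exact: measurable_funX.
    by apply/funext => x /=; rewrite powR_inv1// addr_ge0 ?sqr_ge0.
  - by rewrite (_ : _ \o _ = fun=> 0); [exact: measurable_cst|exact/funext].
  - exists (e ^- 2) => x; rewrite cmodR /r -sqr_cmod ger0_norm ?invr_ge0 ?sqr_ge0//.
    have Fx : 0 < cmod (F x) by exact: lt_le_trans (Fe x).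
    rewrite lef_pV2 ?posrE ?exprn_gt0// lerXn2r ?nnegrE ?cmod_ge0 ?(ltW e0)//.
rewrite (_ : (fun x => _) = (fun x => (r x)%:C * conjC (F x))).
  by apply: bounded_measurableM => //; exact: bounded_measurable_conj.
apply/funext => x; have Fx : F x != 0.
  by rewrite -cmod_eq0 gt_eqF// (lt_le_trans e0).
apply: (mulfI Fx); rewrite divff// mulrCA mul_conjC -rmorphM /r -sqr_cmod mulVf//.
by rewrite sqrf_eq0 cmod_eq0.
Qed.

Section BlaschkeFactor.
Variables (a : R[i]) (a1 : `|a| < 1).

Let ca1 : cmod a < 1. Proof. by rewrite -ltcR -cmodE. Qed.

Lemma cmod_circle_sub (z : circleT R) : 1 - cmod a <= cmod ((z : R[i]) - a).
Proof.
rewrite lerBlDr -(cmod_circle z) -[X in cmod X <= _](subrK a).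
exact: cmodD.
Qed.

Lemma cmod_circle_sub_conj (z : circleT R) : 1 - cmod a <= cmod (1 - conjC a * (z : R[i])).
Proof.
have := cmodD (1 - conjC a * (z : R[i])) (conjC a * (z : R[i])); rewrite subrK.
by rewrite cmod1 cmodM cmodJ cmod_circle mulr1 -lerBlDr.
Qed.

Definition blaschke_factor (z : circleT R) : R[i] := ((z : R[i]) - a) / (1 - conjC a * (z : R[i])).

Let numer (z : circleT R) : R[i] := (z : R[i]) - a.
Let denom (z : circleT R) : R[i] := 1 - conjC a * (z : R[i]).

Let ca10 : 0 < 1 - cmod a. Proof. by rewrite subr_gt0. Qed.

Let bm_numer : bounded_measurable numer.
Proof.
apply: bounded_measurableD; first exact: bounded_measurable_circle.
exact: bounded_measurable_cst.
Qed.

Let bm_denom : bounded_measurable denom.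
Proof.
rewrite /denom; under eq_fun do rewrite -mulNr.
apply: bounded_measurableD; first exact: bounded_measurable_cst.
apply: bounded_measurableM; first exact: bounded_measurable_cst.
exact: bounded_measurable_circle.
Qed.

Let bm_Vnumer : bounded_measurable (fun z => (numer z)^-1).
Proof. exact: bounded_measurableV ca10 bm_numer cmod_circle_sub. Qed.

Lemma bounded_measurable_blaschke_factor : bounded_measurable blaschke_factor.
Proof.
apply: bounded_measurableM => //.
exact: bounded_measurableV ca10 bm_denom cmod_circle_sub_conj.
Qed.

Let numer_neq0 z : numer z != 0.
Proof. by rewrite -cmod_eq0 gt_eqF// (lt_le_trans ca10)// cmod_circle_sub. Qed.

Let denom_neq0 z : denom z != 0.
Proof. by rewrite -cmod_eq0 gt_eqF// (lt_le_trans ca10)// cmod_circle_sub_conj. Qed.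

Let divz f : L2T := mulL2 (fun z => (numer z)^-1) f.

Let divzE f : \forall z \ae m, divz f z = (numer z)^-1 * f z.
Proof. exact: mulL2E (bounded_multiplier m bm_Vnumer). Qed.

Let mulz_divz f : mulz (divz f) = a *: divz f + f.
Proof.
apply: L2_ext; apply: filterS (filterI (mulzE (divz f)) (filterI (L2_linE a (divz f) f) (divzE f))).
move=> z [-> [-> ->]]; rewrite -[X in X * _](subrK a) -/(numer z) mulrDl mulrA.
by rewrite mulfV// mul1r addrC.
Qed.

(** This is [(z - a) (divz f) = f] read at frequency [n]. *)
Let divz_rec f (n : int) :
  dot (divz f) (emono R (n - 1)) = a * dot (divz f) (emono R n) + dot f (emono R n).
Proof. by rewrite -dot_mulz_emono mulz_divz dotDl dotZl. Qed.

Let dnorm_emono (n : int) : N (emono R n) = 1.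
Proof.
have : (N (emono R n) ^+ 2)%:C = 1 :> R[i] by rewrite -dot_dnorm dot_emono eqxx.
move=> /complexI/eqP; rewrite sqrf_eq1 => /orP[/eqP //|/eqP c].
by have := dnormr_ge0 dot (emono R n); rewrite c ler0N1.
Qed.

(* The geometric expansion of [1 / (z - a)] has only negative frequencies. *)
Let divz1_coef0 : dot (divz (emono R 0)) (emono R 0) = 0.
Proof.
set E := divz _.
(* The recurrence trades the coefficient at 0 for the one at [k] at the price [a^k]; coefficients
   are bounded by [N E], so letting [k] grow gives 0. *)
have Ek (k : nat) : dot E (emono R 0) = a ^+ k * dot E (emono R k%:Z).
  elim: k => [|k ->]; first by rewrite mul1r.
  have := divz_rec (emono R 0) k.+1%:Z; rewrite dot_emono addr0 -addn1 PoszD addrK => ->.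
  by rewrite exprD expr1 mulrA.
apply/eqP; rewrite -cmod_eq0 eq_le cmod_ge0 andbT.
have lim0 : (fun k => cmod a ^+ k * N E) @ \oo --> (0 : R).
  rewrite -[X in _ --> X](mul0r (N E)); apply: cvgMl; apply: cvg_expr.
  by rewrite ger0_norm ?cmod_ge0.
apply: (ler_cvg_to (cvg_cst (cmod (dot E (emono R 0)))) lim0); near=> k.
rewrite (Ek k) cmodM cmodX ler_wpM2l ?exprn_ge0 ?cmod_ge0//.
by rewrite (le_trans (dot_le _ _ _))// dnorm_emono mulr1.
Unshelve. all: by end_near. Qed.

Let divz1_coefN1 : dot (divz (emono R 0)) (emono R (-1)) = 1.
Proof.
have := divz_rec (emono R 0) 0; rewrite sub0r => ->.
by rewrite divz1_coef0 mulr0 add0r dot_emono eqxx.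
Qed.

(** The negative coefficients of [f / (z - a)] obey the same recurrence as those of [1 / (z - a)],
    so matching them at frequency -1 cancels them all. Thus [f = (z - a) G + c] with [G] in L2+,
    where [c] is the value at [a] of the analytic extension of [f], and [g = (1 - conjC a z) G]. *)
Lemma blaschke_factor_division f : L2plus f -> exists g (c : R[i]), L2plus g /\
  f = mulL2 blaschke_factor g + c *: emono R 0.
Proof.
move=> /L2plusP fp; set E := divz (emono R 0).
pose c := dot (divz f) (emono R (-1)); pose G := divz f - c *: E.
have Gneg (k : nat) : dot G (emono R (- k.+1%:Z)) = 0.
  elim: k => [|k IH]; first by rewrite dotBl dotZl divz1_coefN1 mulr1 subrr.
  have -> : - k.+2%:Z = - k.+1%:Z - 1 by rewrite -[k.+2]addn1 PoszD opprD.
  have k0 : (0 == - k.+1%:Z) = false by [].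
  have rE := divz_rec (emono R 0) (- k.+1%:Z); have rf := divz_rec f (- k.+1%:Z).
  rewrite (dot_emono R 0 (- k.+1%:Z)) k0 addr0 in rE.
  rewrite (fp (- k.+1%:Z) isT) addr0 in rf.
  move: IH; rewrite /G !(dotBl _ (divz f) (c *: E)) !(dotZl _ c E) rf rE => IH.
  by rewrite mulrCA -mulrBr IH mulr0.
have Gp : L2plus G by apply/L2plusP; case=> // n _; rewrite NegzE; exact: Gneg.
exists (G - conjC a *: mulz G), c; split.
  apply: (closed_subspaceB (@closed_L2plus R)) => //.
  by apply: (closed_subspaceZ (@closed_L2plus R)); exact: L2plus_mulz.
apply: L2_ext; set g := G - _.
apply: filterS (filterI (L2DE (mulL2 blaschke_factor g) (c *: emono R 0))
  (filterI (mulL2E g (bounded_multiplier m bounded_measurable_blaschke_factor))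
  (filterI (L2ZE c (emono R 0)) (filterI (emonoE R 0) (filterI (L2BE G (conjC a *: mulz G))
  (filterI (L2ZE (conjC a) (mulz G)) (filterI (mulzE G) (filterI (L2BE (divz f) (c *: E))
  (filterI (L2ZE c E) (filterI (divzE f) (divzE (emono R 0)))))))))))) => z.
move=> [-> [-> [-> [e0 [-> [-> [-> [-> [-> [-> ->]]]]]]]]]]; rewrite e0 expr0z.
rewrite /blaschke_factor -/(numer z) -/(denom z) !mulr1.
set w := (numer z)^-1 * f z - _.
have -> : w - conjC a * ((z : R[i]) * w) = denom z * w by rewrite /denom mulrBl mul1r mulrA.
rewrite mulrA divfK// /w mulrBr mulrA mulfV// mul1r mulrCA mulfV// mulr1.
by rewrite subrK.
Qed.

End BlaschkeFactor.

Lemma bounded_measurable_blaschke (s : seq R[i]) : (forall a, a \in s -> `|a| < 1) ->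
  bounded_measurable (fun z => \prod_(a <- s) blaschke_factor a z).
Proof.
elim: s => [|a s IH] H.
  by under eq_fun do rewrite big_nil; exact: bounded_measurable_cst.
under eq_fun do rewrite big_cons; apply: bounded_measurableM.
  by apply: bounded_measurable_blaschke_factor; apply: H; rewrite mem_head.
by apply: IH => b bs; apply: H; rewrite in_cons bs orbT.
Qed.

(** What matters is that the remainder vectors [v] depend on [s] alone and not on [f]. *)
Lemma blaschke_division (s : seq R[i]) : (forall a, a \in s -> `|a| < 1) ->
  exists v : nat -> L2T, forall f, L2plus f -> exists g (c : nat -> R[i]), L2plus g /\
    f = mulL2 (fun z => \prod_(a <- s) blaschke_factor a z) g + \sum_(i < size s) c i *: v i.
Proof.
elim: s => [|a s IH] H.
  exists (fun=> 0) => f fp; exists f, (fun=> 0); split => //.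
  rewrite big_ord0 addr0; apply: L2_ext.
  have := mulL2E f (bounded_multiplier m (bounded_measurable_blaschke H)).
  by apply: filterS => z ->; rewrite big_nil mul1r.
have a1 : `|a| < 1 by apply: H; rewrite mem_head.
have Hs b : b \in s -> `|b| < 1 by move=> bs; apply: H; rewrite in_cons bs orbT.
have [v Hv] := IH Hs; pose B z := \prod_(b <- s) blaschke_factor b z.
have mB : multiplier m B := bounded_multiplier m (bounded_measurable_blaschke Hs).
have ma : multiplier m (blaschke_factor a).
  exact: bounded_multiplier (bounded_measurable_blaschke_factor a1).
(* Dividing the previous quotient by the new factor leaves a constant, which appears multiplied by
   the product [B] of the other factors. *)
exists (fun i => if i == size s then mulL2 B (emono R 0) else v i) => f fp.
have [g [c [gp ->]]] := Hv f fp; have [g' [c' [gp' ->]]] := blaschke_factor_division a1 gp.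
exists g', (fun i => if i == size s then c' else c i); split => //.
rewrite /= big_ord_recr/= eqxx [X in _ = _ + X]addrC addrA; congr (_ + _); last first.
  by apply: eq_bigr => i _; rewrite ltn_eqF.
rewrite -/B [_ + c' *: emono R 0]addrC (mulL2_linear mB) addrC; congr (_ + _).
rewrite mulL2M//; last exact: multiplierM.
by congr mulL2; apply/funext => z; rewrite big_cons mulrC.
Qed.

(** Projecting the division identity onto the model space removes the multiple of [h], so the
    projected remainder vectors span. The unimodular constant [c0] is absorbed into the quotient. *)
Theorem model_space_finite_blaschke h : inner h -> finite_blaschke h ->
  exists n (v : nat -> L2T), (forall i, model_space h (v i)) /\
    forall f, model_space h f -> exists c : nat -> R[i], f = \sum_(i < n) c i *: v i.
Proof.
move=> ih [c0 [s [c01 s1 hE]]].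
have [v Hv] := blaschke_division s1; pose M := model_space h.
have hP : inner h \/ h = 0 by left.
have cM : closed_subspace dot M := closed_model_space h.
have PP x := orthprojP x (@L2T_hilbert R) cM.
exists (size s), (fun i => orthproj dot M (v i)); split=> [i|f Mf]; first by case: (PP (v i)).
have [fp fM] := Mf; have [g [c [gp fE]]] := Hv f fp.
exists c; apply: (is_orthproj_unique cM (x := f)).
  by split => // y _; rewrite subrr dot0l.
split; first by apply: (closed_subspace_sum cM) => i _; apply: (closed_subspaceZ cM); case: (PP (v i)).
move=> y My; rewrite {1}fE.
have -> : mulL2 (fun z => \prod_(a <- s) blaschke_factor a z) g = mulL2 h (c0^-1 *: g).
  apply: L2_ext; have mB := bounded_multiplier m (bounded_measurable_blaschke s1).
  apply: filterS (filterI (mulL2E g mB) (filterI (mulL2E (c0^-1 *: g) (inner_multiplier ih))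
    (filterI (L2ZE c0^-1 g) hE))) => z [-> [-> [-> ->]]].
  have c00 : c0 != 0 by rewrite -normr_eq0 c01 oner_eq0.
  by rewrite mulrACA divff// mul1r.
rewrite -addrA -sumrB dotDl (_ : dot (mulL2 h _) y = 0) ?add0r; last first.
  rewrite dotC (_ : dot y (mulL2 h _) = 0) ?conjC0//; apply My.2.
  apply/(mulL2plusP ih); exists (c0^-1 *: g) => //.
  exact: (closed_subspaceZ (@closed_L2plus R)).
rewrite dot_suml big1// => i _; rewrite -scalerBr dotZl.
by case: (PP (v i)) => _ ->//; rewrite mulr0.
Qed.

End FiniteBlaschke.

Lemma linear_comb (R : pzRingType) (U W : lmodType R) (V : {linear U -> W}) n
    (c : nat -> R) (x : nat -> U) :
  V (\sum_(k < n) c k *: x k) = \sum_(k < n) c k *: V (x k).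
Proof. by rewrite linear_sum; apply: eq_bigr => k _; rewrite linearZ. Qed.

Lemma closed_subspaceT (R : realType) (U : lmodType R[i]) (dot : {dot U for conjC}) :
  closed_subspace dot setT.
Proof.
have -> : [set: U] = perp dot set0 by apply/seteqP; split => // x _ y [].
exact: closed_subspace_perp.
Qed.

Lemma eq_seq_lim (R : realType) (U : lmodType R[i]) (dot : {dot U for conjC})
    (u v : nat -> U) x : (forall n, u n = v n) -> seq_lim dot u x -> seq_lim dot v x.
Proof. by move=> uv; have -> : u = v by exact/funext. Qed.

Section OrthogonalProjection.
Variables (R : realType) (U : lmodType R[i]) (dot : {dot U for conjC}).
Hypothesis cU : hilbert dot.
Variables (M : set U) (cM : closed_subspace dot M).
Local Notation P := (orthproj dot M).

Lemma orthproj_linear : linear P.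
Proof.
move=> a x y; have [[Mx Hx] [My Hy]] := (orthprojP x cU cM, orthprojP y cU cM).
apply: (orthprojE cM); split.
  by apply: (closed_subspaceD cM) => //; exact: (closed_subspaceZ cM).
move=> z Mz; have -> : a *: x + y - (a *: P x + P y) = a *: (x - P x) + (y - P y).
  by rewrite scalerBr opprD addrACA.
by rewrite dotDl dotZl Hx// Hy// mulr0 addr0.
Qed.

Lemma dnorm_orthproj_le x : dnorm dot (P x) <= dnorm dot x.
Proof.
have [Mx Hx] := orthprojP x cU cM.
rewrite -(@ler_pXn2r _ 2) ?nnegrE ?dnormr_ge0// -[in leRHS](subrK (P x) x).
by rewrite pythagoras ?Hx// lerDr sqr_ge0.
Qed.

Lemma orthproj_id x : M x -> P x = x.
Proof.
by move=> Mx; apply: (orthprojE cM); split=> // y _; rewrite subrr dot0l.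
Qed.

End OrthogonalProjection.

Definition mk_linear (R : pzRingType) (U W : lmodType R) (f : U -> W) (fl : linear f) :
  {linear U -> W} := HB.pack f (GRing.isLinear.Build R U W *:%R f fl).

(** * Gram-Schmidt orthonormalization *)

Section GramSchmidt.
Variables (R : realType) (U : lmodType R[i]) (dot : {dot U for conjC}).
Local Notation N := (dnorm dot).

Definition span_lt (f : nat -> U) (n : nat) (x : U) : Prop :=
  exists c : nat -> R[i], x = \sum_(i < n) c i *: f i.

Lemma span_lt_linear f n a x y : span_lt f n x -> span_lt f n y -> span_lt f n (a *: x + y).
Proof.
move=> [c ->] [c' ->]; exists (fun i => a * c i + c' i).
rewrite scaler_sumr -big_split/=; apply: eq_bigr => i _.
by rewrite scalerDl scalerA.
Qed.

Lemma span_lt0 f n : span_lt f n 0.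
Proof. by exists (fun=> 0); rewrite big1// => i _; rewrite scale0r. Qed.

Lemma span_lt_widen f n k x : (n <= k)%N -> span_lt f n x -> span_lt f k x.
Proof.
move=> nk [c ->]; exists (fun i => if (i < n)%N then c i else 0).
rewrite (big_ord_widen_cond k xpredT (fun i => c i *: f i))//= big_mkcond/=.
by apply: eq_bigr => i _; case: ifP => //; rewrite scale0r.
Qed.

Lemma span_lt_self f n : span_lt f n.+1 (f n).
Proof.
exists (fun i => (i == n)%:R); rewrite big_ord_recr/= eqxx scale1r big1 ?add0r// => i _.
by rewrite ltn_eqF// scale0r.
Qed.

Lemma span_lt_sum f n k (c : nat -> R[i]) (x : nat -> U) :
  (forall i, (i < k)%N -> span_lt f n (x i)) -> span_lt f n (\sum_(i < k) c i *: x i).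
Proof.
elim: k => [|k IH] H; first by rewrite big_ord0; exact: span_lt0.
rewrite big_ord_recr/= addrC; apply: span_lt_linear; first exact: H.
by apply: IH => i ik; apply: H; rewrite ltnS ltnW.
Qed.

Lemma gram_schmidt (f : nat -> U) : (forall n, ~ span_lt f n (f n)) ->
  exists b : nat -> U, orthonormal_seq dot b /\ forall n, span_lt b n.+1 (f n).
Proof.
move=> fi; pose nrm v : U := (N v)^-1%:C *: v.
pose step s x := x - \sum_(i < size s) dot x (nth 0 s i) *: nth 0 s i.
(* Each new vector needs all its predecessors, so the recursion carries the list of the first [n] of
   them. *)
pose gs := fix gs n := if n is k.+1 then rcons (gs k) (nrm (step (gs k) (f k))) else [::].
have sgs n : size (gs n) = n by elim: n => //= n IH; rewrite size_rcons IH.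
pose b n := nth 0 (gs n.+1) n.
have nthgs n i : (i < n)%N -> nth 0 (gs n) i = b i.
  elim: n => // n IH; rewrite ltnS leq_eqVlt => /orP[/eqP ->//|lin].
  by rewrite [gs n.+1]/= nth_rcons sgs lin IH.
pose v n := f n - \sum_(i < n) dot (f n) (b i) *: b i.
have bE n : b n = nrm (v n).
  rewrite /b [gs n.+1]/= nth_rcons sgs ltnn eqxx /step sgs; congr nrm.
  by congr (_ - _); apply: eq_bigr => i _; rewrite nthgs.
(* This keeps the residuals [v n] nonzero: otherwise [f n] would lie in the span of its
   predecessors. *)
have bspan n : span_lt f n.+1 (b n).
  have [k] := ubnP n; elim: k n => // k IH n; rewrite ltnS => nk.
  rewrite bE -[nrm _]addr0; apply: span_lt_linear; last exact: span_lt0.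
  rewrite /v addrC -scaleN1r; apply: span_lt_linear; last exact: span_lt_self.
  apply: (span_lt_sum (fun i => dot (f n) (b i))) => i lin.
  apply: (@span_lt_widen _ i.+1); first by rewrite ltnW.
  by apply: IH; exact: leq_trans lin nk.
have vn0 n : v n != 0.
  apply/eqP => vn; apply: (fi n); have /eqP := vn; rewrite subr_eq0 => /eqP {1}->.
  apply: (span_lt_sum (fun i => dot (f n) (b i))) => i lin.
  exact: span_lt_widen (bspan i).
have Nv n : N (v n) != 0 by rewrite dnormr_eq0 vn0.
have ortho n : forall i j, (i < n)%N -> (j < n)%N -> dot (b i) (b j) = (i == j)%:R.
  elim: n => // n IH.
  have vb j : (j < n)%N -> dot (v n) (b j) = 0.
    move=> jn; rewrite dotBl dot_suml (bigD1 (Ordinal jn))//= dotZl IH// eqxx mulr1.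
    rewrite big1 ?addr0 ?subrr// => i /negP ij; rewrite dotZl IH//.
    by case: eqP => [e|_]; [exfalso; apply: ij; exact/eqP/val_inj|rewrite mulr0].
  have bb j : (j < n)%N -> dot (b n) (b j) = 0.
    by move=> jn; rewrite [b n]bE dotZl vb// mulr0.
  have nn : dot (b n) (b n) = 1.
    rewrite dot_dnorm bE dnormrZ cmodR ger0_norm ?invr_ge0 ?dnormr_ge0//.
    by rewrite mulVf// expr1n.
  move=> i j; rewrite ltnS leq_eqVlt => /orP[/eqP ->|lin]; rewrite ltnS leq_eqVlt => /orP[/eqP ->|ljn].
  - by rewrite eqxx.
  - by rewrite bb// gtn_eqF.
  - by rewrite dotC bb// conjC0 ltn_eqF.
  - exact: IH.
exists b; split=> [i j|n]; first by apply: (ortho (maxn i j).+1); rewrite ltnS ?leq_maxl ?leq_maxr.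
have -> : f n = (N (v n))%:C *: b n + \sum_(i < n) dot (f n) (b i) *: b i.
  rewrite bE scalerA -rmorphM divff// scale1r /v subrK//.
apply: span_lt_linear; first exact: span_lt_self.
apply: (span_lt_sum (fun i => dot (f n) (b i))) => i lin.
by apply: (@span_lt_widen _ i.+1); [rewrite ltnW|exact: span_lt_self].
Qed.

End GramSchmidt.

Section HilbertNorm.
Variables (R : realType) (H : completeNormedModType R[i]) (dot : {dot H for conjC}).
Hypothesis dot_norm : forall x : H, `|x| ^+ 2 = dot x x.

Lemma normr_dnorm (x : H) : `|x| = (dnorm dot x)%:C.
Proof.
apply/eqP; rewrite -(@eqrXn2 _ 2)// ?ler0c ?dnormr_ge0//.
by rewrite dot_norm dot_dnorm rmorphXn.
Qed.

Lemma completeNormedMod_hilbert : hilbert dot.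
Proof.
move=> u cu; have : cvg (u @ \oo).
  apply/cauchy_cvgP/cauchy_exP => e e0.
  have eR : e = (Re e)%:C by rewrite RRe_real// gtr0_real.
  have : 0 < Re e by rewrite -ltcR -eR.
  move=> /cu[n0 Hn]; exists (u n0); exists n0 => // n /= n0n.
  by rewrite -ball_normE/= normr_dnorm eR ltcR Hn.
move=> /cvg_ex[l ul]; exists l; apply/seq_limP => e e0.
have eC : 0 < e%:C by rewrite -(rmorph0 (real_complex R)) ltcR.
have /cvgrPdist_lt/(_ _ eC)[n0 _ Hn] := ul; exists n0 => n n0n.
by have := Hn n n0n; rewrite /= normr_dnorm ltcR dnormrC.
Qed.

(** Passes from sequential limits to the topological density demanded of an orthonormal basis. *)
Lemma seq_lim_dense (S : set H) :
  (forall y, exists2 u : nat -> H, forall n, S (u n) & seq_lim dot u y) -> dense S.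
Proof.
move=> HS O [y Oy] oO; have [u Su ul] := HS y.
have /(@nbhs_ballP _ _ y)[e /= e0 He] : nbhs y O by exact: open_nbhs_nbhs.
have eR : e = (Re e)%:C by rewrite RRe_real// gtr0_real.
have e0' : 0 < Re e by rewrite -ltcR -eR.
have /seq_limP/(_ _ e0')[n0 Hn] := ul.
exists (u n0); split => //; apply: He; rewrite -ball_normE/= normr_dnorm eR ltcR dnormrC.
exact: Hn.
Qed.

End HilbertNorm.

(** * Frames of orbits *)

Section FrameOrbit.
Variables (R : realType) (H : lmodType R[i]) (dot : {dot H for conjC}).
Hypothesis cH : hilbert dot.
Local Notation m := (@arc_length R).
Local Notation L2T := (L2 m).
Local Notation l2dot := (L2dotp m).
Local Notation epos := (@epos R).
Local Notation cL := (@L2T_hilbert R).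
Local Notation oe := (@orthonormal_epos R).
Local Notation be := (@bessel_epos R).

Section Frame.
Variable f : nat -> H.
Local Notation An := (mixop dot l2dot f epos).

(** By Parseval the extended real series in [is_frame] is the squared norm of the analysis map, so
    the lower frame bound says that this map is bounded below. *)
Lemma frame_sum B g : bessel dot f B ->
  (\sum_(0 <= n <oo) ((Re `|dot g (f n)|) ^+ 2)%:E = (dnorm l2dot (An g) ^+ 2)%:E)%E.
Proof.
move=> bf; apply: cvg_lim => //.
have H1 := parseval_synth oe cL (bessel_square_summable g bf).
under eq_fun do rewrite sumEFin.
apply: cvg_EFin; first by near=> n.
move: H1; apply: cvg_trans; apply: near_eq_cvg; near=> n => /=.
by rewrite big_mkord.
Unshelve. all: by end_near. Qed.

Lemma is_frameP : is_frame dot f <-> exists A B : R, [/\ 0 < A, 0 < B, bessel dot f B &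
  forall g, A * dnorm dot g ^+ 2 <= dnorm l2dot (An g) ^+ 2].
Proof.
split=> [[A [B [A0 B0 Hf]]]|[A [B [A0 B0 bf Hf]]]]; exists A, B; last first.
  split => // g; rewrite (frame_sum g bf) !lee_fin Hf/=.
  by have := mixop_bounded cL ltr01 bf be g; rewrite mul1r.
have bf : bessel dot f B.
  move=> g n; have /andP[_ ub] := Hf g.
  rewrite -lee_fin; apply: le_trans ub.
  have := @nneseries_lim_ge R (fun n => ((Re `|dot g (f n)|) ^+ 2)%:E) xpredT 0%N n.
  rewrite sumEFin big_mkord; apply=> k _ _; by rewrite lee_fin sqr_ge0.
by split => // g; have /andP[] := Hf g; rewrite (frame_sum g bf) lee_fin.
Qed.

End Frame.

Variables (T : {linear H -> H}) (T_bounded : bounded_op dot dot T) (f0 : H).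
Local Notation f := (fun n : nat => iter n T f0).
Local Notation Syn := (mixop l2dot dot epos f).

Section BesselOrbit.
Variables (B : R) (B0 : 0 < B) (bf : bessel dot f B).

(** Multiplication by [z] shifts the coefficients by one, as [T] shifts the orbit. The new term of
    index 0 carries the coefficient of [x] at frequency -1, which is zero in L2+. *)
Lemma mixop_orbit_mulz x : L2plus x -> Syn (mulz x) = T (Syn x).
Proof.
move=> /L2plusP xp; apply: synthE; apply: seq_limSE.
have := bounded_op_lim T_bounded (mixop_lim cH B0 be bf x).
apply: eq_seq_lim => n; rewrite (linear_comb T _ (fun k => l2dot x (epos k)) f) big_ord_recl.
rewrite dot_mulz_emono xp// scale0r add0r; apply: eq_bigr => k _.
rewrite lift0 iterS.
by rewrite dot_mulz_emono -addn1 PoszD addrK.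
Qed.

Lemma mixop_orbit_epos0 : Syn (epos 0%N) = f0.
Proof.
apply: synthE; apply/seq_limP => e e0; exists 1%N => -[//|n] _.
rewrite big_ord_recl dot_emono eqxx scale1r big1 ?addr0 ?subrr ?dnormr0// => k _.
by rewrite dot_emono scale0r.
Qed.

End BesselOrbit.

Section SimilarToModel.
Variables (h : L2T) (hP : inner h \/ h = 0).
Local Notation M := (model_space h).
Local Notation P := (orthproj l2dot M).
Let cM := @closed_model_space R h.
Variables (V : {linear H -> L2T}) (Vinv : L2T -> H).
Hypotheses (bV : bounded_op dot l2dot V) (MV : forall x, M (V x)) (VK : cancel V Vinv).
Hypotheses (VinvK : forall y, M y -> V (Vinv y) = y).
Hypotheses (TV : forall y, M y -> model_op h y = V (T (Vinv y))) (fV : model_vec h = V f0).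

Let Pl : {linear L2T -> L2T} := mk_linear (orthproj_linear cL cM).

Let PlE y : Pl y = P y. Proof. by []. Qed.

Let Pb : bounded_op l2dot l2dot Pl.
Proof. by exists 1 => x; rewrite mul1r; exact: (dnorm_orthproj_le cL cM). Qed.

(** In the induction [model_op h] sends [P z^n] to [P (z P z^n)], which equals [P z^(n+1)] because
    [z (z^n - P z^n)] stays in the shift-invariant [h L2+]. *)
Lemma similar_orbit n : V (f n) = P (epos n).
Proof.
elim: n => [|n IH]; first by rewrite /= -fV /model_vec one_L2_emono.
have -> : V (f n.+1) = model_op h (P (epos n)).
  by rewrite TV -IH ?VK.
have [Mn Kn] := model_projE hP (L2plus_epos R n).
have [Mn1 Kn1] := model_projE hP (L2plus_epos R n.+1).
have Lz : L2plus (mulz (P (epos n))) by apply: L2plus_mulz; case: Mn.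
suff Kd : mulL2plus h (mulz (P (epos n)) - P (epos n.+1)) by exact: (model_proj_eq Lz Mn1 Kd).
have -> : mulz (P (epos n)) - P (epos n.+1) =
    (epos n.+1 - P (epos n.+1)) - mulz (epos n - P (epos n)).
  have mzB (x y : L2T) : mulz (x - y) = mulz x - mulz y.
    by have := @mulz_linear R (-1) y x; rewrite !scaleN1r ![- _ + _]addrC.
  rewrite mzB mulz_emono -[n%:Z + 1]/((n + 1)%N%:Z) addn1 opprB addrC.
  by rewrite [X in _ = X + _]addrC -addrA [X in _ = _ + X]addrC subrK.
apply: (closed_subspaceB (closed_mulL2plus hP)) => //.
exact: (mulL2plus_mulz hP Kn).
Qed.

Lemma similar_synthesis B x : 0 < B -> bessel dot f B -> L2plus x -> V (Syn x) = P x.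
Proof.
move=> B0 bf xp; rewrite (mixop_comp_linear cH B0 be bf x bV).
apply: synthE; have := bounded_op_lim Pb (L2plus_lim xp).
rewrite PlE; apply: eq_seq_lim => n.
rewrite (linear_comb Pl _ (fun k => l2dot x (epos k)) epos); apply: eq_bigr => k _.
by rewrite similar_orbit PlE.
Qed.

(** The right side depends on the orbit only, so two models of the same orbit have the same
    [h L2+]. *)
Lemma similar_kernel B : 0 < B -> bessel dot f B ->
  mulL2plus h = [set x | L2plus x /\ Syn x = 0].
Proof.
move=> B0 bf; apply/seteqP; split => x /=.
  move=> xM; have xp := mulL2plus_sub hP xM; split => //.
  apply: (can_inj VK); rewrite (similar_synthesis B0 bf xp) linear0.
  have xM0 : mulL2plus h (x - 0) by rewrite subr0.
  exact: (model_proj_eq xp (closed_subspace0 cM) xM0).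
move=> [xp x0]; have [_] := model_projE hP xp.
by rewrite -(similar_synthesis B0 bf xp) x0 linear0 subr0.
Qed.

Lemma similar_frame : is_frame dot f.
Proof.
have [C0 HC0] : exists C : R, forall x, dnorm dot x <= C * dnorm l2dot (V x).
  apply: (bounded_inverse cH cL cM bV (can_inj VK) MV) => y My.
  by exists (Vinv y); exact: VinvK.
pose C := `|C0| + 1; have C_gt0 : 0 < C by rewrite ltr_wpDl.
have HC x : dnorm dot x <= C * dnorm l2dot (V x).
  rewrite (le_trans (HC0 x))// ler_wpM2r ?dnormr_ge0//.
  by rewrite (le_trans (ler_norm C0))// lerDl.
have B0 : 0 < C ^+ 2 by rewrite exprn_gt0.
(* The product of [g] with [s] is [Q]. Since [V s] is the projection of the polynomial with the same
   coefficients, the squared norm of [s] is at most [C^2 Q], and Cauchy-Schwarz lets one factor [Q]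
   cancel. *)
have bf : bessel dot f (C ^+ 2).
  move=> g n; set Q := \sum_(k < n) _.
  have Q0 : 0 <= Q by rewrite sumr_ge0// => k _; exact: sqr_ge0.
  pose s := \sum_(k < n) dot g (f k) *: f k.
  have gs : dot g s = Q%:C.
    rewrite dot_sumr rmorph_sum/=; apply: eq_bigr => k _.
    by rewrite dotZr mulrC mul_conjC.
  have Ns : dnorm dot s ^+ 2 <= C ^+ 2 * Q.
    rewrite (@le_trans _ _ ((C * dnorm l2dot (V s)) ^+ 2))//.
      by rewrite ler_pXn2r ?nnegrE ?HC ?mulr_ge0 ?dnormr_ge0 ?(ltW C_gt0).
    rewrite exprMn ler_pM2l//.
    have -> : V s = Pl (\sum_(k < n) dot g (f k) *: epos k).
      rewrite /s (linear_comb V _ (fun k => dot g (f k)) f).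
      rewrite (linear_comb Pl _ (fun k => dot g (f k)) epos); apply: eq_bigr => k _.
      by rewrite similar_orbit PlE.
    rewrite (@le_trans _ _ (dnorm l2dot (\sum_(k < n) dot g (f k) *: epos k) ^+ 2))//.
      by rewrite ler_pXn2r ?nnegrE ?dnormr_ge0//; exact: (dnorm_orthproj_le cL cM).
    by rewrite (sqr_dnorm_orthonormal_sum oe (fun k => dot g (f k))).
  have QQ : Q ^+ 2 <= dnorm dot g ^+ 2 * (C ^+ 2 * Q).
    apply: (@le_trans _ _ ((dnorm dot g * dnorm dot s) ^+ 2)).
      rewrite ler_pXn2r ?nnegrE ?mulr_ge0 ?dnormr_ge0//.
      by have := dot_le dot g s; rewrite gs cmodR ger0_norm.
    by rewrite exprMn ler_wpM2l ?sqr_ge0.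
  have [Q_eq0|Qn0] := eqVneq Q 0; first by rewrite Q_eq0 mulr_ge0 ?sqr_ge0.
  have Qp : 0 < Q by rewrite lt_neqAle eq_sym Qn0.
  rewrite -(ler_pM2r Qp) -expr2 (le_trans QQ)// le_eqVlt; apply/orP; left; apply/eqP; ring.
have [K K0 HK] := bounded_opP bV.
apply/is_frameP; exists (K ^- 2), (C ^+ 2); split => //; first by rewrite invr_gt0 exprn_gt0.
move=> g; set An := mixop dot l2dot _ _ _.
(* As [V Syn] is the projection and [V g] is in the model space, [V] is a right inverse of [Syn]. So
   the squared norm of [g] is the product of [V g] with [An], which yields the lower constant
   [K ^- 2]. *)
have gE : Syn (V g) = g.
  apply: (can_inj VK); rewrite (similar_synthesis B0 bf (MV g).1).
  exact: (orthproj_id cM (MV g)).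
have le1 : dnorm dot g <= K * dnorm l2dot An.
  have [->|g0] := eqVneq g 0; first by rewrite dnormr0 mulr_ge0 ?dnormr_ge0 ?ltW.
  have Ng : 0 < dnorm dot g by rewrite lt_neqAle eq_sym dnormr_eq0 g0 dnormr_ge0.
  rewrite -(ler_pM2r Ng) -expr2 dnormE -{1}gE.
  rewrite (mixop_adjoint cL cH ltr01 B0 be bf) -/An (le_trans (ler_Re_cmod _))//.
  rewrite (le_trans (dot_le _ _ _))// [leRHS]mulrAC ler_wpM2r ?dnormr_ge0//.
rewrite mulrC ler_pdivrMr ?exprn_gt0// mulrC -exprMn.
have KA0 : 0 <= K * dnorm l2dot An by rewrite mulr_ge0 ?dnormr_ge0 ?ltW.
by rewrite ler_pXn2r ?nnegrE ?dnormr_ge0.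
Qed.

End SimilarToModel.

Lemma similar_to_modelP h : similar_to_model dot T f0 h <->
  exists (V : {linear H -> L2T}) (Vinv : L2T -> H),
    [/\ bounded_op dot l2dot V,
        (forall x, model_space h (V x)) /\ cancel V Vinv,
        forall y, model_space h y -> V (Vinv y) = y,
        forall y, model_space h y -> model_op h y = V (T (Vinv y)) &
        model_vec h = V f0].
Proof. by []. Qed.

Lemma frame_similar : is_frame dot f ->
  exists2 h, inner h \/ h = 0 & similar_to_model dot T f0 h.
Proof.
move=> /is_frameP[A [B [A0 B0 bf lowA]]].
pose An := mixop dot l2dot f epos.
have adj x y : dot (Syn x) y = l2dot x (An y) := mixop_adjoint cL cH ltr01 B0 be bf x y.
pose K := [set x : L2T | L2plus x /\ Syn x = 0].
(* The kernel of [Syn] is the orthogonal complement of the range of its adjoint; closedness of [K]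
   follows at once. *)
have KE : K = @L2plus R `&` perp l2dot (range An).
  apply/seteqP; split => x [xp xK]; split => //.
    by move=> _ [y _ <-]; rewrite -adj xK dot0l.
  by apply/eqP; rewrite -(dnorm_eq0 dot) adj xK.
have cK : closed_subspace l2dot K.
  rewrite KE; apply: closed_subspaceI; first exact: closed_L2plus.
  exact: closed_subspace_perp.
have SynL : linear Syn := mixop_linear cH B0 be bf.
have AnL : linear An := mixop_linear cL ltr01 bf be.
have Kz x : K x -> K (mulz x).
  move=> [xp x0]; split; first exact: L2plus_mulz.
  rewrite (mixop_orbit_mulz B0 bf xp) x0; exact: linear0.
have [h hP hK] : exists2 h : L2T, inner h \/ h = 0 & mulL2plus h = K.
  (* Beurling's theorem needs a nonzero element; a trivial kernel is the case [h = 0]. *)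
  have [K0|] := pselect (K = [set 0]); first by exists 0; [right|rewrite mulL2plus0 K0].
  move=> Kn0; have [h ih Kh] : exists2 h : L2T, inner h & K = mulL2plus h.
    apply: beurling => //; first by move=> x [].
    apply: contrapT => Hx; apply: Kn0; apply/seteqP; split => x /=.
      move=> Kx; apply: contrapT => x0; apply: Hx; exists x => //; exact/eqP.
    by move=> ->; exact: closed_subspace0 cK.
  by exists h; [left|rewrite Kh].
exists h => //.
have AnM y : model_space h (An y).
  split; first by apply: (closed_subspace_lim (@closed_L2plus R) _
      (mixop_lim cL ltr01 bf be y)) => n;
    apply: (closed_subspace_sum (@closed_L2plus R)) => k _;
    apply: (closed_subspaceZ (@closed_L2plus R)); exact: L2plus_epos.
  move=> u; rewrite hK => -[up u0]; rewrite -[LHS]/(l2dot (An y) u) dotC -adj u0 dot0l.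
  exact: conjC0.
pose S y := Syn (An y).
have [KA KA0 HKA] := bounded_opP (mixop_bounded_op cL B0 ltr01 bf be).
have [KS KS0 HKS] := bounded_opP (mixop_bounded_op cH ltr01 B0 be bf).
have Scoer y : A * dnorm dot y ^+ 2 <= Re (dot (S y) y).
  by rewrite adj -dnormE lowA.
have SL : linear S by move=> a x y; rewrite /S AnL SynL.
have surjS y : exists x, S x = y.
  have [] := @lax_milgram _ _ dot setT S A (KS * KA) cH _ A0 _ _ _ _ _ y I; last by move=> x _ <-; exists x.
  - exact: closed_subspaceT.
  - exact: mulr_gt0.
  - by [].
  - by move=> a x z _ _; exact: SL.
  - by move=> x _; rewrite (le_trans (HKS _))// -mulrA ler_wpM2l ?HKA// ltW.
  - by move=> x _; exact: Scoer.
have /choice[Si HSi] := surjS.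
have NS y : A * dnorm dot y <= dnorm dot (S y).
  have [->|y0] := eqVneq y 0; first by rewrite dnormr0 mulr0 dnormr_ge0.
  have Ny : 0 < dnorm dot y by rewrite lt_neqAle eq_sym dnormr_eq0 y0 dnormr_ge0.
  rewrite -(ler_pM2r Ny) -mulrA -expr2 (le_trans (Scoer y))//.
  by rewrite (le_trans (ler_Re_cmod _))// dot_le.
have Sinj x y : S x = S y -> x = y.
  move=> Sxy; apply/eqP; rewrite -subr_eq0 -(dnormr_eq0 dot) eq_le dnormr_ge0 andbT.
  rewrite -(ler_pM2l A0) mulr0; apply: (le_trans (NS _)).
  have -> : x - y = -1 *: y + x by rewrite scaleN1r addrC.
  by rewrite SL Sxy scaleN1r addNr dnormr0.
have SiL : linear Si by move=> a x y; apply: Sinj; rewrite SL !HSi.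
have VL : linear (fun y => An (Si y)) by move=> a x y; rewrite SiL AnL.
pose V := mk_linear VL.
have KM x : K x -> model_space h x -> x = 0.
  move=> Kx [_ xM]; apply/eqP; rewrite -(dnorm_eq0 l2dot); apply/eqP.
  by apply: xM; rewrite hK.
(* [Syn (V (Syn w)) = S (Si (Syn w)) = Syn w], so [w - V (Syn w)] lies in the kernel [h L2+], while
   the range of [An] lies in the model space. *)
have VSyn w : L2plus w -> orthproj l2dot (model_space h) w = V (Syn w).
  move=> wp; suff Kd : mulL2plus h (w - V (Syn w)) by exact: (model_proj_eq wp (AnM _) Kd).
  rewrite hK; split.
    by apply: (closed_subspaceB (@closed_L2plus R)) => //; case: (AnM (Si (Syn w))).
  have -> : w - V (Syn w) = -1 *: An (Si (Syn w)) + w by rewrite scaleN1r addrC.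
  by rewrite SynL -/(S _) HSi scaleN1r addNr.
apply/similar_to_modelP; exists V, Syn; split.
(* Coercivity bounds the inverse [Si] by [1 / A]. *)
- exists (KA / A) => y; rewrite (le_trans (HKA _))// -mulrA ler_wpM2l ?(ltW KA0)//.
  by rewrite mulrC ler_pdivlMr// mulrC (le_trans (NS _))// HSi.
- by split=> [x|x]; [exact: AnM|exact: HSi].
- move=> y My; rewrite -VSyn ?(orthproj_id (@closed_model_space R h))//; by case: My.
- move=> y [yp My]; rewrite -(mixop_orbit_mulz B0 bf yp) -VSyn//.
  exact: L2plus_mulz.
- by rewrite /model_vec one_L2_emono -mixop_orbit_epos0 VSyn//; exact: (L2plus_epos R 0%N).
Qed.

(** Pulled back along [V], a finite spanning family of the model space would span [H]. *)
Lemma similar_infinite_blaschke h : infinite_dimensional H -> inner h ->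
  similar_to_model dot T f0 h -> ~ finite_blaschke h.
Proof.
move=> infH ih /similar_to_modelP[V [Vinv [_ [MV VK] VinvK _ _]]] fb.
have [n [v [Mv Hv]]] := model_space_finite_blaschke ih fb.
have [x Hx] := infH n (fun i => Vinv (v i)); have [c Vx] := Hv _ (MV x).
have /eqP[] := Hx (fun i => c i); apply: (can_inj VK); rewrite Vx linear_sum/=.
by apply: eq_bigr => i _; rewrite linearZ/= VinvK.
Qed.

End FrameOrbit.

(** * Riesz bases and injectivity of synthesis *)

Section RieszBasis.
Variables (R : realType) (H : completeNormedModType R[i]) (dot : {dot H for conjC}).
Hypothesis dot_norm : forall x : H, `|x| ^+ 2 = dot x x.
Local Notation m := (@arc_length R).
Local Notation L2T := (L2 m).
Local Notation l2dot := (L2dotp m).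
Local Notation epos := (@epos R).
Local Notation cL := (@L2T_hilbert R).
Local Notation oe := (@orthonormal_epos R).
Local Notation be := (@bessel_epos R).
Let cH : hilbert dot := completeNormedMod_hilbert dot_norm.

Variables (f : nat -> H) (B : R) (B0 : 0 < B) (bf : bessel dot f B).
Local Notation Syn := (mixop l2dot dot epos f).

(** Synthesis along [f] is [W] after synthesis along an orthonormal basis: [W] is injective, and the
    orthonormal synthesis returns its coefficients. *)
Lemma riesz_basis_synthesis_inj x : is_riesz_basis dot f -> L2plus x ->
  Syn x = 0 -> x = 0.
Proof.
move=> [b [W [[ob _] bW [W' WK _] fW]]] xp x0.
have bb := bessel_orthonormal ob.
pose y := mixop l2dot dot epos b x.
have Wy : W y = 0.
  have fE : (fun k => W (b k)) = f by apply/funext => k; rewrite fW.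
  by rewrite /y (mixop_comp_linear cH ltr01 be bb x bW) fE.
have y0 : y = 0 by apply: (can_inj WK); rewrite Wy linear0.
have p0 : L2plus (0 : L2T) := closed_subspace0 (@closed_L2plus R).
apply: (L2plus_ext xp p0) => k; rewrite dot0l.
have <- := dot_synth ob cH k (bessel_square_summable x be).
by rewrite -[synth _ _ _]/y y0 dot0l.
Qed.

Variables (V : {linear H -> L2T}) (bV : bounded_op dot l2dot V).
Hypotheses (Vf : forall n, V (f n) = epos n) (SynV : forall y, Syn (V y) = y).

(* The Gram-Schmidt basis b of f is mapped to f by W = mixop b f, and W is inverted
   by y |-> mixop epos b (V y). *)
Lemma synthesis_inj_riesz_basis : is_riesz_basis dot f.
Proof.
(* A linear relation among the vectors of [f] would be carried by [V] to one among the monomials. *)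
have fi n : ~ span_lt f n (f n).
  move=> [c fE]; have := congr1 (fun y => l2dot (V y) (epos n)) fE.
  rewrite (linear_comb V _ c f) Vf dot_suml oe eqxx big1 => [/eqP|k _].
    by rewrite oner_eq0.
  by rewrite dotZl Vf oe ltn_eqF// mulr0.
have [b [ob bsp]] := gram_schmidt dot fi.
have bb := bessel_orthonormal ob.
have span_b n k : (k <= n)%N -> forall y, span_lt b n (\sum_(i < k) l2dot (V y) (epos i) *: f i).
  move=> kn y; apply: (span_lt_sum (fun i => l2dot (V y) (epos i))) => i ik.
  exact: span_lt_widen (leq_trans ik kn) (bsp i).
have Synlim y : seq_lim dot (fun n => \sum_(k < n) l2dot (V y) (epos k) *: f k) y.
  by rewrite -[X in seq_lim _ _ X](SynV y); exact: (mixop_lim cH B0 be bf (V y)).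
(* Such a [w] is orthogonal to every finite combination of the vectors of [f], and some of these
   converge to [w]. *)
have b_total w : (forall k, dot w (b k) = 0) -> w = 0.
  move=> wb; apply/eqP; rewrite -(dnorm_eq0 dot); apply/eqP.
  apply: (dot_lim_eq (Synlim w)) => n; have [c ->] := span_b n n (leqnn n) w.
  by rewrite dot_suml big1// => k _; rewrite dotZl dotC wb conjC0 mulr0.
pose W := mk_linear (mixop_linear cH B0 bb bf).
have bW : bounded_op dot dot W := mixop_bounded_op cH ltr01 B0 bb bf.
have Wb n : W (b n) = f n.
  apply: synthE; apply/seq_limP => e e0; exists n.+1 => k nk.
  rewrite (bigD1 (Ordinal nk))//= ob eqxx scale1r big1 ?addr0 ?subrr ?dnormr0// => i /negP ik.
  rewrite ob; case: eqP => [ni|_]; last by rewrite scale0r.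
  by exfalso; apply: ik; exact/eqP/val_inj.
exists b, W; split => //; first split => //.
  apply: (seq_lim_dense dot_norm) => y.
  exists (fun n => \sum_(k < n) l2dot (V y) (epos k) *: f k); last exact: Synlim.
  by move=> n; have [c ->] := span_b n n (leqnn n) y; exists n, c.
exists (fun y => mixop l2dot dot epos b (V y)) => [x|y]; last first.
  rewrite (mixop_comp_linear cH ltr01 be bb (V y) bW).
  have -> : (fun k => W (b k)) = f by apply/funext => k; rewrite Wb.
  exact: SynV.
(* Both vectors have the same coefficients along [b]: [V] carries [W x] to the series with
   coefficients [dot x (b k)] along the monomials, and synthesis along [b] returns them. *)
apply/eqP; rewrite -subr_eq0; apply/eqP/b_total => k; rewrite dotBl.
rewrite (dot_synth ob cH k (bessel_square_summable _ be)).
rewrite (mixop_comp_linear cH B0 bb bf x bV).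
have -> : (fun k => V (f k)) = epos by apply/funext => n; rewrite Vf.
by rewrite (dot_synth oe cL k (bessel_square_summable x bb)) subrr.
Qed.

End RieszBasis.

Local Close Scope complex_scope.

Theorem theorem3p4 (R : realType) (H : completeNormedModType R[i])
  (dot : {dot H for conjC}) (dot_norm : forall x : H, `|x| ^+ 2 = dot x x)
  (H_separable : separable H) (H_infdim : infinite_dimensional H)
  (T : {linear H -> H}) (T_bounded : bounded_op dot dot T) (f0 : H) :
  (is_frame dot (fun n : nat => iter n T f0) <->
   exists h : L2 (@arc_length R),
     (inner_star h \/ h = 0) /\ similar_to_model dot T f0 h) /\
  (is_frame dot (fun n : nat => iter n T f0) ->
   (forall h1 h2 : L2 (@arc_length R),
      (inner_star h1 \/ h1 = 0) -> similar_to_model dot T f0 h1 ->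
      (inner_star h2 \/ h2 = 0) -> similar_to_model dot T f0 h2 ->
      exists c : R[i], `|c| = 1 /\ h1 = c *: h2) /\
   (forall h : L2 (@arc_length R),
      (inner_star h \/ h = 0) -> similar_to_model dot T f0 h ->
      (is_riesz_basis dot (fun n : nat => iter n T f0) <-> h = 0))).
Proof.
have cH : hilbert dot := completeNormedMod_hilbert dot_norm.
have inner_starW (h : L2 (@arc_length R)) : inner_star h \/ h = 0 -> inner h \/ h = 0.
  by move=> [[ih _]|->]; [left|right].
split; [split=> [fr|[h [/inner_starW hP]]]|].
- have [h hP hT] := frame_similar cH T_bounded fr; exists h; split => //.
  case: hP => [ih|->]; [left; split => //|by right].
  exact: similar_infinite_blaschke H_infdim ih hT.
- move=> /similar_to_modelP[V [Vinv [bV [MV VK] VinvK TV fV]]].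
  exact: (similar_frame cH hP bV MV VK VinvK TV fV).
move=> /is_frameP[A [B [A0 B0 bf _]]]; split=> [h1 h2|h].
  move=> /inner_starW hP1 /similar_to_modelP[V1 [V1' [bV1 [MV1 VK1] _ TV1 fV1]]].
  move=> /inner_starW hP2 /similar_to_modelP[V2 [V2' [bV2 [MV2 VK2] _ TV2 fV2]]].
  apply: (mulL2plus_eq_inner hP1 hP2).
  (* Both spaces are the kernel of one synthesis map, seen through two similarities. *)
  rewrite (similar_kernel cH hP1 bV1 MV1 VK1 TV1 fV1 B0 bf).
  by rewrite (similar_kernel cH hP2 bV2 MV2 VK2 TV2 fV2 B0 bf).
move=> /inner_starW hP /similar_to_modelP[V [V' [bV [MV VK] _ TV fV]]].
split=> [rb|h0].
  have Kh := similar_kernel cH hP bV MV VK TV fV B0 bf.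
  (* As [h] belongs to [h L2+], synthesis kills it, and injectivity gives [h = 0]. *)
  have := mulL2plus_self h; rewrite Kh => -[hp Sh].
  exact: (riesz_basis_synthesis_inj dot_norm rb hp Sh).
have cM := @closed_model_space R h.
(* For [h = 0] the model projection fixes all monomials, so [V] sends the orbit exactly to the
   powers of [z]. *)
have ML : model_space h = @L2plus R.
  rewrite h0; apply/seteqP; split=> [x []//|x xp]; split => // u.
  by rewrite mulL2plus0 => ->; rewrite -[LHS]/(L2dotp _ x 0) dot0r.
apply: (synthesis_inj_riesz_basis dot_norm B0 bf bV) => [n|y].
  rewrite (similar_orbit hP MV VK TV fV); apply: (orthproj_id cM).
  by rewrite ML; exact: L2plus_epos.
apply: (can_inj VK); rewrite (similar_synthesis cH hP bV MV VK TV fV B0 bf (MV y).1).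
exact: (orthproj_id cM (MV y)).
Qed.
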